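(* There exist (sub-Riemannian) Carnot groups of step $2$ whose geodesic dimension $N_{GEO}$ and curvature exponent $N_{CE}$ satisfy $N_{GEO}<N_{CE}$.
   Context: A Carnot group is a connected simply connected Lie group $G$ whose Lie algebra $\mathfrak g$ has a fixed stratification $\mathfrak g=\bigoplus_{j=1}^s V_j$ (a linear splitting with $[V_1,V_j]=V_{j+1}$ for $1\le j\le s-1$, $[V_1,V_s]=\{0\}$, $V_s\ne\{0\}$; $s$ is the step) and a fixed scalar product on $V_1$. The left-invariant bundle generated by $V_1$ with its scalar product determines the sub-Riemannian distance $d$ on $G$. Let $\mathrm{vol}$ be a Haar measure and $e$ the identity element. For $E\subset G$, $t\in[0,1]$, put $Z_t(p,E)=\{z\in G:\exists q\in E,\ d(p,z)=t\,d(p,q),\ d(z,q)=(1-t)d(p,q)\}$. Let $\mathscr F$ be the family of bounded measurable $E\subset G$ with $0<\mathrm{vol}(E)<\infty$. Then (independently of the base point, so taken to be $e$) $$N_{GEO}=\inf\Big\{N>0:\sup_{E\in\mathscr F}\limsup_{t\to0}\frac{\mathrm{vol}(Z_t(e,E))}{t^N\mathrm{vol}(E)}=\infty\Big\},$$ $$N_{CE}=\inf\{N>0:\mathrm{vol}(Z_t(e,E))\ge t^N\mathrm{vol}(E)\ \forall t\in[0,1],\ \forall E\in\mathscr F\}.$$ *)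

(* Defs.v *)
From HB Require Import structures.
From mathcomp Require Import all_boot all_order all_algebra.
From mathcomp Require Import all_classical all_reals all_analysis.

Set Implicit Arguments.
Unset Strict Implicit.
Unset Printing Implicit Defensive.

Import Order.TTheory GRing.Theory Num.Theory.
Import numFieldNormedType.Exports.

Local Open Scope classical_set_scope.
Local Open Scope ring_scope.

(* In finite dimension, [f] is of class C^(k+1) iff it is differentiable and
   all its directional derivatives are of class C^k. *)
Fixpoint classC (R : realType) (U V : normedModType R) (k : nat) (f : U -> V)
    : Prop :=
  match k with
  | 0 => continuous f
  | k'.+1 => (forall x, differentiable f x) /\
             (forall v, classC k' (fun x => 'D_v f x))
  end.

Definition smooth (R : realType) (U V : normedModType R) (f : U -> V) : Prop :=
  forall k, classC k f.

(* Lie groups whose underlying manifold is R^n. They are connected and simply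
   connected; conversely the exponential map of a connected simply connected
   nilpotent Lie group is a diffeomorphism from its Lie algebra, so every
   Carnot group is isomorphic to a Lie group of this kind. The law need not be
   given in exponential coordinates. *)
Record lieGroup (R : realType) (n : nat) := LieGroup {
  lgmul : 'rV[R]_n -> 'rV[R]_n -> 'rV[R]_n;
  lgone : 'rV[R]_n;
  lginv : 'rV[R]_n -> 'rV[R]_n;
  lgmulA : associative lgmul;
  lgmul1l : left_id lgone lgmul;
  lgmulVl : left_inverse lgone lginv lgmul;
  lgmul_smooth :
    smooth (fun pq : 'rV[R]_n * 'rV[R]_n => lgmul pq.1 pq.2);
  lginv_smooth : smooth lginv
}.

(* The value at [p] of the left-invariant vector field extending the tangent
   vector [X] at the identity, i.e. the differential at the identity of the
   left translation by [p], applied to [X]. *)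
Definition left_field (R : realType) (n : nat) (G : lieGroup R n)
    (X p : 'rV[R]_n) : 'rV[R]_n :=
  'D_X (lgmul G p) (lgone G).

Definition field_bracket (R : realType) (n : nat)
    (X Y : 'rV[R]_n -> 'rV[R]_n) (p : 'rV[R]_n) : 'rV[R]_n :=
  'D_(X p) Y p - 'D_(Y p) X p.

(* The Lie algebra of [G] is the tangent space at the identity. *)
Definition lie_bracket (R : realType) (n : nat) (G : lieGroup R n)
    (X Y : 'rV[R]_n) : 'rV[R]_n :=
  field_bracket (left_field G X) (left_field G Y) (lgone G).

(* [A, B], the linear span of the brackets; bases suffice by bilinearity (as
   for [prodv] in falgebra). *)
Definition bracketv (R : realType) (n : nat) (G : lieGroup R n)
    (A B : {vspace 'rV[R]_n}) : {vspace 'rV[R]_n} :=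
  <<[seq lie_bracket G x y | x <- vbasis A, y <- vbasis B]>>%VS.

(* [layer j] is V_j for 1 <= j <= step; its other values are irrelevant. *)
Record carnotGroup (R : realType) (n : nat) := CarnotGroup {
  cgroup :> lieGroup R n;
  step : nat;
  layer : nat -> {vspace 'rV[R]_n};
  scalar_product : {dot subvs_of (layer 1) for idfun};
  step_gt0 : (0 < step)%N;
  layer_direct : directv (\sum_(j < step) layer j.+1)%VS;
  layer_full : (\sum_(j < step) layer j.+1)%VS = fullv;
  layer_bracket : forall j, (1 <= j < step)%N ->
    bracketv cgroup (layer 1) (layer j) = layer j.+1;
  layer_bracket_step : bracketv cgroup (layer 1) (layer step) = 0%VS;
  layer_step_neq0 : layer step <> 0%VS
}.

(* [gamma] : [0, 1] -> G is absolutely continuous with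
   gamma'(s) = (d L_(gamma s)) (u s), u s in V_1, for almost every s, stated in
   integral form. The integrand is integrable because the coordinates of [u]
   are and [gamma] is continuous. *)
Definition horizontal (R : realType) (n : nat) (G : carnotGroup R n)
    (gamma : R -> 'rV[R]_n) (u : R -> subvs_of (layer G 1)) : Prop :=
  [/\ {within `[0, 1], continuous gamma},
      forall i, lebesgue_measure.-integrable `[0, 1]
                  (fun s => (vsval (u s) 0 i)%:E) &
      forall t, t \in `[0, 1] -> forall i,
        gamma t 0 i = gamma 0 0 i +
          \int[lebesgue_measure]_(s in `[0, t])
             (left_field G (vsval (u s)) (gamma s) 0 i)].

Definition curve_length (R : realType) (n : nat) (G : carnotGroup R n)
    (u : R -> subvs_of (layer G 1)) : \bar R :=
  (\int[lebesgue_measure]_(s in `[0%R, 1%R])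
     (Num.sqrt (scalar_product G (u s) (u s)))%:E)%E.

Definition sr_dist (R : realType) (n : nat) (G : carnotGroup R n)
    (p q : 'rV[R]_n) : \bar R :=
  ereal_inf [set l | exists gamma u,
    [/\ horizontal (G := G) gamma u, gamma 0 = p, gamma 1 = q &
        l = curve_length u]].

Definition borel (R : realType) (n : nat) : measurableType _ :=
  g_sigma_algebraType (@open 'rV[R]_n).

(* Regularity is automatic on R^n. *)
Definition is_haar (R : realType) (n : nat) (G : lieGroup R n)
    (vol : {measure set (borel R n) -> \bar R}) : Prop :=
  [/\ forall (p : 'rV[R]_n) (A : set (borel R n)), measurable A ->
        vol (lgmul G p @` A) = vol A,
      forall K : set 'rV[R]_n, compact K -> (vol K < +oo)%E &
      (0 < vol setT)%E].

Definition geo_interp (R : realType) (n : nat) (G : carnotGroup R n) (t : R)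
    (p : 'rV[R]_n) (E : set 'rV[R]_n) : set 'rV[R]_n :=
  [set z | exists2 q, E q &
     sr_dist G p z = (t%:E * sr_dist G p q)%E /\
     sr_dist G z q = ((1 - t)%:E * sr_dist G p q)%E].

Definition sr_bounded (R : realType) (n : nat) (G : carnotGroup R n)
    (E : set 'rV[R]_n) : Prop :=
  exists M : R, forall q, E q -> (sr_dist G (lgone G) q <= M%:E)%E.

Definition test_sets (R : realType) (n : nat) (G : carnotGroup R n)
    (vol : {measure set (borel R n) -> \bar R}) : set (set (borel R n)) :=
  [set E : set (borel R n) |
    [/\ sr_bounded G E, measurable E & (0 < vol E < +oo)%E]].

(* The volume of Z_t(e, E). This set is analytic when E is Borel, hence
   measurable for the completion of [vol], but possibly not Borel; the outer
   measure [mu_ext vol] extends [vol] and its completion, whereas [vol] itself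
   takes unspecified values outside its sigma-algebra. *)
Definition vol_interp (R : realType) (n : nat) (G : carnotGroup R n)
    (vol : {measure set (borel R n) -> \bar R}) (t : R)
    (E : set (borel R n)) : \bar R :=
  mu_ext vol (geo_interp G t (lgone G) E).

(* Both infima are taken in the extended reals: inf set0 = +oo. *)
Definition N_GEO (R : realType) (n : nat) (G : carnotGroup R n)
    (vol : {measure set (borel R n) -> \bar R}) : \bar R :=
  ereal_inf [set N%:E | N in [set N : R | 0 < N /\
    ereal_sup
      [set limf_esup
             (fun t : R => vol_interp G vol t E / ((t `^ N)%:E * vol E))%E
             (0 : R)^'+
      | E in test_sets G vol] = +oo%E]].

Definition N_CE (R : realType) (n : nat) (G : carnotGroup R n)
    (vol : {measure set (borel R n) -> \bar R}) : \bar R :=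
  ereal_inf [set N%:E | N in [set N : R | 0 < N /\
    forall t : R, 0 <= t <= 1 -> forall E, test_sets G vol E ->
      ((t `^ N)%:E * vol E <= vol_interp G vol t E)%E]].

(* Main.v *)
(* The group is R^5 with coordinates (a, b1, b2, c1, c2) and law
   x * y = x + y + a(x) (0, 0, 0, b1(y), b2(y)); V_1 is spanned by the a, b1 and
   b2 directions. A covector l = (u, beta, p), with beta and p in R^2, gives a
   normal geodesic whose a-coordinate A solves A'' = - |p|^2 A - beta.p; it is
   uniquely minimizing on [0, 1] when |p| < 1. Instead of working with curves we
   cut them into N small steps, compare each step with the geodesic by a
   calibration, and let N go to infinity. The same comparison applied to two
   geodesics shows that covectors depend in a Lipschitz way on the end point, and
   a packing argument turns this into lower bounds for volumes.
   - For a fixed box of covectors, Z_t is obtained by the dilation of ratio t from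
     the time-one image of the box where p is scaled by t. Its volume is at least
     of order t^7 * t^2 = t^9, so N_GEO <= 10.
   - For covectors with |u| <= t and beta.p bounded away from 0, A is O(t^2) on
     [0, t], so (c1, c2) is determined up to O(t^5) by (b1, b2) and the number
     r = (int_0^t A) / t = O(t^2). Covering by boxes gives vol Z_t = O(t^12),
     whereas the volume of the set itself is at least of order t. Hence
     N_CE >= 21/2. *)
From HB Require Import structures.
Require Import Defs.
From mathcomp Require Import all_boot all_order all_algebra.
From mathcomp Require Import all_classical all_reals all_analysis.
From mathcomp Require Import measurable_realfun.
From mathcomp Require Import ring lra.
Import Order.TTheory GRing.Theory Num.Theory.
Import numFieldNormedType.Exports.

Set Implicit Arguments.
Unset Strict Implicit.
Unset Printing Implicit Defensive.

Local Open Scope classical_set_scope.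
Local Open Scope ring_scope.

(** * The group *)

(** The exponents are separated by the order of quantifiers: in [N_GEO] the set is fixed before [t]
    tends to 0, in [N_CE] it may shrink with [t], here to width [t] around [u = 0]. With [M] and [S]
    the integrals of [A] and [A^2] on [[0, t]], eliminating [beta] gives
    [c_j - (M/t) b_j = (S - M^2/t) p_j] for both [j]. The factor [S - M^2/t] is of order [t^3] for
    generic [u], but [O(t^5)] when [u = O(t)]. The freedom of [r = M/t] makes up for this loss along
    one direction of [(c1, c2)] only, which is why two c-coordinates are taken. The condition on
    [beta.p] keeps [A] from being almost constant on [[0, 1]]; otherwise [beta] and [p] could not be
    recovered from the end point. No Jacobian is computed: the volume bounds need only a Lipschitz
    constant independent of [t]. The values 10 and 21/2 leave room on both sides, since the
    estimates themselves give 9 and 12 - 1 = 11. *)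

Section Smooth.
Context {R : realType} {U : normedModType R}.
Implicit Types (V : normedModType R).

Lemma smooth_derive V (f : U -> V) v : smooth f -> smooth (fun x => 'D_v f x).
Proof. by move=> sf k; have [_ /(_ v)] := sf k.+1. Qed.

Lemma smooth_differentiable V (f : U -> V) x : smooth f -> differentiable f x.
Proof. by move=> /(_ 1%N)[]. Qed.

Lemma smooth_derivable V (f : U -> V) x v : smooth f -> derivable f x v.
Proof. by move=> sf; exact/diff_derivable/smooth_differentiable. Qed.

Lemma classC_cst V (c : V) k : classC k (fun _ : U => c).
Proof.
elim: k c => [|k IH] c /=; first by move=> x; exact: cvg_cst.
split=> [x|v]; first exact: differentiable_cst.
rewrite (_ : (fun x => 'D_v _ x) = fun=> 0) //.
by apply/funext => x; exact: derive_cst.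
Qed.

Lemma classCD V k (f g : U -> V) :
  classC k f -> classC k g -> classC k (fun x => f x + g x).
Proof.
elim: k f g => [|k IH] f g /=.
  by move=> cf cg x; apply: continuousD; [exact: cf|exact: cg].
move=> [df Df] [dg Dg]; split=> [x|v]; first exact: differentiableD.
rewrite (_ : (fun x => 'D_v (fun y => f y + g y) x) = fun x => 'D_v f x + 'D_v g x).
  exact: IH.
by apply/funext => x; rewrite deriveD//; exact: diff_derivable.
Qed.

Lemma smoothD V (f g : U -> V) :
  smooth f -> smooth g -> smooth (fun x => f x + g x).
Proof. by move=> sf sg k; exact: classCD. Qed.

(** The induction on [k] keeps both factors smooth instead of merely of class [k]: the product rule
    leaves one factor undifferentiated, and no passage from class [k.+1] to class [k] is then
    needed. *)
Lemma smoothM (f g : U -> R) :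
  smooth f -> smooth g -> smooth (fun x => f x * g x).
Proof.
move=> + + k; elim: k f g => [|k IH] f g sf sg /=.
  by move=> x; apply: continuousM; [exact: (sf 0%N)|exact: (sg 0%N)].
split=> [x|v]; first by apply: differentiableM; exact: smooth_differentiable.
rewrite (_ : (fun x => 'D_v (fun y => f y * g y) x) =
    fun x => f x * 'D_v g x + g x * 'D_v f x).
  by apply: classCD; apply: IH => //; exact: smooth_derive.
by apply/funext => x; rewrite deriveM//; exact: smooth_derivable.
Qed.

Lemma smooth_linear V (f : {linear U -> V}) : continuous f -> smooth f.
Proof.
move=> cf [|k] //=; split=> [x|v]; first exact: linear_differentiable.
rewrite (_ : (fun x => 'D_v f x) = fun=> f v); first exact: classC_cst.
by apply/funext => x; rewrite deriveE ?diff_lin//; exact: linear_differentiable.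
Qed.

Lemma smoothZl V (f : U -> R) (w : V) : smooth f -> smooth (fun x => f x *: w).
Proof.
move=> + k; elim: k f => [|k IH] f sf /=.
  by move=> x; apply: continuousZl; exact: (sf 0%N).
split=> [x|v]; first by apply: differentiableZl; exact: smooth_differentiable.
rewrite (_ : (fun x => 'D_v (fun y => f y *: w) x) = fun x => 'D_v f x *: w).
  by apply: IH; exact: smooth_derive.
apply/funext => x; have df := smooth_differentiable x sf.
by rewrite !deriveE ?diffZl//; exact: differentiableZl.
Qed.

End Smooth.

(** * The Carnot group on R^5 *)

Section HeisenbergLike.
Context {R : realType}.
Local Notation E := 'rV[R]_5.

Definition i0 : 'I_5 := @Ordinal 5 0 isT.
Definition i1 : 'I_5 := @Ordinal 5 1 isT.
Definition i2 : 'I_5 := @Ordinal 5 2 isT.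
Definition i3 : 'I_5 := @Ordinal 5 3 isT.
Definition i4 : 'I_5 := @Ordinal 5 4 isT.

Definition pt (a b1 b2 c1 c2 : R) : E :=
  \row_(i < 5) nth 0 [:: a; b1; b2; c1; c2] i.

Lemma ptE a b1 b2 c1 c2 : (pt a b1 b2 c1 c2 0 i0 = a) *
  (pt a b1 b2 c1 c2 0 i1 = b1) * (pt a b1 b2 c1 c2 0 i2 = b2) *
  (pt a b1 b2 c1 c2 0 i3 = c1) * (pt a b1 b2 c1 c2 0 i4 = c2).
Proof. by do !split; rewrite mxE. Qed.

Lemma forall_ord5 (P : 'I_5 -> Prop) :
  P i0 -> P i1 -> P i2 -> P i3 -> P i4 -> forall i, P i.
Proof.
move=> h0 h1 h2 h3 h4 [[|[|[|[|[|i]]]]] ilt] //.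
- by rewrite (_ : Ordinal _ = i0)//; exact: val_inj.
- by rewrite (_ : Ordinal _ = i1)//; exact: val_inj.
- by rewrite (_ : Ordinal _ = i2)//; exact: val_inj.
- by rewrite (_ : Ordinal _ = i3)//; exact: val_inj.
- by rewrite (_ : Ordinal _ = i4)//; exact: val_inj.
Qed.

Lemma eq_row5 (x y : E) : x 0 i0 = y 0 i0 -> x 0 i1 = y 0 i1 ->
  x 0 i2 = y 0 i2 -> x 0 i3 = y 0 i3 -> x 0 i4 = y 0 i4 -> x = y.
Proof.
move=> h0 h1 h2 h3 h4; apply/rowP; exact: forall_ord5.
Qed.

Lemma ptK (x : E) : pt (x 0 i0) (x 0 i1) (x 0 i2) (x 0 i3) (x 0 i4) = x.
Proof. by apply: eq_row5; rewrite ptE. Qed.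

(** Written with vectors instead of coordinates, so that smoothness follows from that of linear maps
    and of products of coordinates. *)
Definition gmul (x y : E) : E :=
  x + y + (x 0 i0 * y 0 i1) *: 'e_i3 + (x 0 i0 * y 0 i2) *: 'e_i4.
Definition ginv (x : E) : E :=
  - x + (x 0 i0 * x 0 i1) *: 'e_i3 + (x 0 i0 * x 0 i2) *: 'e_i4.

Lemma gmulE x y : gmul x y = pt (x 0 i0 + y 0 i0) (x 0 i1 + y 0 i1)
  (x 0 i2 + y 0 i2) (x 0 i3 + y 0 i3 + x 0 i0 * y 0 i1)
  (x 0 i4 + y 0 i4 + x 0 i0 * y 0 i2).
Proof. by apply: eq_row5; rewrite ptE !mxE/= ?mulr0 ?mulr1 ?addr0. Qed.

Lemma ginvE x : ginv x = pt (- x 0 i0) (- x 0 i1) (- x 0 i2)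
  (- x 0 i3 + x 0 i0 * x 0 i1) (- x 0 i4 + x 0 i0 * x 0 i2).
Proof. by apply: eq_row5; rewrite ptE !mxE/= ?mulr0 ?mulr1 ?addr0. Qed.

Lemma gmulA : associative gmul.
Proof. by move=> x y z; rewrite !gmulE !ptE; apply: eq_row5; rewrite !ptE; ring. Qed.

Lemma gmul0 : left_id 0 gmul.
Proof. by move=> x; rewrite !gmulE; apply: eq_row5; rewrite !ptE !mxE; ring. Qed.

Lemma gmulV : left_inverse 0 ginv gmul.
Proof.
by move=> x; rewrite gmulE ginvE !ptE; apply: eq_row5; rewrite !ptE !mxE; ring.
Qed.

Lemma smooth_coord (V : normedModType R) (f : {linear V -> E}) i :
  continuous f -> smooth (fun v => f v 0 i).
Proof.
move=> cf.
have lf : linear (fun v => f v 0 i : R^o).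
  by move=> k u v; rewrite linearP !mxE.
pose g : {linear V -> R^o} := HB.pack (fun v => f v 0 i : R^o)
   (GRing.isLinear.Build _ _ _ _ _ lf).
apply: (@smooth_linear _ _ _ g) => v /=.
apply: (@continuous_comp _ _ _ f (fun N : E => N 0 i)); first exact: cf.
exact: coord_continuous.
Qed.

Lemma gmul_smooth : smooth (fun pq : E * E => gmul pq.1 pq.2).
Proof.
have c1 : continuous (fst : E * E -> E) by move=> x; exact: cvg_fst.
have c2 : continuous (snd : E * E -> E) by move=> x; exact: cvg_snd.
have s1 i : smooth (fun pq : E * E => pq.1 0 i) by exact: smooth_coord c1.
have s2 i : smooth (fun pq : E * E => pq.2 0 i) by exact: smooth_coord c2.
have w1 := smoothZl ('e_i3 : E) (smoothM (s1 i0) (s2 i1)).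
have w2 := smoothZl ('e_i4 : E) (smoothM (s1 i0) (s2 i2)).
have l1 : smooth (fun pq : E * E => pq.1) := smooth_linear c1.
have l2 : smooth (fun pq : E * E => pq.2) := smooth_linear c2.
exact: (smoothD (smoothD (smoothD l1 l2) w1) w2).
Qed.

Lemma ginv_smooth : smooth ginv.
Proof.
have c1 : continuous (idfun : E -> E) by move=> x; exact: cvg_id.
apply: smoothD; last first.
  by apply: smoothZl; apply: smoothM; exact: (smooth_coord (f := idfun)).
apply: smoothD; last first.
  by apply: smoothZl; apply: smoothM; exact: (smooth_coord (f := idfun)).
by apply: smooth_linear; exact: opp_continuous.
Qed.

Definition gGroup : lieGroup R 5 :=
  LieGroup gmulA gmul0 gmulV gmul_smooth ginv_smooth.

(** The difference quotient is constant in [h]. Left translations and left-invariant fields are all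
    affine here, so this rule computes both the fields and their brackets. *)
Lemma derive_affine (U V : normedModType R) (f : U -> V) a v w :
  (forall h : R, f (h *: v + a) - f a = h *: w) -> 'D_v f a = w.
Proof.
move=> fE; rewrite /derive; apply: cvg_lim => //=.
apply: (@cvg_trans _ ((fun=> w) @ (0 : R)^')); last exact: cvg_cst.
apply: near_eq_cvg; near=> h.
rewrite fE scalerA mulVf ?scale1r//.
by near: h; exact: nbhs_dnbhs_neq.
Unshelve. all: by end_near. Qed.

Lemma left_fieldE X p : left_field gGroup X p =
  pt (X 0 i0) (X 0 i1) (X 0 i2) (X 0 i3 + p 0 i0 * X 0 i1)
    (X 0 i4 + p 0 i0 * X 0 i2).
Proof.
apply: derive_affine => h; rewrite /= !gmulE.
by apply: eq_row5; rewrite !mxE /= ?mxE; ring.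
Qed.

Definition gbracket (X Y : E) : E :=
  pt 0 0 0 (X 0 i0 * Y 0 i1 - Y 0 i0 * X 0 i1)
    (X 0 i0 * Y 0 i2 - Y 0 i0 * X 0 i2).

Lemma lie_bracketE X Y : lie_bracket gGroup X Y = gbracket X Y.
Proof.
rewrite /lie_bracket /field_bracket.
have DE (A B : E) : 'D_(left_field gGroup A (lgone gGroup))
    (left_field gGroup B) (lgone gGroup) =
    pt 0 0 0 (A 0 i0 * B 0 i1) (A 0 i0 * B 0 i2).
  apply: derive_affine => h; rewrite !left_fieldE.
  by apply: eq_row5; rewrite !mxE /= ?mxE/=; ring.
transitivity (pt 0 0 0 (X 0 i0 * Y 0 i1) (X 0 i0 * Y 0 i2)
   - pt 0 0 0 (Y 0 i0 * X 0 i1) (Y 0 i0 * X 0 i2)); first by congr (_ - _); exact: DE.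
by apply: eq_row5; rewrite !mxE /= ?subr0.
Qed.

Definition glayer (j : nat) : {vspace E} :=
  if j == 1%N then <<[:: 'e_i0; 'e_i1; 'e_i2 : E]>>%VS
  else <<[:: 'e_i3; 'e_i4 : E]>>%VS.

Lemma mem_glayer1 (x : E) :
  (x \in glayer 1) = (x 0 i3 == 0) && (x 0 i4 == 0).
Proof.
apply/idP/idP => [|/andP[/eqP h3 /eqP h4]].
  rewrite /glayer /= span_cons => /memv_addP[y /vlineP[k ->] [z]].
  rewrite span_cons => /memv_addP[y' /vlineP[k' ->] [z']].
  rewrite span_seq1 => /vlineP[k'' ->] -> ->.
  by rewrite !mxE/= !mulr0 !addr0 eqxx.
rewrite -[x]ptK h3 h4.
rewrite (_ : pt _ _ _ _ _ = x 0 i0 *: 'e_i0 + x 0 i1 *: 'e_i1 + x 0 i2 *: 'e_i2).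
  by rewrite !rpredD// rpredZ// memv_span// !inE eqxx ?orbT.
by apply: eq_row5; rewrite ptE !mxE /= ; ring.
Qed.

Lemma mem_glayer2 (x : E) :
  (x \in glayer 2) = [&& x 0 i0 == 0, x 0 i1 == 0 & x 0 i2 == 0].
Proof.
apply/idP/idP => [|/and3P[/eqP h0 /eqP h1 /eqP h2]].
  rewrite /glayer /= span_cons => /memv_addP[y /vlineP[k ->] [z]].
  rewrite span_seq1 => /vlineP[k'' ->] ->.
  by rewrite !mxE/= !mulr0 !addr0 eqxx.
rewrite -[x]ptK h0 h1 h2.
rewrite (_ : pt _ _ _ _ _ = x 0 i3 *: 'e_i3 + x 0 i4 *: 'e_i4).
  by rewrite !rpredD// rpredZ// memv_span// !inE eqxx ?orbT.
by apply: eq_row5; rewrite ptE !mxE /= ; ring.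
Qed.

(** [bracketv] is spanned by brackets of an unspecified basis; bilinearity carries this to arbitrary
    vectors, such as the coordinate vectors that generate the second layer. *)
Lemma mem_bracketv (A B : {vspace E}) x y : x \in A -> y \in B ->
  gbracket x y \in bracketv gGroup A B.
Proof.
move=> xA yB; rewrite (coord_vbasis xA) (coord_vbasis yB).
have gl : forall k (u v w : E), gbracket (k *: u + v) w = k *: gbracket u w + gbracket v w.
  by move=> k u v w; apply: eq_row5; rewrite !mxE /=; ring.
have gr : forall k (u v w : E), gbracket w (k *: u + v) = k *: gbracket w u + gbracket w v.
  by move=> k u v w; apply: eq_row5; rewrite !mxE /=; ring.
have g0l u : gbracket 0 u = 0 by apply: eq_row5; rewrite !mxE /=; ring.
have g0r u : gbracket u 0 = 0 by apply: eq_row5; rewrite !mxE /=; ring.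
elim/big_rec : _ => [|i u _ IH]; first by rewrite g0l mem0v.
rewrite gl rpredD// rpredZ//.
elim/big_rec : _ => [|j v _ IH']; first by rewrite g0r mem0v.
rewrite gr rpredD// rpredZ//.
apply: memv_span; rewrite -lie_bracketE; apply: allpairs_f.
  by apply: mem_nth; rewrite size_tuple.
by apply: mem_nth; rewrite size_tuple.
Qed.

Lemma glayer_direct : directv (\sum_(j < 2) glayer j.+1)%VS.
Proof.
apply/directv_sum_independent => us us_in; rewrite big_ord_recl big_ord1 => s0 i _.
have := us_in ord0 isT; have := us_in (lift ord0 ord0) isT.
rewrite mem_glayer1 mem_glayer2 => /and3P[/eqP h0 /eqP h1 /eqP h2] /andP[/eqP h3 /eqP h4].
have S k : us ord0 0 k + us (lift ord0 ord0) 0 k = 0.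
  by move/rowP: s0 => /(_ k); rewrite !mxE.
have := (S i0, S i1, S i2, S i3, S i4).
rewrite h0 h1 h2 h3 h4 ?addr0 ?add0r => -[[[[k0 k1] k2] k3] k4].
have u0 : us ord0 = 0 by apply: eq_row5; rewrite !mxE.
have u1 : us (lift ord0 ord0) = 0 by apply: eq_row5; rewrite !mxE.
by case: (unliftP ord0 i) => [j|] ->; rewrite ?ord1.
Qed.

Lemma glayer_full : (\sum_(j < 2) glayer j.+1)%VS = fullv.
Proof.
apply/eqP; rewrite eqEsubv subvf; apply/subvP => x _.
rewrite big_ord_recl big_ord1; apply/memv_addP.
exists (pt (x 0 i0) (x 0 i1) (x 0 i2) 0 0); first by rewrite mem_glayer1 !ptE eqxx.
exists (pt 0 0 0 (x 0 i3) (x 0 i4)); first by rewrite mem_glayer2 !ptE eqxx.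
by apply: eq_row5; rewrite !mxE /= ?mxE/= ?addr0 ?add0r.
Qed.

Lemma glayer_bracket j : (1 <= j < 2)%N ->
  bracketv gGroup (glayer 1) (glayer j) = glayer j.+1.
Proof.
move=> /andP[j1 j2]; have -> : j = 1%N by apply/eqP; rewrite eqn_leq j1 -ltnS j2.
apply/eqP; rewrite eqEsubv; apply/andP; split.
  apply/span_subvP => z /allpairsP[[x y] /= [_ _ ->]].
  by rewrite lie_bracketE mem_glayer2 !ptE eqxx.
rewrite [X in (X <= _)%VS]/glayer /=; apply/span_subvP => z.
have in1 (k : 'I_5) : (k < 3)%N -> ('e_k : E) \in glayer 1.
  by rewrite mem_glayer1 !mxE/=; move: k; apply: forall_ord5; rewrite /= ?eqxx.
rewrite !inE => /orP[|] /eqP ->.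
  rewrite (_ : 'e_i3 = gbracket 'e_i0 'e_i1); last by apply: eq_row5; rewrite !mxE /= ?mxE /=; ring.
  by apply: mem_bracketv; apply: in1.
rewrite (_ : 'e_i4 = gbracket 'e_i0 'e_i2); last by apply: eq_row5; rewrite !mxE /= ?mxE /=; ring.
by apply: mem_bracketv; apply: in1.
Qed.

Lemma glayer_bracket2 : bracketv gGroup (glayer 1) (glayer 2) = 0%VS.
Proof.
apply/eqP; rewrite -subv0; apply/span_subvP => z /allpairsP[[x y] /= [xA yB ->]].
have := vbasis_mem xA; have := vbasis_mem yB.
rewrite lie_bracketE mem_glayer1 mem_glayer2 memv0 => /and3P[/eqP h0 /eqP h1 /eqP h2] _.
by apply/eqP; apply: eq_row5; rewrite !mxE /= ?h0 ?h1 ?h2; ring.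
Qed.

Lemma glayer2_neq0 : glayer 2 <> 0%VS.
Proof.
move=> h; have : ('e_i3 : E) \in glayer 2 by rewrite mem_glayer2 !mxE/= eqxx.
by rewrite h memv0 => /eqP/rowP/(_ i3); rewrite !mxE/= => /eqP; rewrite oner_eq0.
Qed.

Definition gdot (x y : subvs_of (glayer 1)) : R :=
  vsval x 0 i0 * vsval y 0 i0 + vsval x 0 i1 * vsval y 0 i1
  + vsval x 0 i2 * vsval y 0 i2.

Lemma gdot_bilinear : bilinear_for
  (GRing.Scale.Law.clone _ _ ( *%R ) _) (GRing.Scale.Law.clone _ _ (idfun \; *%R ) _) gdot.
Proof.
by split=> u k x y; rewrite /gdot !linearP !mxE /=; ring.
Qed.
HB.instance Definition _ := bilinear_isBilinear.Build R _ _ R^o _ _ gdot gdot_bilinear.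
Lemma gdot_herm (x y : subvs_of (glayer 1)) : gdot x y = (-1) ^+ false * idfun (gdot y x).
Proof. by rewrite expr0 mul1r /gdot /=; ring. Qed.
HB.instance Definition _ := isHermitianSesquilinear.Build R _ false idfun gdot gdot_herm.
Lemma gdot_gt0 (x : subvs_of (glayer 1)) : x != 0 -> 0 < gdot x x.
Proof.
move=> x0; have := subvsP x; rewrite mem_glayer1 => /andP[/eqP h3 /eqP h4].
rewrite lt_neqAle; apply/andP; split; last by rewrite /gdot; nra.
apply: contra x0; rewrite eq_sym /gdot => /eqP q0.
have k0 : vsval x 0 i0 = 0 by nra.
have k1 : vsval x 0 i1 = 0 by nra.
have k2 : vsval x 0 i2 = 0 by nra.
apply/eqP/val_inj => /=.
by apply: eq_row5; rewrite mxE.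
Qed.
HB.instance Definition _ := isDotProduct.Build R _ gdot gdot_gt0.

(** Transparent, so that [step], [layer] and [scalar_product] of this group compute. *)
Definition gCarnot : carnotGroup R 5.
Proof.
refine (@CarnotGroup R 5 gGroup 2 glayer gdot isT glayer_direct glayer_full
  glayer_bracket glayer_bracket2 glayer2_neq0).
Defined.

End HeisenbergLike.

(** * Geodesics *)

Section DeriveRules.
Context {R : realType}.
Implicit Types (f g df : R -> R) (x y z w a b c : R).

Lemma is_derive1_cst c x : is_derive x 1 (fun _ : R => c) 0.
Proof. exact: is_derive_cst. Qed.

Lemma is_derive1_id x : is_derive x 1 (fun t : R => t) 1.
Proof. exact: is_derive_id. Qed.

Lemma is_derive1D f g x a b : is_derive x 1 f a -> is_derive x 1 g b ->
  is_derive x 1 (fun t => f t + g t) (a + b).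
Proof. by move=> df dg; exact: is_deriveD. Qed.

Lemma is_derive1N f x a : is_derive x 1 f a ->
  is_derive x 1 (fun t => - f t) (- a).
Proof. by move=> df; exact: is_deriveN. Qed.

Lemma is_derive1M f g x a b : is_derive x 1 f a -> is_derive x 1 g b ->
  is_derive x 1 (fun t => f t * g t) (f x * b + g x * a).
Proof. by move=> df dg; exact: is_deriveM. Qed.

Lemma is_derive1X2 f x a : is_derive x 1 f a ->
  is_derive x 1 (fun t => f t ^+ 2) (2 * f x * a).
Proof.
move=> df; rewrite (_ : (fun t => f t ^+ 2) = (fun t => f t * f t)).
  by apply: (is_derive_eq (is_derive1M df df)); ring.
by apply/funext => t; rewrite expr2.
Qed.

Lemma is_derive1_sin f x a : is_derive x 1 f a ->
  is_derive x 1 (fun t => sin (f t)) (cos (f x) * a).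
Proof. by move=> df; exact: is_derive1_comp. Qed.

Lemma is_derive1_cos f x a : is_derive x 1 f a ->
  is_derive x 1 (fun t => cos (f t)) (- sin (f x) * a).
Proof. by move=> df; exact: is_derive1_comp. Qed.

Lemma is_derive1_continuous f df :
  (forall x, is_derive x 1 f (df x)) -> continuous f.
Proof.
move=> h x; apply/differentiable_continuous/derivable1_diffP.
by have [] := h x.
Qed.

Lemma MVT_le f df x y : (forall z, is_derive z 1 f (df z)) -> x <= y ->
  exists2 z, x <= z <= y & f y - f x = df z * (y - x).
Proof.
move=> h xy; have [z zxy fE] := MVT_segment xy (fun z _ => h z)
  (continuous_subspaceT (is_derive1_continuous h)).
by exists z => //; move: zxy; rewrite in_itv.
Qed.

Lemma derive_bounded_lipschitz f df c x y :
  (forall z, is_derive z 1 f (df z)) -> (forall z, `|df z| <= c) ->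
  `|f y - f x| <= c * `|y - x|.
Proof.
move=> h dc; wlog xy : x y / x <= y => [H|].
  have [/H//|/ltW/H] := leP x y; by rewrite distrC [in leRHS]distrC.
have [z _ ->] := MVT_le h xy.
by rewrite normrM ler_wpM2r.
Qed.

(** Mean value theorem and Lipschitz derivative. The constant is not sharp: only the order matters,
    since [N] errors of size [N^-2] add up to [O(1/N)]. *)
Lemma taylor1_le f df c x y :
  (forall z, is_derive z 1 f (df z)) ->
  (forall z w, `|df z - df w| <= c * `|z - w|) -> x <= y ->
  `|f y - f x - df x * (y - x)| <= c * (y - x) ^+ 2.
Proof.
move=> h dc xy; have [z /andP[xz zy] ->] := MVT_le h xy.
rewrite -mulrBl normrM (ger0_norm (_ : 0 <= y - x)) ?subr_ge0//.
rewrite expr2 mulrA ler_wpM2r ?subr_ge0//.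
have c0 : 0 <= c by have := le_trans (normr_ge0 _) (dc (x + 1) x); rewrite addrAC subrr add0r normr1 mulr1.
by rewrite (le_trans (dc _ _))// ler_wpM2l// ger0_norm ?subr_ge0// lerB.
Qed.

End DeriveRules.

Ltac derive1 := repeat first
  [ exact: is_derive1_cst | exact: is_derive1_id
  | apply: is_derive1D | apply: is_derive1N | apply: is_derive1X2
  | apply: is_derive1_sin | apply: is_derive1_cos | apply: is_derive1M
  | eassumption ].

Section Geodesic.
Context {R : realType}.
Local Notation E := 'rV[R]_5.
Implicit Types (l : E) (t s : R).

(* [l] is the covector (u, beta1, beta2, p1, p2). Below, [gA] is the a-coordinate
   of the geodesic [gexp l], [gH] its derivative, [gM] the primitive of [gA] and
   [gS] that of [gA ^+ 2]; the formulas are only meaningful if [kap l != 0]. *)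
Definition kap l : R := Num.sqrt (l 0 i3 ^+ 2 + l 0 i4 ^+ 2).
Definition th l : R := l 0 i1 * l 0 i3 + l 0 i2 * l 0 i4.
Definition ell2 l : R := l 0 i0 ^+ 2 + l 0 i1 ^+ 2 + l 0 i2 ^+ 2.

Definition gA l t : R :=
  l 0 i0 * (sin (kap l * t) / kap l) + th l * ((cos (kap l * t) - 1) / kap l ^+ 2).
Definition gH l t : R :=
  l 0 i0 * cos (kap l * t) - th l * (sin (kap l * t) / kap l).
Definition gM l t : R :=
  l 0 i0 * ((1 - cos (kap l * t)) / kap l ^+ 2)
  + th l * ((sin (kap l * t) / kap l - t) / kap l ^+ 2).
Definition gS l t : R :=
  let P := l 0 i0 / kap l in let Q := th l / kap l ^+ 2 in
  let s := sin (kap l * t) in let c := cos (kap l * t) in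
  P ^+ 2 * (t / 2 - s * c / (2 * kap l))
  + Q ^+ 2 * (3 * t / 2 + s * c / (2 * kap l) - 2 * s / kap l)
  + 2 * P * Q * (s ^+ 2 / (2 * kap l) + (c - 1) / kap l).

(** Integrates [b' = beta + A p] and [c' = A b'] from the identity, so that only the primitives of
    [A] and [A^2] enter. *)
Definition gexp l t : E :=
  pt (gA l t) (t * l 0 i1 + gM l t * l 0 i3) (t * l 0 i2 + gM l t * l 0 i4)
     (gM l t * l 0 i1 + gS l t * l 0 i3) (gM l t * l 0 i2 + gS l t * l 0 i4).

Section Fixed.
Variable l : E.
Hypothesis k0 : 0 < kap l.
Let kn0 : kap l != 0. Proof. exact: lt0r_neq0. Qed.

Lemma kap2 : kap l ^+ 2 = l 0 i3 ^+ 2 + l 0 i4 ^+ 2.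
Proof. by rewrite sqr_sqrtr// addr_ge0// sqr_ge0. Qed.

Lemma gA_derive t : is_derive t 1 (gA l) (gH l t).
Proof.
rewrite /gA; apply: is_derive_eq; rewrite /GRing.scale /=.
by rewrite /gH; field.
Qed.

Lemma gH_derive t : is_derive t 1 (gH l) (- (kap l ^+ 2 * gA l t + th l)).
Proof.
rewrite /gH; apply: is_derive_eq; rewrite /GRing.scale /=.
by rewrite /gA; field.
Qed.

Lemma gM_derive t : is_derive t 1 (gM l) (gA l t).
Proof.
rewrite /gM; apply: is_derive_eq; rewrite /GRing.scale /=.
by rewrite /gA; field.
Qed.

Lemma gS_derive t : is_derive t 1 (gS l) (gA l t ^+ 2).
Proof.
rewrite /gS; apply: is_derive_eq; rewrite /GRing.scale /=.
have cs := cos2Dsin2 (kap l * t); rewrite /gA.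
set c := cos _ in cs *; set s := sin _ in cs *.
have c2 : c ^+ 2 = 1 - s ^+ 2 by rewrite -cs addrK.
field: c2; exact: kn0.
Qed.

Lemma gA0 : gA l 0 = 0.
Proof. by rewrite /gA mulr0 sin0 cos0; ring. Qed.
Lemma gH0 : gH l 0 = l 0 i0.
Proof. by rewrite /gH mulr0 sin0 cos0; ring. Qed.
Lemma gM0 : gM l 0 = 0.
Proof. by rewrite /gM mulr0 sin0 cos0; ring. Qed.
Lemma gS0 : gS l 0 = 0.
Proof. by rewrite /gS mulr0 sin0 cos0; ring. Qed.
Lemma gexp0 : gexp l 0 = 0.
Proof. by apply: eq_row5; rewrite ptE ?gA0 ?gM0 ?gS0 mxE; ring. Qed.

(** Conservation of energy: the left side is the first integral of [A'' = - kap^2 A - th]. The value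
    is read off from the closed forms. *)
Lemma speed t : gH l t ^+ 2 + (l 0 i1 + gA l t * l 0 i3) ^+ 2 +
  (l 0 i2 + gA l t * l 0 i4) ^+ 2 = ell2 l.
Proof.
rewrite (_ : _ + _ = gH l t ^+ 2 + kap l ^+ 2 * gA l t ^+ 2 + 2 * gA l t * th l
  + l 0 i1 ^+ 2 + l 0 i2 ^+ 2); last by rewrite kap2 /th; ring.
have cs := cos2Dsin2 (kap l * t); rewrite /gA /gH /ell2.
set c := cos _ in cs *; set s := sin _ in cs *.
have c2 : c ^+ 2 = 1 - s ^+ 2 by rewrite -cs addrK.
field: c2; exact: kn0.
Qed.

End Fixed.
End Geodesic.

(** * Calibration *)

Section Excess.
Context {R : realType}.
Local Notation E := 'rV[R]_5.
Implicit Types (l g : E) (t d h X L : R).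

(* What remains of a horizontal curve of length [h] from [g] to [g']: along it
   [dc = a db], and [a] varies by at most [h]. *)
Definition hstep h g g' :=
  [/\ (g' 0 i0 - g 0 i0) ^+ 2 + (g' 0 i1 - g 0 i1) ^+ 2
        + (g' 0 i2 - g 0 i2) ^+ 2 <= h ^+ 2,
      `|g' 0 i3 - g 0 i3 - g 0 i0 * (g' 0 i1 - g 0 i1)| <= h ^+ 2 &
      `|g' 0 i4 - g 0 i4 - g 0 i0 * (g' 0 i2 - g 0 i2)| <= h ^+ 2].

Definition chain N h (g : nat -> E) :=
  forall i, (i < N)%N -> hstep h (g i) (g i.+1).

Lemma gA_bounded l : exists c, forall t, `|gA l t| <= c.
Proof.
exists (`|l 0 i0 / kap l| + `|th l / kap l ^+ 2| * 2) => t.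
rewrite /gA mulrCA [X in _ + X]mulrCA (le_trans (ler_normD _ _))//.
rewrite ![`|_ * (_ / _)|]normrM lerD//.
  by rewrite ler_piMl// ler_norml sin_geN1 sin_le1.
rewrite mulrC ler_wpM2l// (le_trans (ler_normB _ _))// normr1 (_ : 2 = 1 + 1)//.
by rewrite lerD2r ler_norml cos_geN1 cos_le1.
Qed.

Lemma gH_bounded l : exists c, forall t, `|gH l t| <= c.
Proof.
exists (`|l 0 i0| + `|th l / kap l|) => t.
rewrite /gH [X in _ - X]mulrCA (le_trans (ler_normB _ _))//.
rewrite !normrM lerD//.
  by rewrite ler_piMr// ler_norml cos_geN1 cos_le1.
by rewrite -normrM ler_piMl// ler_norml sin_geN1 sin_le1.
Qed.

(** A single constant serves all estimates along one geodesic; [1 <= c] lets it absorb lower powers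
    of itself. *)
Definition geo_rem c l :=
  [/\ 1 <= c, (forall t, `|gA l t| <= c), (forall t, `|gH l t| <= c) &
    forall t d, 0 <= d ->
   [/\ `|gA l (t + d) - gA l t - gH l t * d| <= c * d ^+ 2,
       `|gH l (t + d) - gH l t + (kap l ^+ 2 * gA l t + th l) * d| <= c * d ^+ 2,
       `|gM l (t + d) - gM l t - gA l t * d| <= c * d ^+ 2 &
       `|gS l (t + d) - gS l t - gA l t ^+ 2 * d| <= c * d ^+ 2]].

(** [gA] and [gH] are trigonometric, hence bounded on the whole line, and this makes the derivatives
    of [gA], [gH], [gM] and [gS] Lipschitz. *)
Lemma geo_taylor l : 0 < kap l -> exists c, geo_rem c l.
Proof.
move=> k0; have [cA hA] := gA_bounded l; have [cH hH] := gH_bounded l.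
have cA0 : 0 <= cA := le_trans (normr_ge0 _) (hA 0).
have cH0 : 0 <= cH := le_trans (normr_ge0 _) (hH 0).
pose cD := kap l ^+ 2 * cA + `|th l|.
have cD0 : 0 <= cD by rewrite /cD addr_ge0// mulr_ge0// sqr_ge0.
have hD t : `|- (kap l ^+ 2 * gA l t + th l)| <= cD.
  rewrite normrN (le_trans (ler_normD _ _))// lerD2r normrM ger0_norm ?sqr_ge0//.
  by rewrite ler_wpM2l// sqr_ge0.
have k20 : 0 <= kap l ^+ 2 by rewrite sqr_ge0.
have LA t s : `|gA l t - gA l s| <= cH * `|t - s|.
  by apply: derive_bounded_lipschitz hH => ?; exact: gA_derive.
have LH t s : `|gH l t - gH l s| <= cD * `|t - s|.
  by apply: derive_bounded_lipschitz hD => ?; exact: gH_derive.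
have LD t s : `|- (kap l ^+ 2 * gA l t + th l) + (kap l ^+ 2 * gA l s + th l)|
   <= kap l ^+ 2 * cH * `|t - s|.
  have -> : - (kap l ^+ 2 * gA l t + th l) + (kap l ^+ 2 * gA l s + th l)
     = kap l ^+ 2 * (gA l s - gA l t) by ring.
  by rewrite normrM ger0_norm// -mulrA ler_wpM2l// distrC.
have LA2 t s : `|gA l t ^+ 2 - gA l s ^+ 2| <= (2 * cA) * cH * `|t - s|.
  rewrite (_ : _ - _ = (gA l t + gA l s) * (gA l t - gA l s)); last by ring.
  rewrite normrM -mulrA ler_pM// (le_trans (ler_normD _ _))//.
  by rewrite (_ : 2 * cA = cA + cA) ?lerD//; ring.
pose c := 1 + cA + cH + cD + kap l ^+ 2 * cH + 2 * cA * cH.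
have p1 : 0 <= kap l ^+ 2 * cH by rewrite mulr_ge0.
have p2 : 0 <= 2 * cA * cH by rewrite !mulr_ge0.
exists c; split.
- by rewrite /c; lra.
- by move=> t; rewrite (le_trans (hA t))// /c; lra.
- by move=> t; rewrite (le_trans (hH t))// /c; lra.
move=> t d d0; have td : t <= t + d by rewrite lerDl.
have dE : t + d - t = d by rewrite addrAC subrr add0r.
have d20 : 0 <= d ^+ 2 by rewrite sqr_ge0.
split.
- have := taylor1_le (gA_derive k0) LH td.
  by rewrite dE => /le_trans; apply; rewrite ler_wpM2r// /c; lra.
- have LD' u v : `|- (kap l ^+ 2 * gA l u + th l) - - (kap l ^+ 2 * gA l v + th l)|
   <= kap l ^+ 2 * cH * `|u - v| by rewrite opprK.
  have := taylor1_le (gH_derive k0) LD' td.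
  rewrite dE mulNr opprK => /le_trans; apply; rewrite ler_wpM2r// /c; lra.
- have := taylor1_le (gM_derive k0) LA td.
  by rewrite dE => /le_trans; apply; rewrite ler_wpM2r// /c; lra.
- have := taylor1_le (gS_derive k0) LA2 td.
  by rewrite dE => /le_trans; apply; rewrite ler_wpM2r// /c; lra.
Qed.

Section Action.
Variable l : E.
Hypothesis k0 : 0 < kap l.

(* A calibration, affine in the position: along [gexp l] its rate of increase is the
   squared speed, and along other horizontal curves it is at most that, up to
   [kap l ^+ 2] times the square of the deviation of the a-coordinate. *)
Definition gact t g : R :=
  2 * gH l t * (g 0 i0 - gA l t)
  - 2 * (t * (l 0 i1 ^+ 2 + l 0 i2 ^+ 2) + 2 * gM l t * th l + gS l t * kap l ^+ 2)
  + t * ell2 l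
  + 2 * (l 0 i1 * g 0 i1 + l 0 i2 * g 0 i2) + 2 * (l 0 i3 * g 0 i3 + l 0 i4 * g 0 i4).

Lemma gact_gexp t : gact t (gexp l t) = t * ell2 l.
Proof. by rewrite /gact !ptE kap2 /th; ring. Qed.

(* Defects of a step of duration [d] with respect to the calibration. Their squares
   bound the excess of energy from below; the deviation term is absorbed by a
   discrete Poincare inequality, since the deviation vanishes at an end point. *)
Definition dfa t d g g' := g' 0 i0 - g 0 i0 - d * gH l t.
Definition dfb1 d g g' := g' 0 i1 - g 0 i1 - d * (l 0 i1 + g 0 i0 * l 0 i3).
Definition dfb2 d g g' := g' 0 i2 - g 0 i2 - d * (l 0 i2 + g 0 i0 * l 0 i4).

Lemma norm_le_sqr (x y : R) : 0 <= y -> x ^+ 2 <= y ^+ 2 -> `|x| <= y.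
Proof. by move=> y0 xy; rewrite -ler_sqr ?nnegrE// real_normK ?num_real. Qed.

Lemma hstep_norm h g g' : 0 <= h -> hstep h g g' ->
  [/\ `|g' 0 i0 - g 0 i0| <= h, `|g' 0 i1 - g 0 i1| <= h & `|g' 0 i2 - g 0 i2| <= h].
Proof.
move=> h0 [s _ _]; have := sqr_ge0 (g' 0 i0 - g 0 i0).
have := sqr_ge0 (g' 0 i1 - g 0 i1); have := sqr_ge0 (g' 0 i2 - g 0 i2).
by move=> *; split; apply: norm_le_sqr => //; lra.
Qed.

(** The first-order terms cancel: [gact] is affine in the position, and its increment matches the
    cross terms of the squared defects. The deviation term arises because [dfb1] and [dfb2] use the
    a-coordinate of the chain and not that of the geodesic. [C] depends on the starting point only
    through [X]. *)
Lemma step_excess X : exists C, 0 <= C /\ forall t d h g g', 0 < d <= h -> h <= 1 ->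
  `|g 0 i0| <= X -> hstep h g g' ->
  `|(g' 0 i0 - gA l (t + d)) - (g 0 i0 - gA l t) - dfa t d g g'| <= C * h ^+ 2 /\
  gact (t + d) g' - gact t g + (dfa t d g g' ^+ 2 + dfb1 d g g' ^+ 2 + dfb2 d g g' ^+ 2) / d
    - d * kap l ^+ 2 * (g 0 i0 - gA l t) ^+ 2
    - ((g' 0 i0 - g 0 i0) ^+ 2 + (g' 0 i1 - g 0 i1) ^+ 2 + (g' 0 i2 - g 0 i2) ^+ 2) / d
  <= C * h ^+ 2.
Proof.
have [c [c1 cA cH ct]] := geo_taylor k0.
pose w := kap l ^+ 2 * c + `|th l|.
pose Y := `|X| + 1 + c.
pose C := c + 2 * (`|l 0 i3| + `|l 0 i4|) + 2 * c * c + 2 * c * Y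
   + 2 * w * (1 + 2 * c) + 2 * (2 * `|th l| * c + kap l ^+ 2 * c).
have c0 : 0 <= c by lra.
have k20 : 0 <= kap l ^+ 2 by rewrite sqr_ge0.
have w0 : 0 <= w by rewrite addr_ge0// mulr_ge0.
have Y0 : 0 <= Y by rewrite !addr_ge0.
have kc0 : 0 <= kap l ^+ 2 * c by rewrite mulr_ge0.
have cc0 : 0 <= c * c by rewrite mulr_ge0.
have cY0 : 0 <= c * Y by rewrite mulr_ge0.
have wc0 : 0 <= w * (1 + 2 * c) by rewrite mulr_ge0// addr_ge0// mulr_ge0.
have tc0 : 0 <= `|th l| * c by rewrite mulr_ge0.
have p30 := normr_ge0 (l 0 i3); have p40 := normr_ge0 (l 0 i4).
exists C; split; first by rewrite /C; lra.
move=> t d h g g' /andP[d0 dh] h1 gX st.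
have h0 : 0 <= h by lra.
have [n0 n1 n2] := hstep_norm h0 st; have [_ s3 s4] := st.
have [tA tH tM tS] := ct t d (ltW d0).
have h20 : 0 <= h ^+ 2 by rewrite sqr_ge0.
have dh2 : d ^+ 2 <= h ^+ 2 by rewrite ler_sqr ?nnegrE// ltW.
have cdh : c * d ^+ 2 <= c * h ^+ 2 by rewrite ler_wpM2l.
set eA := gA l (t + d) - gA l t - gH l t * d in tA.
set eH := gH l (t + d) - gH l t + _ in tH.
set eM := gM l (t + d) - gM l t - _ in tM.
set eS := gS l (t + d) - gS l t - _ in tS.
have {}tA := le_trans tA cdh; have {}tH := le_trans tH cdh.
have {}tM := le_trans tM cdh; have {}tS := le_trans tS cdh.
split.
  rewrite (_ : _ - _ = - eA); last by rewrite /eA /dfa; ring.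
  rewrite normrN (le_trans tA)// ler_wpM2r// /C; lra.
pose E3 := g' 0 i3 - g 0 i3 - g 0 i0 * (g' 0 i1 - g 0 i1).
pose E4 := g' 0 i4 - g 0 i4 - g 0 i0 * (g' 0 i2 - g 0 i2).
pose x' := g' 0 i0 - gA l (t + d).
pose dA := gA l (t + d) - gA l t.
pose W := kap l ^+ 2 * gA l t + th l.
pose D1 := g' 0 i0 - g 0 i0.
(* An exact identity. Each term on the right contains a vertical error of the step, a Taylor
   remainder, or [d] times the change of the deviation, and is therefore [O(h^2)]. *)
rewrite [leLHS](_ : _ = 2 * (l 0 i3 * E3 + l 0 i4 * E4) - 2 * gH l t * eA
   + 2 * eH * x' - 2 * W * d * (D1 - dA) - 2 * (2 * th l * eM + kap l ^+ 2 * eS)); last first.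
  have sp := speed k0 t.
  have e2 : ell2 l = gH l t ^+ 2 + (l 0 i1 + gA l t * l 0 i3) ^+ 2 +
  (l 0 i2 + gA l t * l 0 i4) ^+ 2 by rewrite sp.
  rewrite /gact /dfa /dfb1 /dfb2 /E3 /E4 /eA /eH /x' /W /D1 /dA /eM /eS e2 kap2 /th.
  by field; rewrite gt_eqF.
have B1 : 2 * (l 0 i3 * E3 + l 0 i4 * E4) <= 2 * (`|l 0 i3| + `|l 0 i4|) * h ^+ 2.
  rewrite -mulrA ler_wpM2l// mulrDl lerD// (le_trans (ler_norm _))// normrM ler_wpM2l//.
have B2 : - (2 * gH l t * eA) <= 2 * c * c * h ^+ 2.
  rewrite (le_trans (ler_norm _))// normrN !normrM (ger0_norm (_ : 0 <= 2))//.
  by rewrite -!mulrA ler_wpM2l// ler_pM.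
have ndA : `|dA| <= 2 * c * h.
  rewrite /dA (_ : _ - _ = gH l t * d + eA); last by rewrite /eA; ring.
  rewrite (le_trans (ler_normD _ _))// (_ : 2 * c * h = c * h + c * h); last by ring.
  rewrite lerD//; first by rewrite normrM (gtr0_norm d0) ler_pM// ltW.
  by rewrite (le_trans tA)// ler_wpM2l// expr2 ler_piMr.
have nx' : `|x'| <= Y.
  rewrite /x' (_ : _ - _ = g 0 i0 + D1 - gA l (t + d)); last by rewrite /D1; ring.
  rewrite (le_trans (ler_normB _ _))// /Y lerD// (le_trans (ler_normD _ _))//.
  rewrite lerD//; [exact: le_trans gX (ler_norm _)|exact: le_trans n0 h1].
have B3 : 2 * eH * x' <= 2 * c * Y * h ^+ 2.
  rewrite (le_trans (ler_norm _))// !normrM (ger0_norm (_ : 0 <= 2))//.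
  by rewrite -!mulrA ler_wpM2l// [Y * _]mulrC mulrA ler_pM.
have nW : `|W| <= w.
  by rewrite (le_trans (ler_normD _ _))// /w lerD// normrM (ger0_norm k20) ler_wpM2l.
have nDA : `|D1 - dA| <= (1 + 2 * c) * h.
  by rewrite (le_trans (ler_normB _ _))// mulrDl mul1r lerD.
have B4 : - (2 * W * d * (D1 - dA)) <= 2 * w * (1 + 2 * c) * h ^+ 2.
  rewrite (le_trans (ler_norm _))// normrN !normrM (ger0_norm (_ : 0 <= 2))//.
  rewrite -!mulrA ler_wpM2l// ler_pM// ?mulr_ge0//.
  rewrite (gtr0_norm d0) (_ : _ * h ^+ 2 = h * ((1 + 2 * c) * h)); last by ring.
  by rewrite ler_pM// ltW.
have B5 : - (2 * (2 * th l * eM + kap l ^+ 2 * eS)) <=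
   2 * (2 * `|th l| * c + kap l ^+ 2 * c) * h ^+ 2.
  rewrite (le_trans (ler_norm _))// normrN normrM (ger0_norm (_ : 0 <= 2))//.
  rewrite -[leRHS]mulrA ler_wpM2l// (le_trans (ler_normD _ _))// [leRHS]mulrDl.
  rewrite [`|kap l ^+ 2 * _|]normrM (ger0_norm k20) lerD//.
    rewrite 2!normrM (ger0_norm (_ : 0 <= 2))// -!mulrA.
    by rewrite !ler_wpM2l.
  by rewrite -[leRHS]mulrA ler_wpM2l.
rewrite /C !mulrDl; have : 0 <= c * h ^+ 2 by rewrite mulr_ge0.
lra.
Qed.

(** Cauchy-Schwarz, obtained by expanding the sum of the squares of [N x_i - P], where [P] is the
    sum of the [x_i]. *)
Lemma sqr_sum_le N (x : nat -> R) :
  (\sum_(i < N) x i) ^+ 2 <= N%:R * \sum_(i < N) x i ^+ 2.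
Proof.
have [->|N0] := posnP N; first by rewrite !big_ord0 mul0r expr0n.
pose P := \sum_(i < N) x i.
have : 0 <= \sum_(i < N) (N%:R * x i - P) ^+ 2 by apply: sumr_ge0 => *; rewrite sqr_ge0.
rewrite (eq_bigr (fun i : 'I_N => N%:R ^+ 2 * x i ^+ 2 - 2 * N%:R * P * x i + P ^+ 2)); last first.
  by move=> i _; ring.
rewrite big_split/= sumrB -!mulr_sumr sumr_const card_ord -/P -mulr_natl.
set Q := \sum_(i < N) x i ^+ 2 => q.
have Np : 0 < N%:R :> R by rewrite ltr0n.
rewrite -subr_ge0 -(pmulr_rge0 _ Np) (le_trans q)// le_eqVlt; apply/orP; left.
by apply/eqP; ring.
Qed.

End Action.
End Excess.

(** * Excess of a whole chain *)

Section ChainExcess.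
Context {R : realType}.
Local Notation E := 'rV[R]_5.
Implicit Types (l : E) (g : nat -> E) (t d h X L : R).

Lemma sum_ord_mono (y : nat -> R) i j : (i <= j)%N ->
  (forall k, (k < j)%N -> 0 <= y k) -> \sum_(k < i) y k <= \sum_(k < j) y k.
Proof.
move=> ij y0; rewrite -(subnKC ij) big_split_ord /= lerDl sumr_ge0// => k _.
by rewrite y0// -{2}(subnKC ij) ltn_add2l.
Qed.

Lemma telescope_le N (x y : nat -> R) : (forall k, (k < N)%N -> `|x k.+1 - x k| <= y k) ->
  forall i j, (i <= N)%N -> (j <= N)%N -> `|x i - x j| <= \sum_(k < N) y k.
Proof.
move=> xy i j; wlog ij : i j / (j <= i)%N => [H iN jN|iN _].
  have [/H|/ltnW/H] := leqP j i; first by apply.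
  by rewrite distrC; apply.
have y0 k : (k < N)%N -> 0 <= y k by move=> kN; exact: le_trans (normr_ge0 _) (xy k kN).
suff H : `|x i - x j| <= \sum_(k < i) y k.
  by rewrite (le_trans H)// sum_ord_mono.
elim: i ij iN => [|i IH]; first by rewrite leqn0 => /eqP -> _; rewrite subrr normr0 big_ord0.
rewrite leq_eqVlt => /orP[/eqP <-|]; last first.
  rewrite ltnS => ji iN; rewrite big_ord_recr /= (_ : x i.+1 - x j = (x i - x j) + (x i.+1 - x i)); last by ring.
  by rewrite (le_trans (ler_normD _ _))// lerD ?xy ?IH// ltnW.
move=> iN; rewrite subrr normr0 sumr_ge0// => k _; rewrite y0//.
by rewrite (leq_trans (ltn_ord k)).
Qed.

Variable l : E.
Hypothesis k0 : 0 < kap l.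

Definition tau t0 d (i : nat) : R := t0 + i%:R * d.
(** [chEa], [chEb] and [chS] are discrete energies, of the a-defects, of the b-defects and of the
    chain itself: each squared increment is divided by the duration of its step. *)
Definition chEa t0 d N g : R :=
  \sum_(i < N) dfa l (tau t0 d i) d (g i) (g i.+1) ^+ 2 / d.
Definition chEb d N g : R :=
  \sum_(i < N) (dfb1 l d (g i) (g i.+1) ^+ 2 + dfb2 l d (g i) (g i.+1) ^+ 2) / d.
Definition chdev t0 d g (i : nat) : R := g i 0 i0 - gA l (tau t0 d i).
Definition chS d N g : R := \sum_(i < N)
  ((g i.+1 0 i0 - g i 0 i0) ^+ 2 + (g i.+1 0 i1 - g i 0 i1) ^+ 2
   + (g i.+1 0 i2 - g i 0 i2) ^+ 2) / d.

Lemma tauS t0 d i : tau t0 d i.+1 = tau t0 d i + d.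
Proof. by rewrite /tau -natr1; ring. Qed.

Lemma chain_bounded X h N g : 0 <= h -> `|g 0%N 0 i0| <= X -> chain N h g ->
  forall i, (i <= N)%N -> `|g i 0 i0| <= X + N%:R * h.
Proof.
move=> h0 gX ch i iN.
have H k : (k < N)%N -> `|g k.+1 0 i0 - g k 0 i0| <= (fun=> h) k.
  by move=> /ch /(hstep_norm h0)[].
have := telescope_le (x := fun k => g k 0 i0) (y := fun=> h) H iN (leq0n N); rewrite sumr_const card_ord -[h *+ N]mulr_natl => D.
rewrite (_ : g i 0 i0 = g 0%N 0 i0 + (g i 0 i0 - g 0%N 0 i0)); last by ring.
by rewrite (le_trans (ler_normD _ _))// lerD.
Qed.

(** [step_excess] is summed and [gact] telescopes. For the last estimate, the deviation changes at
    each step by [dfa] up to [O(h^2)], and Cauchy-Schwarz bounds the sum of these defects by their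
    energy. *)
Lemma chain_excess X L : 1 <= L -> exists C, 0 <= C /\ forall t0 T N g,
  0 < T <= 1 -> L <= N%:R -> `|g 0%N 0 i0| <= X -> chain N (L / N%:R) g ->
  let d := T / N%:R in
  gact l (t0 + T) (g N) - gact l t0 (g 0%N) + chEa t0 d N g + chEb d N g
    - kap l ^+ 2 * \sum_(i < N) d * chdev t0 d g i ^+ 2 <= chS d N g + C / N%:R /\
  forall i j, (i <= N)%N -> (j <= N)%N ->
    (chdev t0 d g i - chdev t0 d g j) ^+ 2 <= T * chEa t0 d N g + C / N%:R.
Proof.
move=> L1; have [C0 [C00 st]] := step_excess k0 (X + L).
have [cH hH] := gH_bounded l.
have cH0 : 0 <= cH := le_trans (normr_ge0 _) (hH 0).
pose q := C0 * L ^+ 2; pose B := L * (1 + cH).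
have q0 : 0 <= q by rewrite mulr_ge0// sqr_ge0.
have B0 : 0 <= B by rewrite mulr_ge0 ?addr_ge0//; lra.
have qq := sqr_ge0 q; have Bq : 0 <= B * q by exact: mulr_ge0.
(* [q / N] is the total of the [N] remainders and [B] bounds the sum [P] of the defects; the last
   two terms come from expanding [(P + q / N) ^+ 2]. *)
exists (q + 2 * B * q + q ^+ 2); split; first by clearbody q B; lra.
move=> t0 T N g /andP[T0 T1] LN gX ch d.
have N0 : 0 < N%:R :> R by lra.
have Nn0 : N%:R != 0 :> R by rewrite gt_eqF.
have N1 : 1 <= N%:R :> R by lra.
pose h := L / N%:R.
have h0 : 0 < h by rewrite divr_gt0//; lra.
have h1 : h <= 1 by rewrite ler_pdivrMr// mul1r.
have d0 : 0 < d by rewrite divr_gt0.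
have dh : d <= h by rewrite ler_pM2r ?invr_gt0//; lra.
have Nh : N%:R * h = L by rewrite /h mulrC divfK.
have Nd : N%:R * d = T by rewrite /d mulrC divfK.
have gb i : (i < N)%N -> `|g i 0 i0| <= X + L.
  by move=> iN; rewrite -Nh (chain_bounded (ltW h0) gX ch)// ltnW.
have sti i : (i < N)%N -> _ := fun iN => st (tau t0 d i) d h (g i) (g i.+1)
   (introT andP (conj d0 dh)) h1 (gb i iN) (ch i iN).
have NC : \sum_(i < N) (C0 * h ^+ 2) = q / N%:R.
  by rewrite sumr_const card_ord -[_ *+ N]mulr_natl /q /h; field.
split.
  have : \sum_(i < N) (gact l (tau t0 d i.+1) (g i.+1) - gact l (tau t0 d i) (g i)
    + dfa l (tau t0 d i) d (g i) (g i.+1) ^+ 2 / d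
    + (dfb1 l d (g i) (g i.+1) ^+ 2 + dfb2 l d (g i) (g i.+1) ^+ 2) / d
    - kap l ^+ 2 * (d * chdev t0 d g i ^+ 2)
    - ((g i.+1 0 i0 - g i 0 i0) ^+ 2 + (g i.+1 0 i1 - g i 0 i1) ^+ 2
   + (g i.+1 0 i2 - g i 0 i2) ^+ 2) / d) <= \sum_(i < N) (C0 * h ^+ 2).
    apply: ler_sum => i _; have [_] := sti i (ltn_ord i).
    apply: le_trans; rewrite tauS /chdev le_eqVlt; apply/orP; left.
    by apply/eqP; field; rewrite gt_eqF.
  rewrite NC !sumrB big_split /= big_split /= sumrB -mulr_sumr -/(chEa t0 d N g) -/(chEb d N g) -/(chS d N g).
  have -> : \sum_(i < N) gact l (tau t0 d i.+1) (g i.+1) - \sum_(i < N) gact l (tau t0 d i) (g i)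
    = gact l (t0 + T) (g N) - gact l t0 (g 0%N).
    rewrite -sumrB -(big_mkord xpredT (fun i => gact l (tau t0 d i.+1) (g i.+1) - gact l (tau t0 d i) (g i))).
    rewrite (telescope_sumr (fun i => gact l (tau t0 d i) (g i)))//.
    by rewrite /tau Nd mul0r addr0.
  have : 0 <= (2 * B * q + q ^+ 2) / N%:R.
    by rewrite divr_ge0 ?(ltW N0)//; clearbody q B; lra.
  by rewrite !mulrDl; lra.
pose P := \sum_(i < N) `|dfa l (tau t0 d i) d (g i) (g i.+1)|.
have P0 : 0 <= P by apply: sumr_ge0.
have PB : P <= B.
  have : P <= \sum_(i < N) (h * (1 + cH)).
    apply: ler_sum => i _; rewrite /dfa (le_trans (ler_normB _ _))// [leRHS]mulrDr mulr1.
    have [n1 _ _] := hstep_norm (ltW h0) (ch i (ltn_ord i)).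
    by rewrite lerD// normrM (gtr0_norm d0) ler_pM// ltW.
  by rewrite sumr_const card_ord -[_ *+ N]mulr_natl mulrA Nh.
have PT : P ^+ 2 <= T * chEa t0 d N g.
  rewrite (le_trans (sqr_sum_le N (fun i => `|dfa l (tau t0 d i) d (g i) (g i.+1)|)))//.
  rewrite -Nd -mulrA ler_wpM2l ?(ltW N0)// /chEa mulr_sumr.
  by apply: ler_sum => i _; rewrite mulrC divfK ?gt_eqF// real_normK ?num_real.
move=> i j iN jN.
have H k : (k < N)%N -> `|chdev t0 d g k.+1 - chdev t0 d g k| <=
    (fun k => `|dfa l (tau t0 d k) d (g k) (g k.+1)| + C0 * h ^+ 2) k.
  move=> kN; have [+ _] := sti k kN; rewrite -tauS /chdev /=.
  set y := dfa _ _ _ _ _; set z := (X in `|X - y|) => D.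
  by have := ler_normD y (z - y); rewrite [y + _]addrC subrK => /le_trans; apply; rewrite lerD2l.
have := telescope_le H iN jN; rewrite big_split /= NC -/P => D.
have : (chdev t0 d g i - chdev t0 d g j) ^+ 2 <= (P + q / N%:R) ^+ 2.
  rewrite -real_normK ?num_real// ler_sqr ?nnegrE// addr_ge0// divr_ge0// ltW.
move=> /le_trans; apply.
have qN : 0 <= q / N%:R by rewrite divr_ge0// ltW.
have qN2 : q / N%:R * (q / N%:R) <= q / N%:R * q.
  by rewrite ler_wpM2l// ler_pdivrMr// ler_peMr.
have PqB : P * (q / N%:R) <= B * (q / N%:R) by rewrite ler_wpM2r.
rewrite (_ : (q + 2 * B * q + q ^+ 2) / N%:R = q / N%:R + 2 * (B * (q / N%:R)) + q / N%:R * q); last first.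
  by field.
rewrite sqrrD -mulr_natl [(q / _) ^+ 2]expr2; lra.
Qed.

End ChainExcess.

(** * Minimality of geodesics among chains *)

Section Reach.
Context {R : realType}.
Local Notation E := 'rV[R]_5.
Implicit Types (l g z : E) (t d h X L T : R).

(* A discrete substitute for [sr_dist g g' <= L]. *)
Definition reach g g' L := forall N, (0 < N)%N -> exists c : nat -> E,
  [/\ c 0%N = g, c N = g' & chain N (L / N%:R) c].

Definition ell l : R := Num.sqrt (ell2 l).

Lemma ell2_ge0 l : 0 <= ell2 l.
Proof. by rewrite !addr_ge0// sqr_ge0. Qed.

Lemma ell_ge0 l : 0 <= ell l. Proof. exact: sqrtr_ge0. Qed.

Lemma sqr_ell l : ell l ^+ 2 = ell2 l.
Proof. by rewrite sqr_sqrtr// ell2_ge0. Qed.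

Lemma large_nat (x e : R) : 0 < e -> exists N, [/\ (0 < N)%N, x <= N%:R & x / N%:R <= e].
Proof.
move=> e0; pose N := maxn (Num.truncn `|x|).+1 (Num.truncn (`|x| / e)).+1.
have N0 : 0 < N%:R :> R by rewrite ltr0n /N leq_max.
exists N; split; first by rewrite /N leq_max.
- rewrite (le_trans (ler_norm _))// (le_trans (ltW (truncnS_gt _)))//.
  by rewrite ler_nat leq_maxl.
- rewrite ler_pdivrMr// mulrC -ler_pdivrMr//.
  rewrite (le_trans (_ : _ <= `|x| / e))//; first by rewrite ler_pM2r ?invr_gt0// ler_norm.
  by rewrite (le_trans (ltW (truncnS_gt _)))// ler_nat leq_maxr.
Qed.

(** This is the passage to the limit in the number of steps. It requires [C] to be independent of
    [N], hence the order of quantifiers in the excess estimates. *)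
Lemma le_limN (A B C L : R) : (forall N, (0 < N)%N -> L <= N%:R -> A <= B + C / N%:R) -> A <= B.
Proof.
move=> H; apply/ler_addgt0Pr => e e0.
have [N [N0 LN CN]] := large_nat (`|L| + `|C|) e0.
have Np : 0 < N%:R :> R by rewrite ltr0n.
have := normr_ge0 L; have := normr_ge0 C; have := ler_norm L; have := ler_norm C.
move=> h1 h2 h3 h4.
apply: le_trans (H N N0 _) _; first lra.
rewrite lerD2l (le_trans _ CN)// ler_pM2r ?invr_gt0//; lra.
Qed.

Lemma hstep_le h h' g g' : 0 <= h <= h' -> hstep h g g' -> hstep h' g g'.
Proof.
move=> /andP[h0 hh'] [s1 s2 s3].
have hh : h ^+ 2 <= h' ^+ 2 by rewrite ler_sqr ?nnegrE// (le_trans h0).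
by split; exact: le_trans hh.
Qed.

Lemma chS_le L T N (g : nat -> E) : 0 < T -> (0 < N)%N -> chain N (L / N%:R) g ->
  chS (T / N%:R) N g <= L ^+ 2 / T.
Proof.
move=> T0 N0 ch; have Np : 0 < N%:R :> R by rewrite ltr0n.
have d0 : 0 < T / N%:R by rewrite divr_gt0.
rewrite (@le_trans _ _ (\sum_(i < N) ((L / N%:R) ^+ 2 / (T / N%:R))))//.
  apply: ler_sum => i _; rewrite ler_pM2r ?invr_gt0//.
  by have [] := ch i (ltn_ord i).
rewrite sumr_const card_ord -[_ *+ N]mulr_natl le_eqVlt; apply/orP; left.
by apply/eqP; field; rewrite !gt_eqF.
Qed.

Lemma chEb_ge0 l d N (g : nat -> E) : 0 < d -> 0 <= chEb l d N g.
Proof.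
by move=> d0; apply: sumr_ge0 => i _; rewrite divr_ge0 ?(ltW d0)// addr_ge0// sqr_ge0.
Qed.

Lemma chEa_ge0 l t d N (g : nat -> E) : 0 < d -> 0 <= chEa l t d N g.
Proof.
by move=> d0; apply: sumr_ge0 => i _; rewrite divr_ge0 ?(ltW d0)// sqr_ge0.
Qed.

(** With the deviation zero at one end, the sum of [d * chdev ^+ 2] is at most [T ^+ 2] times the
    a-energy, up to [O(1/N)]; as [T] and [kap l] are at most 1, a fraction [1 - kap l ^+ 2] of that
    energy survives. Either end may be pinned, so a point in the middle can be treated from both
    sides. [C] depends on [Lm] but not on [L], which varies later. *)
Lemma excess_bound l X Lm : 0 < kap l <= 1 -> 1 <= Lm -> exists C, 0 <= C /\
  forall t0 T L N (g : nat -> E), 0 < T <= 1 -> (0 < N)%N -> Lm <= N%:R -> 0 <= L <= Lm ->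
  `|g 0%N 0 i0| <= X -> chain N (L / N%:R) g ->
  g 0%N 0 i0 = gA l t0 \/ g N 0 i0 = gA l (t0 + T) ->
  let d := T / N%:R in
  gact l (t0 + T) (g N) - gact l t0 (g 0%N) + (1 - kap l ^+ 2) * chEa l t0 d N g
     + chEb l d N g <= chS d N g + C / N%:R /\
  forall i, (i <= N)%N -> chdev l t0 d g i ^+ 2 <= T * chEa l t0 d N g + C / N%:R.
Proof.
move=> /andP[k0 k1] Lm1; have [C [C0 H]] := chain_excess k0 X Lm1.
exists (2 * C); split; first lra.
move=> t0 T L N g T01 N0 LN /andP[L0 LL] gX ch x0 d.
have Np : 0 < N%:R :> R by rewrite ltr0n.
have ch' : chain N (Lm / N%:R) g.
  move=> i iN; apply: hstep_le (ch i iN).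
  by rewrite divr_ge0 ?(ltW Np)// ler_pM2r ?invr_gt0.
have [H1 H2] := H t0 T N g T01 LN gX ch'.
have [T0 T1] := andP T01.
have CN : 0 <= C / N%:R by rewrite divr_ge0// ltW.
have dev i : (i <= N)%N -> chdev l t0 d g i ^+ 2 <= T * chEa l t0 d N g + C / N%:R.
  move=> iN; case: x0 => x0.
    have := H2 i 0%N iN isT; rewrite {2}/chdev x0 /tau mul0r addr0 subrr subr0.
    by [].
  have := H2 i N iN (leqnn _); rewrite {2}/chdev x0 /tau [N%:R * _]mulrC divfK ?gt_eqF// subrr subr0.
  by [].
have C2 : (2 * C) / N%:R = C / N%:R + C / N%:R by field; rewrite gt_eqF.
split; last by move=> i iN; rewrite (le_trans (dev i iN))// lerD2l C2; lra.
have d0 : 0 < d by rewrite divr_gt0.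
have Ea0 := chEa_ge0 l t0 N g d0.
have k2 : 0 <= kap l ^+ 2 <= 1 by rewrite sqr_ge0 /= expr_le1// ltW.
have S : \sum_(i < N) d * chdev l t0 d g i ^+ 2 <= chEa l t0 d N g + C / N%:R.
  rewrite (@le_trans _ _ (\sum_(i < N) (d * (T * chEa l t0 d N g + C / N%:R))))//.
    by apply: ler_sum => i _; rewrite ler_wpM2l ?(ltW d0)// dev// ltnW.
  rewrite sumr_const card_ord -[_ *+ N]mulr_natl mulrA /d [N%:R * _]mulrC divfK ?gt_eqF//.
  have TE : T * chEa l t0 (T / N%:R) N g <= chEa l t0 (T / N%:R) N g by rewrite ler_piMl.
  have TE0 : 0 <= T * chEa l t0 (T / N%:R) N g by rewrite mulr_ge0 ?(ltW T0).
  rewrite (le_trans (ler_piMl _ T1)) ?addr_ge0//; lra.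
have : kap l ^+ 2 * (\sum_(i < N) d * chdev l t0 d g i ^+ 2) <=
  kap l ^+ 2 * chEa l t0 d N g + C / N%:R.
  rewrite (le_trans (_ : _ <= kap l ^+ 2 * (chEa l t0 d N g + C / N%:R)))//.
    by rewrite ler_wpM2l//; case/andP: k2.
  by rewrite mulrDr lerD2l ler_piMl//; case/andP: k2.
move: H1; rewrite -/d C2; lra.
Qed.

(** Both ends lie on the geodesic, where [gact] grows by [T * ell2 l]; dropping the defects leaves
    [T * ell2 l <= L ^+ 2 / T], since [N] equal steps have energy at most [L ^+ 2 / T]. *)
Lemma gexp_minimal l t0 T L : 0 < kap l <= 1 -> 0 < T <= 1 -> 0 <= L ->
  reach (gexp l t0) (gexp l (t0 + T)) L -> T * ell l <= L.
Proof.
move=> k01 T01 L0 rch; have [T0 _] := andP T01.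
have [C [C0 H]] := @excess_bound l `|gA l t0| (1 + L) k01 ltac:(lra).
have : T * ell2 l <= L ^+ 2 / T.
  apply: (@le_limN _ _ C (1 + L)) => N N0 LN.
  have [c [c0 cN ch]] := rch N N0.
  have L01 : 0 <= L <= 1 + L by rewrite L0; lra.
  have gX : `|c 0%N 0 i0| <= `|gA l t0| by rewrite c0 ptE.
  have x0 : c 0%N 0 i0 = gA l t0 \/ c N 0 i0 = gA l (t0 + T) by left; rewrite c0 ptE.
  have [+ _] := H t0 T L N c T01 N0 LN L01 gX ch x0.
  have Np : 0 < N%:R :> R by rewrite ltr0n.
  have d0 : 0 < T / N%:R by rewrite divr_gt0.
  have := chS_le T0 N0 ch; have := chEb_ge0 l N c d0; have := chEa_ge0 l t0 N c d0.
  rewrite c0 cN !gact_gexp; case/andP: k01 => k0 k1.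
  have : kap l ^+ 2 <= 1 by rewrite expr_le1// ltW.
  nra.
rewrite ler_pdivlMr// => h.
have : (T * ell l) ^+ 2 <= L ^+ 2 by rewrite exprMn sqr_ell; nra.
by rewrite ler_sqr// nnegrE// mulr_ge0 ?ell_ge0// ltW.
Qed.

End Reach.

(** * Uniqueness of intermediate points *)

Section Uniqueness.
Context {R : realType}.
Local Notation E := 'rV[R]_5.
Implicit Types (l g z : E) (t d h X L T : R).

Lemma sum_telescope N (x : nat -> R) : \sum_(i < N) (x i.+1 - x i) = x N - x 0%N.
Proof. by rewrite -(big_mkord xpredT (fun i => x i.+1 - x i)) telescope_sumr. Qed.

Lemma norm_sum_le N (f F : nat -> R) : (forall i, (i < N)%N -> `|f i| <= F i) ->
  `|\sum_(i < N) f i| <= \sum_(i < N) F i.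
Proof.
by move=> H; rewrite (le_trans (ler_norm_sum _ _ _))// ler_sum// => i _; exact: H.
Qed.

Lemma sum_const N (c : R) : \sum_(i < N) c = N%:R * c.
Proof. by rewrite sumr_const card_ord -[_ *+ N]mulr_natl. Qed.

(** A discrete integration of [b' = be + a p] and [w' = a b'] with [a] close to [A]. Since
    [N d <= 1], Cauchy-Schwarz bounds the sum of the b-defects by [r]. The sequences [b] and [w]
    stand for one of the pairs [(b1, c1)] and [(b2, c2)]; [M] and [S] stand for the integrals of [A]
    and [A ^+ 2]. *)
Lemma discrete_endpoint N d (A a b w : nat -> R) (be p c e r xi q M S : R) :
  0 < d -> N%:R * d <= 1 -> b 0%N = 0 -> w 0%N = 0 ->
  (forall i, (i < N)%N -> `|A i| <= c) ->
  (forall i, (i < N)%N -> `|a i - A i| <= xi) -> 0 <= xi <= 1 ->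
  (forall i, (i < N)%N -> `|w i.+1 - w i - a i * (b i.+1 - b i)| <= e) ->
  \sum_(i < N) (b i.+1 - b i - d * (be + a i * p)) ^+ 2 / d <= r ^+ 2 -> 0 <= r -> 0 <= c ->
  `|M - \sum_(i < N) d * A i| <= q -> `|S - \sum_(i < N) d * A i ^+ 2| <= q ->
  `|b N - (N%:R * d * be + M * p)| <= r + `|p| * (xi + q) /\
  `|w N - (M * be + S * p)| <=
     N%:R * e + (c + 1) * r + `|be| * (xi + q) + `|p| * ((2 * c + 1) * xi + q).
Proof.
move=> d0 Nd1 b0 w0 Ac ax /andP[xi0 xi1] we sr r0 c0 Mq Sq.
pose f i := b i.+1 - b i - d * (be + a i * p).
have Gr : \sum_(i < N) `|f i| <= r.
  have G0 : 0 <= \sum_(i < N) `|f i| by apply: sumr_ge0.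
  rewrite -ler_sqr ?nnegrE// (le_trans (sqr_sum_le N (fun i => `|f i|)))//.
  rewrite (le_trans _ sr)//.
  have -> : \sum_(i < N) `|f i| ^+ 2 = d * \sum_(i < N) f i ^+ 2 / d.
    rewrite mulr_sumr; apply: eq_bigr => i _.
    by rewrite real_normK ?num_real// mulrC divfK// gt_eqF.
  rewrite mulrA ler_piMl// sumr_ge0// => i _; rewrite divr_ge0 ?sqr_ge0// ltW//.
pose x i := a i - A i.
have Sx : `|\sum_(i < N) d * x i| <= xi.
  apply: le_trans (norm_sum_le (f := fun i => d * x i) (F := fun=> d * xi) _) _.
    by move=> i iN; rewrite normrM (gtr0_norm d0) ler_wpM2l ?(ltW d0)// ax.
  by rewrite sum_const mulrA ler_piMl.
have Sa : `|\sum_(i < N) d * a i - M| <= xi + q.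
  have -> : \sum_(i < N) d * a i - M = \sum_(i < N) d * x i - (M - \sum_(i < N) d * A i).
    rewrite opprB addrCA addrA -big_split /= ; congr (_ - _).
    by apply: eq_bigr => i _; rewrite /x; ring.
  by rewrite (le_trans (ler_normB _ _))// lerD.
have Sx2 : `|\sum_(i < N) d * (x i * (2 * A i + x i))| <= (2 * c + 1) * xi.
  apply: le_trans (norm_sum_le (f := fun i => d * (x i * (2 * A i + x i)))
    (F := fun=> d * ((2 * c + 1) * xi)) _) _.
    move=> i iN; rewrite normrM (gtr0_norm d0) ler_wpM2l ?(ltW d0)// normrM mulrC.
    rewrite ler_pM//; last exact: ax.
    rewrite (le_trans (ler_normD _ _))// lerD//; last by rewrite (le_trans (ax i iN)).
    by rewrite normrM (ger0_norm (_ : 0 <= 2))// ler_wpM2l// Ac.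
  by rewrite sum_const mulrA ler_piMl// mulr_ge0// addr_ge0// mulr_ge0.
have Sa2 : `|\sum_(i < N) d * a i ^+ 2 - S| <= (2 * c + 1) * xi + q.
  have -> : \sum_(i < N) d * a i ^+ 2 - S = \sum_(i < N) d * (x i * (2 * A i + x i))
     - (S - \sum_(i < N) d * A i ^+ 2).
    rewrite opprB addrCA addrA -big_split /= ; congr (_ - _).
    by apply: eq_bigr => i _; rewrite /x; ring.
  by rewrite (le_trans (ler_normB _ _))// lerD.
split.
  have -> : b N - (N%:R * d * be + M * p) = \sum_(i < N) f i + p * (\sum_(i < N) d * a i - M).
    have := sum_telescope N b; rewrite b0 subr0 => <-.
    rewrite [\sum_(i < N) (b i.+1 - b i)](eq_bigr (fun i : 'I_N => f i + d * be + p * (d * a i))); last first.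
      by move=> i _; rewrite /f; ring.
    by rewrite !big_split /= sum_const -mulr_sumr; ring.
  rewrite (le_trans (ler_normD _ _))// lerD//.
    by rewrite (le_trans (norm_sum_le (f := f) (F := fun i => `|f i|) _)).
  by rewrite normrM ler_wpM2l.
pose v i := w i.+1 - w i - a i * (b i.+1 - b i).
have -> : w N - (M * be + S * p) = \sum_(i < N) v i + \sum_(i < N) a i * f i
   + be * (\sum_(i < N) d * a i - M) + p * (\sum_(i < N) d * a i ^+ 2 - S).
  have := sum_telescope N w; rewrite w0 subr0 => <-.
  rewrite [\sum_(i < N) (w i.+1 - w i)](eq_bigr (fun i : 'I_N => v i + a i * f i
     + be * (d * a i) + p * (d * a i ^+ 2))); last by move=> i _; rewrite /v /f; ring.
  by rewrite !big_split /= -!mulr_sumr; ring.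
rewrite (le_trans (ler_normD _ _))// lerD//; last by rewrite normrM ler_wpM2l.
rewrite (le_trans (ler_normD _ _))// lerD//; last by rewrite normrM ler_wpM2l.
rewrite (le_trans (ler_normD _ _))// lerD//.
  by rewrite (le_trans (norm_sum_le (f := v) (F := fun=> e) _))// sum_const.
rewrite (le_trans (norm_sum_le (f := fun i => a i * f i) (F := fun i => (c + 1) * `|f i|) _))//.
  move=> i iN; rewrite normrM ler_wpM2r// -(subrK (A i) (a i)) addrC.
  rewrite (le_trans (ler_normD _ _))// lerD ?Ac// (le_trans (ax i iN))//.
by rewrite -mulr_sumr ler_wpM2l// addr_ge0.
Qed.

(** The increments of [f] telescope and leave only Taylor remainders, so no integral enters. *)
Lemma riemann_sum (f df : R -> R) c T N : 0 < T -> (0 < N)%N -> f 0 = 0 ->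
  (forall t d, 0 <= d -> `|f (t + d) - f t - df t * d| <= c * d ^+ 2) ->
  `|f T - \sum_(i < N) T / N%:R * df (tau 0 (T / N%:R) i)| <= c * T ^+ 2 / N%:R.
Proof.
move=> T0 N0 f0 H; have Np : 0 < N%:R :> R by rewrite ltr0n.
set d := T / N%:R; have d0 : 0 < d by rewrite divr_gt0.
have -> : f T - \sum_(i < N) d * df (tau 0 d i) =
  \sum_(i < N) (f (tau 0 d i + d) - f (tau 0 d i) - df (tau 0 d i) * d).
  rewrite sumrB; congr (_ - _); last by apply: eq_bigr => i _; rewrite mulrC.
  under eq_bigr do rewrite -tauS.
  rewrite (sum_telescope N (fun i => f (tau 0 d i))) /tau mul0r addr0 f0 subr0 add0r.
  by rewrite /d [_ * (_ / _)]mulrC divfK// gt_eqF.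
apply: le_trans (norm_sum_le (f := fun i => f (tau 0 d i + d) - f (tau 0 d i) - df (tau 0 d i) * d) (F := fun=> c * d ^+ 2) _) _.
  by move=> i _; exact/H/ltW.
rewrite sum_const le_eqVlt; apply/orP; left; apply/eqP.
by rewrite /d; field; rewrite gt_eqF.
Qed.

Lemma small_eq0 (x K : R) : (forall e, 0 < e <= 1 -> `|x| <= K * e) -> x = 0.
Proof.
move=> H; apply/eqP; rewrite -normr_eq0 eq_le normr_ge0 andbT.
apply/ler_addgt0Pr => e e0; rewrite add0r.
pose e' := Num.min 1 (e / (`|K| + 1)).
have K1 : 0 < `|K| + 1 by rewrite ltr_pwDr.
have e'0 : 0 < e' by rewrite lt_min ltr01 divr_gt0.
have := H e'; rewrite e'0 ge_min lexx => /(_ isT) /le_trans; apply.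
rewrite (le_trans (_ : _ <= (`|K| + 1) * e'))//.
  by rewrite ler_wpM2r ?(ltW e'0)// (le_trans (ler_norm _))// lerDl.
by rewrite mulrC -ler_pdivlMr// ge_min lexx orbT.
Qed.

(** Chains from the identity to [z] and from [z] to [gexp l 1] have total energy [ell2 l + O(e)],
    which is the total increment of the calibration; its values at [z] cancel. All defects thus have
    energy [O(e)]. The first chain is pinned at its start and the second at its end, so nothing is
    assumed about [z]; [kap l < 1] keeps the coefficient of the a-energy positive. *)
Lemma intermediate_unique l t z : 0 < kap l < 1 -> 0 < t < 1 ->
  (forall e, 0 < e -> reach 0 z (t * ell l + e)) ->
  (forall e, 0 < e -> reach z (gexp l 1) ((1 - t) * ell l + e)) -> z = gexp l t.
Proof.
move=> /andP[k0 k1] /andP[t0 t1] r1 r2.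
have [c [c1 cA cH ct]] := geo_taylor k0.
have c0 : 0 <= c by lra.
have el0 := ell_ge0 l.
pose Lm := ell l + 1.
have Lm1 : 1 <= Lm by rewrite /Lm; lra.
have k01 : 0 < kap l <= 1 by rewrite k0 ltW.
have [C1 [C10 H1]] := excess_bound `|z 0 i0| k01 Lm1.
have [C2 [C20 H2]] := excess_bound 0 k01 Lm1.
have k2 : 0 < 1 - kap l ^+ 2 by rewrite subr_gt0 expr_lt1// ltW.
(* The energies [(t * ell l + e) ^+ 2 / t] and its analogue for [1 - t] exceed their ideal values by
   [2 e ell l] each, plus [e ^+ 2 / t] and [e ^+ 2 / (1 - t)]; the final 1 pays for the [O(1/N)]
   errors. *)
pose K := 4 * ell l + t^-1 + (1 - t)^-1 + 1.
pose kk := (1 - kap l ^+ 2)^-1.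
have kk1 : 1 <= kk by rewrite invf_ge1// lerBlDr lerDl sqr_ge0.
have KK0 : 0 <= K.
  rewrite /K !addr_ge0 ?invr_ge0 ?(ltW t0)//; [exact: mulr_ge0|by rewrite subr_ge0 ltW].
have main e : 0 < e <= 1 -> exists N cc, [/\ (0 < N)%N, N%:R^-1 <= e, chain N (Lm / N%:R) cc,
   cc 0%N = 0 /\ cc N = z &
   chEb l (t / N%:R) N cc <= K * e /\
   forall i, (i <= N)%N -> chdev l 0 (t / N%:R) cc i ^+ 2 <= (kk * K + 1) * e].
  move=> /andP[e0 e1].
  have [N [N0 LN CN]] := large_nat (C1 + C2 + Lm + 1) e0.
  have Np : 0 < N%:R :> R by rewrite ltr0n.
  have [a [a0 aN cha]] := r1 e e0 N N0.
  have [b [b0 bN chb]] := r2 e e0 N N0.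
  have t10 : 0 < 1 - t <= 1 by clear -t0 t1; lra.
  have t01 : 0 < t <= 1 by rewrite t0 ltW.
  have LN' : Lm <= N%:R by clear -LN C10 C20; lra.
  have La : 0 <= t * ell l + e <= Lm by rewrite /Lm; clear -t0 t1 e0 e1 el0; apply/andP; split; nra.
  have Lb : 0 <= (1 - t) * ell l + e <= Lm by rewrite /Lm; clear -t0 t1 e0 e1 el0; apply/andP; split; nra.
  have Xa : `|a 0%N 0 i0| <= 0 by rewrite a0 mxE normr0.
  have Xb : `|b 0%N 0 i0| <= `|z 0 i0| by rewrite b0.
  have xa : a 0%N 0 i0 = gA l 0 \/ a N 0 i0 = gA l (0 + t) by left; rewrite a0 gA0// mxE.
  have xb : b 0%N 0 i0 = gA l t \/ b N 0 i0 = gA l (t + (1 - t)).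
    by right; rewrite bN ptE; congr (gA _ _); ring.
  have [P1 P2] := H2 0 t _ N a t01 N0 LN' La Xa cha xa.
  have [Q1 _] := H1 t (1 - t) _ N b t10 N0 LN' Lb Xb chb xb.
  have d1 : 0 < t / N%:R by rewrite divr_gt0.
  have t1' : 0 < 1 - t by rewrite subr_gt0.
  have d2 : 0 < (1 - t) / N%:R by rewrite divr_gt0.
  have Ea := chEa_ge0 l 0 N a d1; have Eb := chEb_ge0 l N a d1.
  have Fa := chEa_ge0 l t N b d2; have Fb := chEb_ge0 l N b d2.
  have Sa := chS_le t0 N0 cha.
  have Sb := chS_le t1' N0 chb.
  have CC : C1 / N%:R + C2 / N%:R + N%:R^-1 <= e.
    rewrite (le_trans _ CN)// -[X in _ + X]mul1r -!mulrDl ler_pM2r ?invr_gt0//; clear -Lm1; lra.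
  have C1N : 0 <= C1 / N%:R by rewrite divr_ge0// ltW.
  have C2N : 0 <= C2 / N%:R by rewrite divr_ge0// ltW.
  have Ni : 0 < N%:R^-1 :> R by rewrite invr_gt0.
  have tot : (1 - kap l ^+ 2) * chEa l 0 (t / N%:R) N a + chEb l (t / N%:R) N a <= K * e.
    move: P1 Q1; rewrite a0 aN b0 bN.
    rewrite -[X in gact l 0 X](gexp0 l) add0r (_ : t + (1 - t) = 1); last by ring.
    rewrite !gact_gexp mul0r mul1r => P1 Q1.
    have Fk : 0 <= (1 - kap l ^+ 2) * chEa l t ((1 - t) / N%:R) N b by rewrite mulr_ge0// ltW.
    have S1 : (t * ell l + e) ^+ 2 / t = t * ell2 l + 2 * e * ell l + e * e * t^-1.
      by rewrite -sqr_ell; field; rewrite gt_eqF.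
    have S2 : ((1 - t) * ell l + e) ^+ 2 / (1 - t) = (1 - t) * ell2 l + 2 * e * ell l + e * e * (1 - t)^-1.
      by rewrite -sqr_ell; field; rewrite gt_eqF.
    have ee : e * e <= e by rewrite ler_piMr// ltW.
    have E1 : e * e * t^-1 <= e * t^-1 by rewrite ler_pM2r ?invr_gt0.
    have E2 : e * e * (1 - t)^-1 <= e * (1 - t)^-1 by rewrite ler_pM2r ?invr_gt0.
    move: Sa Sb; rewrite S1 S2 /K => Sa Sb.
    rewrite !mulrDl mul1r; clear -P1 Q1 Sa Sb Fk Fa Fb Ea Eb CC C1N C2N Ni ee E1 E2; lra.
  exists N, a; split => //; first by clear -CC C1N C2N; lra.
    by move=> i iN; apply: hstep_le (cha i iN); case/andP: La => ? ?; rewrite divr_ge0 ?(ltW Np)// ler_pM2r ?invr_gt0.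
  split; first by have := mulr_ge0 (ltW k2) Ea; move: tot; clear; lra.
  move=> i iN; rewrite (le_trans (P2 i iN))// mulrDl mul1r lerD//; last by clear -CC C1N Ni; lra.
  rewrite (le_trans (ler_piMl Ea _))//; first by rewrite ltW.
  by rewrite -mulrA -ler_pdivrMl ?invr_gt0// invrK; clear -tot Eb; lra.
pose K2 := kk * K + 1.
have kK0 : 0 <= kk * K by rewrite mulr_ge0// (le_trans ler01).
have K20 : 0 < K2 by rewrite ltr_wpDl.
(* Rescaling: [main] controls squares linearly in its parameter, so it is applied at a multiple of
   [e ^+ 2]. *)
have main2 e : 0 < e <= 1 -> exists N cc, [/\ (0 < N)%N, N%:R^-1 <= e, chain N (Lm / N%:R) cc,
   cc 0%N = 0 /\ cc N = z &
   chEb l (t / N%:R) N cc <= e ^+ 2 /\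
   forall i, (i <= N)%N -> `|chdev l 0 (t / N%:R) cc i| <= e].
  move=> /andP[e0 e1]; have e20 : 0 < e ^+ 2 by rewrite exprn_gt0.
  have e21 : e ^+ 2 <= e by rewrite expr2 ler_piMr// ltW.
  have KKp : 0 < K2 + K + 1 by rewrite ltr_wpDl// addr_ge0// ltW.
  have q0 : 0 < e ^+ 2 / (K2 + K + 1) by rewrite divr_gt0.
  have q1 : e ^+ 2 / (K2 + K + 1) <= e ^+ 2.
    by rewrite ler_pdivrMr// ler_peMr ?(ltW e20)// lerDr addr_ge0// ltW.
  have qe : (K2 + K + 1) * (e ^+ 2 / (K2 + K + 1)) = e ^+ 2 by rewrite mulrC divfK// gt_eqF.
  have q2 : 0 < e ^+ 2 / (K2 + K + 1) <= 1 by rewrite q0; clear -q1 e21 e1; lra.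
  have [N [cc [N0 Ne ch [cc0 ccN] [Eb dev]]]] := main _ q2.
  exists N, cc; split => //; first by clear -Ne q1 e21; lra.
  split; first by rewrite (le_trans Eb)// -[leRHS]qe ler_pM2r//; clear -K20; lra.
  move=> i iN; apply: norm_le_sqr; first exact: ltW.
  by rewrite (le_trans (dev i iN))// -[leRHS]qe ler_pM2r// /K2; clear -KK0; lra.
have tE N : (0 < N)%N -> tau 0 (t / N%:R) N = t.
  by move=> N0; rewrite /tau add0r mulrC divfK// gt_eqF// ltr0n.
(* The indices [(ib, iw)] are [(i1, i3)] or [(i2, i4)], so the two pairs of coordinates share one
   argument. *)
have fin (ib iw : 'I_5) :
    (forall N h (cc : nat -> E), chain N h cc -> forall i, (i < N)%N ->
      `|cc i.+1 0 iw - cc i 0 iw - cc i 0 i0 * (cc i.+1 0 ib - cc i 0 ib)| <= h ^+ 2) ->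
    (forall N d (cc : nat -> E), 0 < d -> \sum_(i < N) (cc i.+1 0 ib - cc i 0 ib
       - d * (l 0 ib + cc i 0 i0 * l 0 iw)) ^+ 2 / d <= chEb l d N cc) ->
    z 0 ib = t * l 0 ib + gM l t * l 0 iw /\
    z 0 iw = gM l t * l 0 ib + gS l t * l 0 iw.
  move=> hw hb.
  have key e : 0 < e <= 1 ->
    `|z 0 ib - (t * l 0 ib + gM l t * l 0 iw)| <= (1 + `|l 0 iw| * (1 + c)) * e /\
    `|z 0 iw - (gM l t * l 0 ib + gS l t * l 0 iw)| <=
      (Lm ^+ 2 + (c + 1) + `|l 0 ib| * (1 + c) + `|l 0 iw| * ((2 * c + 1) + c)) * e.
    move=> e01; have [N [cc [N0 Ne ch [cc0 ccN] [Eb dev]]]] := main2 e e01.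
    have [e0 e1] := andP e01.
    have Np : 0 < N%:R :> R by rewrite ltr0n.
    have d0 : 0 < t / N%:R by rewrite divr_gt0.
    have Nd : N%:R * (t / N%:R) = t by rewrite mulrC divfK// gt_eqF.
    have remM t' d' : 0 <= d' -> `|gM l (t' + d') - gM l t' - gA l t' * d'| <= c * d' ^+ 2.
      by move=> /(ct t')[].
    have remS t' d' : 0 <= d' -> `|gS l (t' + d') - gS l t' - (gA l t') ^+ 2 * d'| <= c * d' ^+ 2.
      by move=> /(ct t')[].
    have RM := riemann_sum t0 N0 (gM0 l) remM.
    have RS := riemann_sum (df := fun t => gA l t ^+ 2) t0 N0 (gS0 l) remS.
    have ctN : c * t ^+ 2 / N%:R <= c * e.
      by rewrite -mulrA ler_wpM2l// (le_trans (ler_piMl _ _))// ?invr_ge0 ?(ltW Np)// expr_le1 ?(ltW t0)// ltW.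
    have LmN : N%:R * (Lm / N%:R) ^+ 2 <= Lm ^+ 2 * e.
      rewrite (_ : _ * _ = Lm ^+ 2 * N%:R^-1); last by field; rewrite gt_eqF.
      by rewrite ler_wpM2l// sqr_ge0.
    have [] := @discrete_endpoint N (t / N%:R) (fun i => gA l (tau 0 (t / N%:R) i))
      (fun i => cc i 0 i0) (fun i => cc i 0 ib) (fun i => cc i 0 iw)
      (l 0 ib) (l 0 iw) c ((Lm / N%:R) ^+ 2) e e (c * e) (gM l t) (gS l t) d0.
    + by rewrite Nd ltW.
    + by rewrite cc0 mxE.
    + by rewrite cc0 mxE.
    + by move=> i _; exact: cA.
    + by move=> i iN; apply: dev; exact: ltnW.
    + by rewrite ltW.
    + by move=> i iN; exact: hw ch i iN.
    + exact: le_trans (hb N _ cc d0) Eb.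
    + exact: ltW.
    + exact: c0.
    + exact: le_trans RM ctN.
    + exact: le_trans RS ctN.
    rewrite Nd ccN => B1 B2; split.
      by rewrite (le_trans B1)// le_eqVlt; apply/orP; left; apply/eqP; ring.
    by rewrite (le_trans B2)//; move: LmN; clear; move: (N%:R * _) => x; lra.
  split; apply/eqP; rewrite -subr_eq0; apply/eqP.
    by apply: small_eq0 => e /key[B1 _]; exact: B1.
  by apply: small_eq0 => e /key[_ B2]; exact: B2.
have [z1 z3] : z 0 i1 = t * l 0 i1 + gM l t * l 0 i3 /\
    z 0 i3 = gM l t * l 0 i1 + gS l t * l 0 i3.
  apply: fin => [N h cc ch i iN|N d cc d0]; first by have [] := ch i iN.
  by apply: ler_sum => i _; rewrite ler_pM2r ?invr_gt0// lerDl sqr_ge0.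
have [z2 z4] : z 0 i2 = t * l 0 i2 + gM l t * l 0 i4 /\
    z 0 i4 = gM l t * l 0 i2 + gS l t * l 0 i4.
  apply: fin => [N h cc ch i iN|N d cc d0]; first by have [] := ch i iN.
  by apply: ler_sum => i _; rewrite ler_pM2r ?invr_gt0// lerDr sqr_ge0.
apply: eq_row5; rewrite ptE//.
apply/eqP; rewrite -subr_eq0; apply/eqP.
apply: (@small_eq0 _ 1) => e /main2[N [cc [N0 _ _ [_ ccN] [_ dev]]]].
by have := dev N (leqnn _); rewrite /chdev ccN tE// mul1r.
Qed.
End Uniqueness.

(** * Lipschitz dependence of covectors on end points *)

Section SampledGeodesics.
Context {R : realType}.
Local Notation E := 'rV[R]_5.
Implicit Types (l g z : E) (t d h X L T : R).

Lemma addCK (x y : R) : x + y - x = y.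
Proof. by rewrite addrC addKr. Qed.

Lemma pair_bound M (x y a : R) (A : nat -> R) : (0 < M)%N -> 0 <= a ->
  (forall i, (i < M)%N -> a <= A (3 * M + i)%N - A (2 * M + i)%N) ->
  a ^+ 2 * y ^+ 2 / 8 <= \sum_(i < 4 * M) (4 * M)%:R^-1 * (x + A i * y) ^+ 2.
Proof.
move=> M0 a0 H; have Mp : 0 < M%:R :> R by rewrite ltr0n.
rewrite -mulr_sumr natrM mulrC ler_pdivlMl ?mulr_gt0//.
pose f i := (x + A i * y) ^+ 2.
have -> : \sum_(i < 4 * M) (x + A i * y) ^+ 2 =
  \sum_(i < 2 * M) f i + (\sum_(i < M) f (2 * M + i)%N + \sum_(i < M) f (3 * M + i)%N).
  rewrite (_ : (4 * M = 2 * M + (M + M))%N); last by rewrite !mulSn mul0n !addn0 !addnA.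
  rewrite !big_split_ord /=; congr (_ + (_ + _)).
  by apply: eq_bigr => i _; rewrite /f addnA (_ : (2 * M + M = 3 * M)%N)// addnC -mulSn.
rewrite -big_split /=.
have S0 : 0 <= \sum_(i < 2 * M) f i by apply: sumr_ge0 => i _; rewrite sqr_ge0.
suff : \sum_(i < M) (a ^+ 2 * y ^+ 2 / 2) <= \sum_(i < M) (f (2 * M + i)%N + f (3 * M + i)%N).
  rewrite sum_const => h; apply: (@le_trans _ _ (M%:R * (a ^+ 2 * y ^+ 2 / 2))); last by lra.
  by rewrite le_eqVlt; apply/orP; left; apply/eqP; field.
apply: ler_sum => i _; rewrite /f; have {H} := H i (ltn_ord i).
set u := A (2 * M + i)%N; set v := A (3 * M + i)%N => uv.
have : a ^+ 2 <= (v - u) ^+ 2 by rewrite ler_sqr ?nnegrE//; lra.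
move=> /(ler_wpM2r (sqr_ge0 y)); have := sqr_ge0 (x + u * y + (x + v * y)).
nra.
Qed.

Lemma average_bound M (x y c : R) (A : nat -> R) : (0 < M)%N ->
  (forall i, (i < 4 * M)%N -> `|A i| <= c) ->
  x ^+ 2 <= 2 * (\sum_(i < 4 * M) (4 * M)%:R^-1 * (x + A i * y) ^+ 2) + 2 * c ^+ 2 * y ^+ 2.
Proof.
move=> M0 Ac; have Mp : 0 < (4 * M)%:R :> R by rewrite ltr0n muln_gt0.
have : \sum_(i < 4 * M) (4 * M)%:R^-1 * x ^+ 2 <=
  \sum_(i < 4 * M) ((4 * M)%:R^-1 * (2 * (x + A i * y) ^+ 2 + 2 * c ^+ 2 * y ^+ 2)).
  apply: ler_sum => i _; rewrite ler_pM2l ?invr_gt0//.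
  have : A i ^+ 2 <= c ^+ 2.
    by rewrite -real_normK ?num_real// ler_sqr ?nnegrE ?Ac// (le_trans (normr_ge0 _) (Ac i _)).
  move=> /(ler_wpM2r (sqr_ge0 y)); have := sqr_ge0 (x + 2 * (A i * y)).
  by rewrite expr2 => *; nra.
rewrite -!mulr_sumr big_split /= -mulr_sumr !sum_const ler_pM2l ?invr_gt0//.
move: Mp; set n := (4 * M)%:R; set S := \sum_(_ < _) _ => n0 h; clearbody n S.
have e : n * (2 * (n^-1 * S) + 2 * c ^+ 2 * y ^+ 2) = 2 * S + n * (2 * c ^+ 2 * y ^+ 2).
  by field; rewrite gt_eqF.
by rewrite -(ler_pM2l n0) e expr2 mulrCA.
Qed.

Section Samples.
Variables (l : E) (c : R).
Hypotheses (k0 : 0 < kap l) (lb : forall i, `|l 0 i| <= 2) (rem : geo_rem c l).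

Let smp d (i : nat) := gexp l (tau 0 d i).

Lemma sample_steps t d : 0 < d ->
  exists eA eM eS, [/\ `|eA| <= c * d ^+ 2, `|eM| <= c * d ^+ 2, `|eS| <= c * d ^+ 2 &
   gexp l (t + d) = gexp l t + pt (gH l t * d + eA)
     (d * (l 0 i1 + gA l t * l 0 i3) + l 0 i3 * eM)
     (d * (l 0 i2 + gA l t * l 0 i4) + l 0 i4 * eM)
     ((gA l t * d + eM) * l 0 i1 + (gA l t ^+ 2 * d + eS) * l 0 i3)
     ((gA l t * d + eM) * l 0 i2 + (gA l t ^+ 2 * d + eS) * l 0 i4)].
Proof.
move=> d0; have [_ _ _ /(_ t d (ltW d0))[rA _ rM rS]] := rem.
exists (gA l (t + d) - gA l t - gH l t * d), (gM l (t + d) - gM l t - gA l t * d),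
  (gS l (t + d) - gS l t - gA l t ^+ 2 * d); split => //.
by apply: eq_row5; rewrite !mxE /=; ring.
Qed.

(** A rough step length is enough: it affects only the constant of the [O(1/N)] error in
    [excess_bound]. *)
Lemma sample_chain N : (0 < N)%N -> chain N ((4 + 8 * c) / N%:R) (smp N%:R^-1).
Proof.
move=> N0 i iN; have d0 : 0 < N%:R^-1 :> R by rewrite invr_gt0 ltr0n.
rewrite /smp tauS; set t := tau _ _ _; move: d0; set d := N%:R^-1 => d0.
have d1 : d <= 1 by rewrite invf_le1 ?ler1n// ltr0n.
have [eA [eM [eS [bA bM bS ->]]]] := sample_steps t d0.
have [c1 cA cH _] := rem.
have dd : d ^+ 2 <= d by rewrite expr2 ler_piMr// ltW.
have cdd : c * d ^+ 2 <= c * d by rewrite ler_wpM2l//; lra.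
have c0 : 0 <= c by lra.
have cd : 0 <= c * d by rewrite mulr_ge0// ltW.
have nA : `|gH l t * d + eA| <= (2 + 4 * c) * d.
  rewrite (le_trans (ler_normD _ _))// normrM (gtr0_norm d0).
  have := ler_wpM2r (ltW d0) (cH t); lra.
have nB (b p : R) : `|b| <= 2 -> `|p| <= 2 -> `|d * (b + gA l t * p) + p * eM| <= (2 + 4 * c) * d.
  move=> b2 p2; rewrite (le_trans (ler_normD _ _))// !normrM (gtr0_norm d0).
  have : `|b + gA l t * p| <= 2 + c * 2.
    by rewrite (le_trans (ler_normD _ _))// lerD// normrM ler_pM.
  move=> /(ler_wpM2l (ltW d0)); have : `|p| * `|eM| <= 2 * (c * d).
    by rewrite ler_pM// (le_trans bM).
  lra.
have sq (x : R) : `|x| <= (2 + 4 * c) * d -> x ^+ 2 <= ((2 + 4 * c) * d) ^+ 2.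
  move=> h; rewrite -real_normK ?num_real// ler_sqr ?nnegrE//.
  by rewrite mulr_ge0// ?ltW//; lra.
have nE (b p : R) : `|b| <= 2 -> `|p| <= 2 ->
   `|(gA l t * d + eM) * b + (gA l t ^+ 2 * d + eS) * p - gA l t * (d * (b + gA l t * p) + p * eM)|
     <= ((4 + 8 * c) * d) ^+ 2.
  move=> b2 p2.
  rewrite [X in `|X|](_ : _ = b * eM + p * eS - gA l t * (p * eM)); last by ring.
  have n1 : `|b * eM| <= 2 * (c * d ^+ 2) by rewrite normrM ler_pM.
  have n2 : `|p * eS| <= 2 * (c * d ^+ 2) by rewrite normrM ler_pM.
  have n3 : `|gA l t * (p * eM)| <= c * (2 * (c * d ^+ 2)) by rewrite !normrM ler_pM ?ler_pM// mulr_ge0.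
  rewrite (le_trans (ler_normB _ _))// (le_trans (lerD (ler_normD _ _) (lexx _)))//.
  have : 0 <= c * c * d ^+ 2 by rewrite !mulr_ge0// ltW.
  have : 0 <= c * d ^+ 2 by rewrite !mulr_ge0// ltW.
  have : 0 <= d ^+ 2 by rewrite sqr_ge0.
  lra.
split.
- rewrite !mxE /= !addCK.
  have := sq _ nA; have := sq _ (nB _ _ (lb i1) (lb i3)); have := sq _ (nB _ _ (lb i2) (lb i4)).
  have := sqr_ge0 ((2 + 4 * c) * d); lra.
- by rewrite !mxE /= !addCK; exact: nE.
- by rewrite !mxE /= !addCK; exact: nE.
Qed.

Lemma sqr_div_le d (f e F q : R) : 0 < d <= 1 -> `|f| <= F -> `|e| <= q * d ^+ 2 ->
  (d * f + e) ^+ 2 / d <= d * f ^+ 2 + (2 * F * q + q ^+ 2) * d ^+ 2.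
Proof.
move=> /andP[d0 d1] fF eq; rewrite ler_pdivrMr//.
have F0 := le_trans (normr_ge0 _) fF.
have q0 : 0 <= q by rewrite -(pmulr_lge0 _ (exprn_gt0 2 d0)) (le_trans _ eq).
have e2 : e ^+ 2 <= (q * d ^+ 2) ^+ 2.
  by rewrite -real_normK ?num_real// ler_sqr ?nnegrE// mulr_ge0// sqr_ge0.
have fe : f * e <= F * (q * d ^+ 2).
  by rewrite (le_trans (ler_norm _))// normrM ler_pM.
have h1 := ler_wpM2l (ltW d0) fe.
have h2 : (q * d ^+ 2) ^+ 2 <= q ^+ 2 * d ^+ 3.
  rewrite exprMn -exprM ler_wpM2l ?sqr_ge0//.
  by rewrite (exprS _ 3) ler_piMl// exprn_ge0// ltW.
by lra.
Qed.

Lemma sqr_div_ge d (f e q : R) : 0 < d <= 1 -> `|e| <= q * d ^+ 2 ->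
  d * f ^+ 2 / 2 - q ^+ 2 * d ^+ 2 <= (d * f + e) ^+ 2 / d.
Proof.
move=> /andP[d0 d1] eq; rewrite ler_pdivlMr//.
have q0 : 0 <= q by rewrite -(pmulr_lge0 _ (exprn_gt0 2 d0)) (le_trans _ eq).
have e2 : e ^+ 2 <= (q * d ^+ 2) ^+ 2.
  by rewrite -real_normK ?num_real// ler_sqr ?nnegrE// mulr_ge0// sqr_ge0.
have h2 : (q * d ^+ 2) ^+ 2 <= q ^+ 2 * d ^+ 3.
  rewrite exprMn -exprM ler_wpM2l ?sqr_ge0//.
  by rewrite (exprS _ 3) ler_piMl// exprn_ge0// ltW.
have := sqr_ge0 (d * f + 2 * e); lra.
Qed.

(** Computed from the conserved speed and not from the step length of [sample_chain]: the leading
    term must be exactly [ell2 l]. *)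
Lemma sample_chS N : (0 < N)%N ->
  chS N%:R^-1 N (smp N%:R^-1) <= ell2 l + (99 * c ^+ 2) / N%:R.
Proof.
move=> N0; set d := N%:R^-1.
have Np : 0 < N%:R :> R by rewrite ltr0n.
have d0 : 0 < d by rewrite invr_gt0.
have d1 : d <= 1 by rewrite invf_le1 ?ler1n// ltr0n.
have d01 : 0 < d <= 1 by rewrite d0.
have [c1 cA cH _] := rem.
rewrite (@le_trans _ _ (\sum_(i < N) (d * ell2 l + 99 * c ^+ 2 * d ^+ 2)))//.
  apply: ler_sum => i _; rewrite /smp tauS; set t := tau _ _ _.
  have [eA [eM [eS [bA bM bS ->]]]] := sample_steps t d0.
  rewrite !mxE /= !addCK !(mulrDl _ _ d^-1).
  have nf (b p : R) : `|b| <= 2 -> `|p| <= 2 -> `|b + gA l t * p| <= 2 + c * 2.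
    by move=> b2 p2; rewrite (le_trans (ler_normD _ _))// lerD// normrM ler_pM.
  have ne (p : R) : `|p| <= 2 -> `|p * eM| <= 2 * c * d ^+ 2.
    by move=> p2; rewrite normrM -mulrA ler_pM.
  have := sqr_div_le d01 (cH t) bA; rewrite [d * gH l t]mulrC => h1.
  have h2 := sqr_div_le d01 (nf _ _ (lb i1) (lb i3)) (ne _ (lb i3)).
  have h3 := sqr_div_le d01 (nf _ _ (lb i2) (lb i4)) (ne _ (lb i4)).
  rewrite -(speed k0 t); have : c * d ^+ 2 <= c ^+ 2 * d ^+ 2.
    by rewrite ler_wpM2r ?sqr_ge0// expr2 ler_peMl//; lra.
  have : 0 <= c ^+ 2 * d ^+ 2 by rewrite mulr_ge0// sqr_ge0.
  lra.
rewrite sum_const le_eqVlt; apply/orP; left; apply/eqP.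
by rewrite /d; field; rewrite gt_eqF.
Qed.

Variable l' : E.
Hypothesis k0' : 0 < kap l'.

(** Relative to [l'], each a-defect of the sampled geodesic is [d] times the difference of the two
    a-velocities, up to [O(d^2)]. *)
Lemma sample_chEa N : (0 < N)%N ->
  \sum_(i < N) N%:R^-1 * (gH l (tau 0 N%:R^-1 i) - gH l' (tau 0 N%:R^-1 i)) ^+ 2 / 2
  <= chEa l' 0 N%:R^-1 N (smp N%:R^-1) + c ^+ 2 / N%:R.
Proof.
move=> N0; set d := N%:R^-1.
have Np : 0 < N%:R :> R by rewrite ltr0n.
have d0 : 0 < d by rewrite invr_gt0.
have d1 : d <= 1 by rewrite invf_le1 ?ler1n// ltr0n.
have d01 : 0 < d <= 1 by rewrite d0.
rewrite -lerBlDr; have -> : c ^+ 2 / N%:R = \sum_(i < N) c ^+ 2 * d ^+ 2.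
  by rewrite sum_const /d; field; rewrite gt_eqF.
rewrite -sumrB; apply: ler_sum => i _; rewrite /smp tauS; set t := tau _ _ _.
have [eA [eM [eS [bA bM bS ->]]]] := sample_steps t d0.
have := sqr_div_ge (gH l t - gH l' t) d01 bA.
rewrite /dfa !mxE /= (_ : d * (gH l t - gH l' t) + eA =
  gA l t + (gH l t * d + eA) - gA l t - d * gH l' t)//.
by ring.
Qed.

(** Since [dfb1] and [dfb2] use the a-coordinate of the chain, only [gA l] appears and not [gA l'].
    The velocity differences are then of the form [x + A y] to which [pair_bound] applies. *)
Lemma sample_chEb N : (0 < N)%N ->
  \sum_(i < N) N%:R^-1 * (l 0 i1 - l' 0 i1 + gA l (tau 0 N%:R^-1 i) * (l 0 i3 - l' 0 i3)) ^+ 2 / 2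
  + \sum_(i < N) N%:R^-1 * (l 0 i2 - l' 0 i2 + gA l (tau 0 N%:R^-1 i) * (l 0 i4 - l' 0 i4)) ^+ 2 / 2
  <= chEb l' N%:R^-1 N (smp N%:R^-1) + (8 * c ^+ 2) / N%:R.
Proof.
move=> N0; set d := N%:R^-1.
have Np : 0 < N%:R :> R by rewrite ltr0n.
have d0 : 0 < d by rewrite invr_gt0.
have d1 : d <= 1 by rewrite invf_le1 ?ler1n// ltr0n.
have d01 : 0 < d <= 1 by rewrite d0.
rewrite -lerBlDr; have -> : (8 * c ^+ 2) / N%:R = \sum_(i < N) 8 * c ^+ 2 * d ^+ 2.
  by rewrite sum_const /d; field; rewrite gt_eqF.
rewrite -big_split -sumrB /=; apply: ler_sum => i _; rewrite /smp tauS; set t := tau _ _ _.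
have [eA [eM [eS [bA bM bS ->]]]] := sample_steps t d0.
have ne (p : R) : `|p| <= 2 -> `|p * eM| <= 2 * c * d ^+ 2.
  by move=> p2; rewrite normrM -mulrA ler_pM.
have := sqr_div_ge (l 0 i1 - l' 0 i1 + gA l t * (l 0 i3 - l' 0 i3)) d01 (ne _ (lb i3)).
have := sqr_div_ge (l 0 i2 - l' 0 i2 + gA l t * (l 0 i4 - l' 0 i4)) d01 (ne _ (lb i4)).
rewrite /dfb1 /dfb2 !mxE /= (mulrDl _ _ d^-1).
set u1 := d * _ + _; set u2 := (X in X ^+ 2 / d + _).
set v1 := d * _ + _; set v2 := (X in _ + X ^+ 2 / d).
have -> : u2 = v1 by rewrite /u2 /v1; ring.
have -> : v2 = u1 by rewrite /v2 /u1; ring.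
lra.
Qed.
End Samples.
End SampledGeodesics.

(** * Comparison of the a-velocities of two good covectors *)

Section GoodCovectors.
Context {R : realType}.
Local Notation E := 'rV[R]_5.
Implicit Types (l g z : E) (t d h X L T : R).

(** The last clause makes [A] vary, which allows [beta] and [p] to be told apart. It concerns only
    the second half of the time interval, because [gH l 0 = l 0 i0] may vanish for the covectors
    with small [u]. *)
Definition good h l := [/\ 0 < kap l, kap l <= 1 / 2, forall i, `|l 0 i| <= 2 &
  forall t, 1 / 2 <= t <= 1 -> h <= gH l t].

Definition dist4 l l' : R := `|l 0 i1 - l' 0 i1| + `|l 0 i2 - l' 0 i2|
  + `|l 0 i3 - l' 0 i3| + `|l 0 i4 - l' 0 i4|.

Lemma dist4C l l' : dist4 l l' = dist4 l' l.
Proof. by rewrite /dist4; do 4 (congr (_ + _) => //; try exact: distrC); exact: distrC. Qed.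

Lemma dist4_ge0 l l' : 0 <= dist4 l l'.
Proof. by rewrite !addr_ge0. Qed.

Lemma p_le_kap l : `|l 0 i3| <= kap l /\ `|l 0 i4| <= kap l.
Proof.
have h := kap2 l; split; apply: norm_le_sqr; rewrite ?sqrtr_ge0// h ?lerDl ?lerDr sqr_ge0//.
Qed.

Lemma sqr_le2 (x c : R) : `|x| <= c -> x ^+ 2 <= c ^+ 2.
Proof.
move=> h; rewrite -real_normK ?num_real// ler_sqr ?nnegrE//.
exact: le_trans (normr_ge0 _) h.
Qed.

Lemma good_H4 h l t : good h l -> `|gH l t| <= 4.
Proof.
move=> [k0 _ lb _]; apply: norm_le_sqr => //.
have := speed k0 t; have := sqr_le2 (lb i0); have := sqr_le2 (lb i1); have := sqr_le2 (lb i2).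
have := sqr_ge0 (l 0 i1 + gA l t * l 0 i3); have := sqr_ge0 (l 0 i2 + gA l t * l 0 i4).
rewrite /ell2; lra.
Qed.

Lemma good_A4 h l t : good h l -> 0 <= t <= 1 -> `|gA l t| <= 4.
Proof.
move=> gl /andP[t0 t1]; have [k0 _ _ _] := gl.
have := derive_bounded_lipschitz 0 t (gA_derive k0) (fun t => good_H4 t gl).
rewrite gA0 !subr0 (ger0_norm t0); lra.
Qed.

(** A maximum argument in place of Gronwall. If [m] is the maximum on [[0, 1]] of the difference [Y]
    of the a-velocities, the a-coordinates differ by at most [m], and [kap l ^+ 2 <= 1 / 4] gives
    [m / 4 + 6 D] as a bound for [Y']. At the maximum this yields [m <= 4 / 3 |u| + 8 D]. *)
Lemma H_difference h l l' : good h l -> good h l' ->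
  `|gH l 1 - gH l' 1| <= 4 / 3 * `|l 0 i0 - l' 0 i0| + 8 * dist4 l l' /\
  forall t, 0 <= t <= 1 ->
    2 / 9 * (l 0 i0 - l' 0 i0) ^+ 2 - 64 * dist4 l l' ^+ 2 <= (gH l t - gH l' t) ^+ 2.
Proof.
move=> gl gl'; have [k0 kh lb _] := gl; have [k0' kh' lb' _] := gl'.
set D := dist4 l l'; set u := l 0 i0 - l' 0 i0.
pose Y t := gH l t - gH l' t.
pose dY t := - (kap l ^+ 2 * gA l t + th l) - - (kap l' ^+ 2 * gA l' t + th l').
have dYE t : is_derive t 1 Y (dY t).
  by apply: is_derive1D; [exact: gH_derive|apply: is_derive1N; exact: gH_derive].
pose X t := gA l t - gA l' t.
have dX t : is_derive t 1 X (Y t).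
  by apply: is_derive1D; [exact: gA_derive|apply: is_derive1N; exact: gA_derive].
have [s /[!in_itv]/= s01 smax] := @EVT_max R (fun t => `|Y t|) 0 1 ler01
  (continuous_subspaceT (fun t => continuous_comp (is_derive1_continuous dYE (x:=t)) (@norm_continuous _ _ _))).
set m := `|Y s| in smax.
have Ym t : 0 <= t <= 1 -> `|Y t| <= m by move=> t01; apply: smax; rewrite in_itv.
have Xm t : 0 <= t <= 1 -> `|X t| <= m.
  move=> /andP[t0 t1]; have [z /andP[z0 zt]] := MVT_le dX t0.
  rewrite {2}/X !gA0 !subr0 => ->; rewrite normrM (ger0_norm t0).
  rewrite (le_trans (ler_piMr _ t1))// Ym// z0 (le_trans zt)//.
have dYb t : 0 <= t <= 1 -> `|dY t| <= m / 4 + 6 * D.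
  move=> t01.
  have -> : dY t = - (kap l ^+ 2 * X t) - ((l 0 i3 - l' 0 i3) * (l 0 i3 + l' 0 i3) +
     (l 0 i4 - l' 0 i4) * (l 0 i4 + l' 0 i4)) * gA l' t
     - ((l 0 i1 - l' 0 i1) * l 0 i3 + l' 0 i1 * (l 0 i3 - l' 0 i3)
       + ((l 0 i2 - l' 0 i2) * l 0 i4 + l' 0 i2 * (l 0 i4 - l' 0 i4))).
    by rewrite /dY /X !kap2 /th; ring.
  have [p3 p4] := p_le_kap l; have [p3' p4'] := p_le_kap l'.
  rewrite (le_trans (ler_normB _ _))//; apply: le_trans (lerD (ler_normB _ _) (lexx _)) _.
  have n1 : `|- (kap l ^+ 2 * X t)| <= 1 / 4 * m.
    rewrite normrN normrM ler_pM ?Xm// ger0_norm ?sqr_ge0//.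
    have := sqr_le2 (_ : `|kap l| <= 1 / 2); rewrite ger0_norm ?(ltW k0)// => /(_ kh); lra.
  have n2 (x y : R) : `|x| <= 1 / 2 -> `|y| <= 1 / 2 -> `|(x - y) * (x + y)| <= `|x - y|.
    move=> hx hy; rewrite normrM ler_piMr// (le_trans (ler_normD _ _))//; lra.
  have n3 : `|((l 0 i3 - l' 0 i3) * (l 0 i3 + l' 0 i3) +
     (l 0 i4 - l' 0 i4) * (l 0 i4 + l' 0 i4)) * gA l' t| <= (`|l 0 i3 - l' 0 i3| + `|l 0 i4 - l' 0 i4|) * 4.
    rewrite normrM ler_pM ?(good_A4 gl')// (le_trans (ler_normD _ _))// lerD//; apply: n2; lra.
  have n4 (b b' p p' : R) : `|p| <= 1 / 2 -> `|b'| <= 2 ->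
     `|(b - b') * p + b' * (p - p')| <= `|b - b'| + 2 * `|p - p'|.
    move=> hp hb; rewrite (le_trans (ler_normD _ _))// lerD// normrM ?ler_wpM2r// ler_piMr//; lra.
  have n5 : `|(l 0 i1 - l' 0 i1) * l 0 i3 + l' 0 i1 * (l 0 i3 - l' 0 i3)
       + ((l 0 i2 - l' 0 i2) * l 0 i4 + l' 0 i2 * (l 0 i4 - l' 0 i4))| <=
      `|l 0 i1 - l' 0 i1| + 2 * `|l 0 i3 - l' 0 i3| + (`|l 0 i2 - l' 0 i2| + 2 * `|l 0 i4 - l' 0 i4|).
    by rewrite (le_trans (ler_normD _ _))// lerD//; apply: n4 => //; lra.
  have := normr_ge0 (l 0 i1 - l' 0 i1); have := normr_ge0 (l 0 i2 - l' 0 i2).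
  have := normr_ge0 (l 0 i3 - l' 0 i3); have := normr_ge0 (l 0 i4 - l' 0 i4).
  rewrite /D /dist4; lra.
have D0 : 0 <= D := dist4_ge0 l l'.
have m0 : 0 <= m := normr_ge0 _.
have Yu t : 0 <= t <= 1 -> `|Y t - u| <= m / 4 + 6 * D.
  move=> /andP[t0 t1]; have [z /andP[z0 zt]] := MVT_le dYE t0.
  rewrite {2}/Y !gH0 -/u !subr0 => ->; rewrite normrM (ger0_norm t0).
  rewrite (le_trans (ler_piMr _ t1))// dYb// z0 (le_trans zt)//.
have mu : m <= 4 / 3 * `|u| + 8 * D.
  have := Yu s s01; have := ler_normD u (Y s - u); rewrite [u + _]addrC subrK -/m; lra.
split; first by rewrite (le_trans (Ym 1 _))// ler01 lexx.
move=> t t01.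
have h1 : `|u| <= `|Y t| + `|Y t - u|.
  by have := ler_normB (Y t) (Y t - u); rewrite opprB addrC subrK.
have h2 := Yu t t01.
have h3 : 2 / 3 * `|u| <= `|Y t| + 8 * D by lra.
have h4 : (2 / 3 * `|u|) ^+ 2 <= (`|Y t| + 8 * D) ^+ 2.
  by rewrite ler_sqr ?nnegrE// ?addr_ge0 ?mulr_ge0//; lra.
have e1 : `|u| ^+ 2 = u ^+ 2 by rewrite real_normK ?num_real.
have e2 : `|Y t| ^+ 2 = Y t ^+ 2 by rewrite real_normK ?num_real.
have := sqr_ge0 (`|Y t| - 8 * D); rewrite -/(Y t); nra.
Qed.

End GoodCovectors.

(** * End points determine covectors with a Lipschitz bound *)

Section Expansiveness.
Context {R : realType}.
Local Notation E := 'rV[R]_5.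
Implicit Types (l g z : E) (t d h X L T : R).

(* The excess of [gexp l] over [gexp l'] controls the difference of the covectors. *)
Lemma excess_lower h l l' : 0 < h -> good h l -> good h l' ->
  gact l' 1 (gexp l 1) + ((l 0 i0 - l' 0 i0) ^+ 2 + dist4 l l' ^+ 2) /
    (18 * (64 * (4 * (2 + 66 * (64 / h ^+ 2))))) <= ell2 l.
Proof.
move=> h0 gl gl'; set G := 4 * _; have [k0 kh lb hl] := gl; have [k0' kh' lb' hl'] := gl'.
have hh0 : 0 < h ^+ 2 by rewrite exprn_gt0.
have w0 : 0 <= 64 / h ^+ 2 by rewrite divr_ge0// ltW.
have G8 : 8 <= G by rewrite /G; move: w0; set w := 64 / h ^+ 2; clearbody w; lra.
have [c rem] := geo_taylor k0; have [c1 _ _ _] := rem.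
have L1 : 1 <= 4 + 8 * c by lra.
have k01' : 0 < kap l' <= 1 by rewrite k0' /=; lra.
have [C [C0 H]] := excess_bound 0 k01' L1.
set D := dist4 l l'; set u := l 0 i0 - l' 0 i0.
apply: (@le_limN _ _ _ (C + 110 * c ^+ 2) (4 + 8 * c)) => M M0 LM.
pose N := (4 * M)%N; have N0 : (0 < N)%N by rewrite muln_gt0.
have Mp : 0 < M%:R :> R by rewrite ltr0n.
have Np : 0 < N%:R :> R by rewrite ltr0n.
have NM : M%:R <= N%:R :> R by rewrite ler_nat /N leq_pmull.
pose smp (i : nat) := gexp l (tau 0 N%:R^-1 i).
have T01 : 0 < (1 : R) <= 1 by rewrite ltr01 lexx.
have ch : chain N ((4 + 8 * c) / N%:R) smp := sample_chain lb rem N0.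
have s0 : smp 0%N = 0 by rewrite /smp /tau mul0r addr0 gexp0.
have sN : smp N = gexp l 1 by rewrite /smp /tau add0r mulfV// gt_eqF.
have LN : 4 + 8 * c <= N%:R := le_trans LM NM.
have LL : 0 <= 4 + 8 * c <= 4 + 8 * c by rewrite lexx andbT; lra.
have X0 : `|smp 0%N 0 i0| <= 0 by rewrite s0 mxE normr0.
have x0 : smp 0%N 0 i0 = gA l' 0 \/ smp N 0 i0 = gA l' (0 + 1) by left; rewrite s0 mxE gA0.
have [P _] := H 0 1 _ N smp T01 N0 LN LL X0 ch x0.
move: P; rewrite div1r s0 sN -[X in gact l' 0 X](gexp0 l') gact_gexp mul0r subr0 add0r => P.
have Sle := sample_chS k0 lb rem N0; have Ea := sample_chEa rem l' N0.
have Eb := sample_chEb lb rem l' N0.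
rewrite -/smp in Sle Ea Eb.
set EA := chEa _ _ _ _ _ in P Ea; set EB := chEb _ _ _ _ in P Eb.
have d0 : 0 < N%:R^-1 :> R by rewrite invr_gt0.
have EA0 : 0 <= EA := chEa_ge0 l' 0 N smp d0.
have tI (i : nat) : (i < N)%N -> 0 <= tau (0 : R) N%:R^-1 i <= 1.
  move=> iN; rewrite /tau !add0r; apply/andP; split; first by rewrite mulr_ge0 ?(ltW d0).
  by rewrite ler_pdivrMr// mul1r ler_nat ltnW.
have [_ HY] := H_difference gl gl'.
have EaL : u ^+ 2 / 9 - 32 * D ^+ 2 <= EA + c ^+ 2 / N%:R.
  rewrite (le_trans _ Ea)//.
  rewrite (@le_trans _ _ (\sum_(i < N) N%:R^-1 * (u ^+ 2 / 9 - 32 * D ^+ 2)))//.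
    by rewrite sum_const mulVKf ?gt_eqF.
  apply: ler_sum => i _; rewrite -mulrA ler_pM2l//.
  have := HY _ (tI i (ltn_ord i)); rewrite -/u -/D.
  by move: (D ^+ 2) (u ^+ 2) ((gH l _ - _) ^+ 2) => x y z; clear; lra.
pose A i := gA l (tau 0 N%:R^-1 i).
(* Moving [M] indices out of [4 M] advances time by [1 / 4], within [[1 / 2, 1]], where [A] has
   slope at least [h]. *)
have Apair i : (i < M)%N -> h / 4 <= A (3 * M + i)%N - A (2 * M + i)%N.
  move=> iM; rewrite /A.
  have e1 : tau 0 N%:R^-1 (3 * M + i) = tau 0 N%:R^-1 (2 * M + i) + 1 / 4 :> R.
    rewrite /tau /N (natrD _ (3 * M)) (natrD _ (2 * M)) (natrM _ 3) (natrM _ 2) (natrM _ 4).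
    by field; rewrite gt_eqF.
  have r : 1 / 2 <= tau (0 : R) N%:R^-1 (2 * M + i) <= 3 / 4.
    rewrite /tau !add0r ler_pdivlMr// ler_pdivrMr// /N (natrD _ (2 * M)) (natrM _ 2) (natrM _ 4).
    have : i%:R <= M%:R :> R by rewrite ler_nat ltnW.
    have := ler0n R i; clear -Mp; lra.
  move: r => /andP[r1 r2]; rewrite e1.
  have tt : tau (0 : R) N%:R^-1 (2 * M + i) <= tau 0 N%:R^-1 (2 * M + i) + 1 / 4 by clear; lra.
  have [z /andP[z1 z2] ->] := MVT_le (gA_derive k0) tt.
  have hz : h <= gH l z by apply: hl; clear -r1 r2 z1 z2; apply/andP; split; lra.
  by rewrite addCK; clear -hz; lra.
have A4 i : (i < 4 * M)%N -> `|A i| <= 4 by move=> iN; exact: (good_A4 gl (tI i iN)).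
pose F (x y : R) := \sum_(i < 4 * M) (4 * M)%:R^-1 * (x + A i * y) ^+ 2.
(* With [w = 64 / h ^+ 2], [pair_bound] for [a = h / 4] gives the factor [2 w] for [y], and
   [|A| <= 4] then gives [2 + 64 w] for [x]. Their sum [2 + 66 w], times 4 for the square of a sum
   of four terms, is [G]. *)
have Fy x y : y ^+ 2 <= 2 * (64 / h ^+ 2) * F x y.
  have h40 : 0 <= h / 4 by rewrite divr_ge0// ltW.
  have := pair_bound x y M0 h40 Apair; rewrite -/(F x y) => hF.
  rewrite (_ : 2 * (64 / h ^+ 2) * F x y = (2 * (64 * F x y)) / h ^+ 2); last by ring.
  by rewrite ler_pdivlMr//; clear -hF; lra.
have Fx x y : x ^+ 2 <= (2 + 64 * (64 / h ^+ 2)) * F x y.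
  have := average_bound x y M0 A4; rewrite -/(F x y).
  have := Fy x y; set w := 64 / h ^+ 2; set f := F x y; clearbody w f; clear; lra.
have Fs x y : x ^+ 2 + y ^+ 2 <= (2 + 66 * (64 / h ^+ 2)) * F x y.
  by have := Fx x y; have := Fy x y; set w := 64 / h ^+ 2; set f := F x y; clearbody w f; clear; lra.
have EbL : (F (l 0 i1 - l' 0 i1) (l 0 i3 - l' 0 i3) + F (l 0 i2 - l' 0 i2) (l 0 i4 - l' 0 i4)) / 2
   <= EB + (8 * c ^+ 2) / N%:R.
  rewrite (le_trans _ Eb)// mulrDl /F !mulr_suml; exact: lexx.
have DF : D ^+ 2 <= G * (F (l 0 i1 - l' 0 i1) (l 0 i3 - l' 0 i3) + F (l 0 i2 - l' 0 i2) (l 0 i4 - l' 0 i4)).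
  have := Fs (l 0 i1 - l' 0 i1) (l 0 i3 - l' 0 i3).
  have := Fs (l 0 i2 - l' 0 i2) (l 0 i4 - l' 0 i4).
  rewrite -!(real_normK (num_real (_ - _))) /D /dist4 /G.
  set a1 := `|_|; set a3 := `|_|; set a2 := `|_|; set a4 := `|_|.
  move=> f1 f2; rewrite mulrDr -!(mulrA 4).
  have := sqr_ge0 (a1 - a2); have := sqr_ge0 (a1 - a3); have := sqr_ge0 (a1 - a4).
  have := sqr_ge0 (a2 - a3); have := sqr_ge0 (a2 - a4); have := sqr_ge0 (a3 - a4).
  clear -f1 f2; nra.
have Gp : 0 < G := lt_le_trans (ltr0n _ 8) G8.
have Dq : D ^+ 2 / G <= F (l 0 i1 - l' 0 i1) (l 0 i3 - l' 0 i3) + F (l 0 i2 - l' 0 i2) (l 0 i4 - l' 0 i4).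
  by rewrite ler_pdivrMr// mulrC.
move: DF Gp Dq EbL G8; clearbody G D u => DF Gp Dq EbL G8.
have k34 : 3 / 4 <= 1 - kap l' ^+ 2.
  by have := sqr_le2 (_ : `|kap l'| <= 1 / 2); rewrite ger0_norm ?(ltW k0')// => /(_ kh'); clear; lra.
(* The a-energy controls [u ^+ 2 / 9] only up to a loss of [32 D ^+ 2]. With the weight
   [1 / (128 G)] this loss is [D ^+ 2 / (4 G)], which is covered by the [D ^+ 2 / (2 G)] coming from
   the b-energy. *)
have P1 : 1 / (64 * (2 * G)) * EA <= (1 - kap l' ^+ 2) * EA.
  rewrite ler_wpM2r// (le_trans _ k34)// ler_pdivrMr ?mulr_gt0//; clear -G8; lra.
have P2 : 1 / (64 * (2 * G)) * (u ^+ 2 / 9 - 32 * D ^+ 2) <= 1 / (64 * (2 * G)) * (EA + c ^+ 2 / N%:R).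
  by rewrite ler_wpM2l// divr_ge0// !mulr_ge0 ?(ltW Gp).
have cN : 0 <= c ^+ 2 / N%:R by rewrite divr_ge0 ?sqr_ge0// ltW.
have P3 : 1 / (64 * (2 * G)) * (c ^+ 2 / N%:R) <= c ^+ 2 / N%:R.
  by rewrite ler_piMl// ler_pdivrMr ?mulr_gt0//; clear -G8; lra.
have CC0 : 0 <= C + 110 * c ^+ 2 by rewrite addr_ge0// mulr_ge0// sqr_ge0.
have cNM : (C + 110 * c ^+ 2) / N%:R <= (C + 110 * c ^+ 2) / M%:R.
  by rewrite ler_wpM2l// lef_pV2.
have E1 : 1 / (64 * (2 * G)) * (u ^+ 2 / 9 - 32 * D ^+ 2) = u ^+ 2 / (18 * (64 * G)) - D ^+ 2 / G / 4.
  by field; rewrite gt_eqF.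
have E2 : (u ^+ 2 + D ^+ 2) / (18 * (64 * G)) = u ^+ 2 / (18 * (64 * G)) + D ^+ 2 / G / 64 / 18.
  by field; rewrite gt_eqF.
have DG0 : 0 <= D ^+ 2 / G by rewrite divr_ge0 ?sqr_ge0// ltW.
rewrite E2; rewrite E1 mulrDr in P2.
have e99 : (99 * c ^+ 2) / N%:R = 99 * (c ^+ 2 / N%:R) by rewrite mulrA.
have e8 : (8 * c ^+ 2) / N%:R = 8 * (c ^+ 2 / N%:R) by rewrite mulrA.
have e110 : (C + 110 * c ^+ 2) / N%:R = C / N%:R + 110 * (c ^+ 2 / N%:R) by rewrite mulrDl mulrA.
rewrite e99 in Sle; rewrite e8 in EbL; rewrite e110 in cNM *.
clear Ea Eb EaL EA0 e99 e8 e110; clearbody EA EB.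
move: (c ^+ 2 / N%:R) (D ^+ 2 / G) (u ^+ 2 / _) EB EA (C / N%:R) Sle EbL cNM P2 P1 P P3 cN DG0 Dq.
clear; move=> *; lra.
Qed.

(** [excess_lower] is used for [(l, l')] and for [(l', l)], as in strong monotonicity of a gradient.
    [K] depends on [h] alone: constants depending on the covectors occurred only in errors that
    vanish as [N] grows. *)
Lemma gexp_expansive h : 0 < h -> exists K, 0 < K /\ forall l l' m, good h l -> good h l' ->
  (forall j, `|gexp l 1 0 j - gexp l' 1 0 j| <= m) -> forall i, `|l 0 i - l' 0 i| <= K * m.
Proof.
move=> h0; pose G := 4 * (2 + 66 * (64 / h ^+ 2)).
have G0 : 0 < G.
  by rewrite mulr_gt0// addr_gt0// mulr_gt0// divr_gt0// exprn_gt0.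
have K0 : 0 < 18 * (64 * G).
  by apply: mulr_gt0 => //; exact: mulr_gt0.
(* The outer 18 is [2 * 9]: 2 from the square of [|u| + D], 9 from [|y| + D <= 9 (|u| + D)]. *)
exists (18 * (18 * (64 * G))); split; first exact: mulr_gt0.
move=> l l' m gl gl' qm i.
have := excess_lower h0 gl gl'; have := excess_lower h0 gl' gl; rewrite -/G.
rewrite (dist4C l' l) -(sqrrN (l' 0 i0 - _)) opprB.
set D := dist4 l l'; set u := l 0 i0 - l' 0 i0 => e1 e2.
have [Y1 _] := H_difference gl gl'; rewrite -/D -/u in Y1.
set y := gH l 1 - gH l' 1 in Y1.
have D0 : 0 <= D := dist4_ge0 l l'.
have m0 : 0 <= m := le_trans (normr_ge0 _) (qm i0).
(* [gact a 1] is affine in the position, and its gradient is twice the final covector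
   [(gH a 1, beta, p)]. *)
have gE (a b : E) : gact a 1 (gexp b 1) = ell2 a + 2 * (gH a 1 * (gexp b 1 0 i0 - gexp a 1 0 i0)
   + a 0 i1 * (gexp b 1 0 i1 - gexp a 1 0 i1) + a 0 i2 * (gexp b 1 0 i2 - gexp a 1 0 i2)
   + a 0 i3 * (gexp b 1 0 i3 - gexp a 1 0 i3) + a 0 i4 * (gexp b 1 0 i4 - gexp a 1 0 i4)).
  rewrite -[ell2 a]mul1r -gact_gexp /gact (_ : gexp a 1 0 i0 = gA a 1) ?ptE//; ring.
rewrite gE in e1; rewrite gE in e2.
have b1 j x : `|x| * m >= - (x * (gexp l 1 0 j - gexp l' 1 0 j)).
  by rewrite (le_trans (ler_norm _))// normrN normrM ler_wpM2l.
have tot : (u ^+ 2 + D ^+ 2) / (18 * (64 * G)) <= (`|y| + D) * m.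
  have := b1 i0 (- y); have := b1 i1 (- (l 0 i1 - l' 0 i1)); have := b1 i2 (- (l 0 i2 - l' 0 i2)).
  have := b1 i3 (- (l 0 i3 - l' 0 i3)); have := b1 i4 (- (l 0 i4 - l' 0 i4)).
  rewrite !normrN /y /D /dist4; move: e1 e2; rewrite /y /D /dist4.
  by move=> *; lra.
have V2 : (`|u| + D) ^+ 2 <= 2 * (u ^+ 2 + D ^+ 2).
  by rewrite -(real_normK (num_real u)); have := sqr_ge0 (`|u| - D); nra.
rewrite ler_pdivrMr// in tot.
have V3 : (`|u| + D) ^+ 2 <= (`|u| + D) * (18 * (18 * (64 * G)) * m).
  have : (`|y| + D) * m * (18 * (64 * G)) <= (9 * (`|u| + D)) * m * (18 * (64 * G)).
    by rewrite ler_pM2r// ler_wpM2r//; have := normr_ge0 u; lra.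
  lra.
have iu : `|l 0 i - l' 0 i| <= `|u| + D.
  rewrite /D /dist4; move: i; apply: forall_ord5; rewrite -/u;
  have := normr_ge0 u; have := normr_ge0 (l 0 i1 - l' 0 i1); have := normr_ge0 (l 0 i2 - l' 0 i2);
  have := normr_ge0 (l 0 i3 - l' 0 i3); have := normr_ge0 (l 0 i4 - l' 0 i4); clear; lra.
rewrite (le_trans iu)//.
have [->|V0] := eqVneq (`|u| + D) 0; first by rewrite mulr_ge0// mulr_ge0// ltW.
have Vp : 0 < `|u| + D by rewrite lt_neqAle eq_sym V0 addr_ge0.
by rewrite -(ler_pM2l Vp) -expr2.
Qed.

End Expansiveness.

(** * The sub-Riemannian distance *)

Section HorizontalReach.
Context {R : realType}.
Local Notation E := 'rV[R]_5.
Local Notation mu := (@lebesgue_measure R).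
Variables (gamma : R -> E) (u : R -> subvs_of (layer (@gCarnot R) 1)).
Hypothesis hor : horizontal (G := @gCarnot R) gamma u.

Let v i s : R := vsval (u s) 0 i.
Let I01 : set R := [set` `[0, 1]].

Let v34 s : v i3 s = 0 /\ v i4 s = 0.
Proof.
by have := subvsP (u s); rewrite [_ \in _]mem_glayer1 => /andP[/eqP ? /eqP ?].
Qed.

Let iv i : mu.-integrable I01 (EFin \o v i).
Proof. by have [_ h _] := hor; exact: h. Qed.

Let cgamma : {within I01, continuous gamma}. Proof. by have [] := hor. Qed.

Let cg0 : {within I01, continuous (fun s => gamma s 0 i0)}.
Proof.
move=> x; apply: (@continuous_comp (subspace I01) _ _ gamma (fun N : E => N 0 i0)); first exact: cgamma.
exact: coord_continuous.
Qed.

Let mI : (measurable : set (set (measurableTypeR R))) I01. Proof. exact: measurable_itv. Qed.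

Let mg0 : measurable_fun (I01 : set (measurableTypeR R)) (fun s : measurableTypeR R => gamma s 0 i0).
Proof. exact: subspace_continuous_measurable_fun. Qed.

Let ig0v i : mu.-integrable I01 (EFin \o (fun s => gamma s 0 i0 * v i s)).
Proof.
have : [bounded gamma s 0 i0 | s in I01].
  have /compact_bounded[M [_ mrt]] := continuous_compact cg0 (@segment_compact R 0 1).
  exists M; split; rewrite ?num_real // => x Mx s Is.
  by apply: (mrt x Mx); exists s.
move=> b; have := integrableMr mI mg0 b (iv i).
by apply: eq_integrable => // s _ /=; rewrite EFinM.
Qed.

Definition speed_fun s : R := Num.sqrt (scalar_product (@gCarnot R) (u s) (u s)).

Lemma speed_funE s : speed_fun s = Num.sqrt (v i0 s ^+ 2 + v i1 s ^+ 2 + v i2 s ^+ 2).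
Proof. by rewrite /speed_fun /= /gdot -!expr2. Qed.

Lemma integrable_speed : mu.-integrable I01 (EFin \o speed_fun).
Proof.
have mv i : measurable_fun (I01 : set (measurableTypeR R)) (v i : measurableTypeR R -> _).
  by apply/measurable_EFinP; exact: measurable_int (iv i).
have igs : mu.-integrable I01 (EFin \o (fun s => `|v i0 s| + `|v i1 s| + `|v i2 s|)).
  have := integrableD mI (integrableD mI (integrable_norm (iv i0)) (integrable_norm (iv i1))) (integrable_norm (iv i2)).
  by apply: eq_integrable => // s _ /=; rewrite !EFinD.
apply: le_integrable igs => //.
  apply/measurable_EFinP; rewrite (_ : speed_fun = Num.sqrt \o
      (fun s => v i0 s ^+ 2 + v i1 s ^+ 2 + v i2 s ^+ 2)); last first.
    by apply/funext => s; rewrite speed_funE.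
  apply: measurableT_comp; first exact: continuous_measurable_fun (@sqrt_continuous R).
  have m2 i := measurable_funX 2 (mv i).
  exact: (measurable_funD (measurable_funD (m2 i0) (m2 i1)) (m2 i2)).
move=> s _ /=; rewrite lee_fin speed_funE ger0_norm ?sqrtr_ge0//.
rewrite -(sqrtr_sqr (`|v i0 s| + _ + _)).
rewrite ler_wsqrtr// -!(real_normK (num_real (v _ s))).
have := normr_ge0 (v i0 s); have := normr_ge0 (v i1 s); have := normr_ge0 (v i2 s); nra.
Qed.

Variable e : R.
Hypothesis e0 : 0 < e.
(** Adding [e] makes the arc length strictly increasing even where the curve is at rest, so that
    times can be ordered by it. *)
Let w s := speed_fun s + e.

Let iw : mu.-integrable I01 (EFin \o w).
Proof.
have ic : mu.-integrable I01 (EFin \o (fun=> e)).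
  by apply: continuous_compact_integrable; [exact: segment_compact|move=> x; exact: cvg_cst].
have := integrableD mI integrable_speed ic.
by apply: eq_integrable => // s _ /=; rewrite EFinD.
Qed.

Definition arc s : R := \int[mu]_(r in [set` `[0, s]]) w r.

Let sub s t : 0 <= s -> t <= 1 -> [set` `]s, t]] `<=` I01.
Proof.
move=> s0 t1 r; rewrite /I01 /= !in_itv/= => /andP[sr rt].
by rewrite (le_trans s0 (ltW sr)) (le_trans rt t1).
Qed.

Let intS f s t : 0 <= s -> t <= 1 -> mu.-integrable I01 (EFin \o f) ->
  mu.-integrable [set` `]s, t]] (EFin \o f).
Proof. by move=> s0 t1; apply: integrableS => //; exact: sub. Qed.

Let incr f s t : 0 <= s -> s <= t -> t <= 1 -> mu.-integrable I01 (EFin \o f) ->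
  \int[mu]_(r in [set` `[0, t]]) f r - \int[mu]_(r in [set` `[0, s]]) f r
  = \int[mu]_(r in [set` `]s, t]]) f r.
Proof.
move=> s0 st t1 fi; apply: Rintegral_itvB; rewrite ?bnd_simp//.
apply: integrableS fi => //; apply: subset_itvl; rewrite bnd_simp//.
Qed.

Let arc_incr s t : 0 <= s -> s <= t -> t <= 1 ->
  arc t - arc s = \int[mu]_(r in [set` `]s, t]]) w r.
Proof. by move=> s0 st t1; exact: incr. Qed.

Let arc_lt s t : 0 <= s -> s < t -> t <= 1 -> arc s < arc t.
Proof.
move=> s0 st t1; rewrite -subr_gt0 arc_incr ?(ltW st)//.
apply: (@lt_le_trans _ _ (e * (t - s))); first by rewrite mulr_gt0// subr_gt0.
have -> : e * (t - s) = \int[mu]_(r in [set` `]s, t]]) e.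
  rewrite [RHS]Rintegral_cst//.
  have muE : mu [set` `]s, t]] = (t - s)%:E by rewrite lebesgue_measure_itv/= lte_fin st.
  by congr (_ * _); exact: (congr1 fine (esym muE)).
apply: le_Rintegral => //; [|exact: intS|].
  apply: (intS (f := fun=> e)) => //.
  by apply: continuous_compact_integrable; [exact: segment_compact|move=> x; exact: cvg_cst].
by move=> r _; rewrite lerDr sqrtr_ge0.
Qed.

Let lf i s : left_field (@gCarnot R) (vsval (u s)) (gamma s) 0 i =
  pt (v i0 s) (v i1 s) (v i2 s) (gamma s 0 i0 * v i1 s) (gamma s 0 i0 * v i2 s) 0 i.
Proof.
have [h3 h4] := v34 s; rewrite left_fieldE -/(v i3 s).
by rewrite -!/(v _ s) h3 h4 !add0r.
Qed.

Let gincr f i s t : (forall r, left_field (@gCarnot R) (vsval (u r)) (gamma r) 0 i = f r) ->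
  mu.-integrable I01 (EFin \o f) -> 0 <= s -> s <= t -> t <= 1 ->
  gamma t 0 i - gamma s 0 i = \int[mu]_(r in [set` `]s, t]]) f r.
Proof.
move=> fE fi s0 st t1; have [_ _ H] := hor.
have t01 : t \in `[0, 1] by rewrite in_itv/= t1 (le_trans s0).
have s01 : s \in `[0, 1] by rewrite in_itv/= s0 (le_trans st).
rewrite (H t t01) (H s s01) opprD addrACA subrr add0r.
under eq_Rintegral do rewrite fE.
under [X in _ - X]eq_Rintegral do rewrite fE.
exact: incr.
Qed.

Let ginc3 s t : 0 <= s -> s <= t -> t <= 1 ->
  [/\ gamma t 0 i0 - gamma s 0 i0 = \int[mu]_(r in [set` `]s, t]]) v i0 r,
      gamma t 0 i1 - gamma s 0 i1 = \int[mu]_(r in [set` `]s, t]]) v i1 r &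
      gamma t 0 i2 - gamma s 0 i2 = \int[mu]_(r in [set` `]s, t]]) v i2 r].
Proof.
by move=> s0 st t1; split; apply: gincr => // r; rewrite lf ptE.
Qed.

Let cauchy_schwarz3 (x y z a b c : R) :
  x * a + y * b + z * c <= Num.sqrt (x ^+ 2 + y ^+ 2 + z ^+ 2) * Num.sqrt (a ^+ 2 + b ^+ 2 + c ^+ 2).
Proof.
rewrite -sqrtrM ?addr_ge0 ?sqr_ge0// (le_trans (ler_norm _))// -sqrtr_sqr ler_wsqrtr//.
have := sqr_ge0 (x * b - y * a); have := sqr_ge0 (x * c - z * a); have := sqr_ge0 (y * c - z * b).
nra.
Qed.

Let v_le (i : 'I_5) s : (i < 3)%N -> `|v i s| <= w s.
Proof.
move=> i3; apply: (@le_trans _ _ (speed_fun s)); last by rewrite lerDl ltW.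
rewrite speed_funE -sqrtr_sqr ler_wsqrtr//; move: i i3; apply: forall_ord5 => // _;
have := sqr_ge0 (v i0 s); have := sqr_ge0 (v i1 s); have := sqr_ge0 (v i2 s); lra.
Qed.

(** For the vertical part, the increment of [c] minus [a(s)] times that of [b] is the integral of
    [(a(r) - a(s)) v(r)], in which both factors are controlled by arc length. *)
Let arc_hstep s t : 0 <= s -> s <= t -> t <= 1 -> hstep (arc t - arc s) (gamma s) (gamma t).
Proof.
move=> s0 st t1; have mD : (measurable : set (set (measurableTypeR R))) [set` `]s, t]] by exact: measurable_itv.
have ag s' t' : 0 <= s' -> s' <= t' -> t' <= 1 -> 0 <= arc t' - arc s'.
  move=> s0' st' t1'; rewrite arc_incr//; apply: Rintegral_ge0 => r _.
  by rewrite addr_ge0 ?sqrtr_ge0// ltW.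
have sq s' t' : 0 <= s' -> s' <= t' -> t' <= 1 ->
   (gamma t' 0 i0 - gamma s' 0 i0) ^+ 2 + (gamma t' 0 i1 - gamma s' 0 i1) ^+ 2
        + (gamma t' 0 i2 - gamma s' 0 i2) ^+ 2 <= (arc t' - arc s') ^+ 2.
  move=> s0' st' t1'; have mD' : (measurable : set (set (measurableTypeR R))) [set` `]s', t']] by exact: measurable_itv.
  have [x y z] := ginc3 s0' st' t1'.
  set X := _ - _ in x *; set Y := gamma t' 0 i1 - _ in y *; set Z := gamma t' 0 i2 - _ in z *.
  have J i : mu.-integrable [set` `]s', t']] (EFin \o v i) by exact: intS.
  have JZ i k : mu.-integrable [set` `]s', t']] (EFin \o (fun r => k * v i r)).
    by have := integrableZl mD' k (J i); apply: eq_integrable => // r _ /=; rewrite EFinM.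
  have JD : mu.-integrable [set` `]s', t']] (EFin \o (fun r => X * v i0 r + Y * v i1 r + Z * v i2 r)).
    have := integrableD mD' (integrableD mD' (JZ i0 X) (JZ i1 Y)) (JZ i2 Z).
    by apply: eq_integrable => // r _ /=; rewrite !EFinD.
  have JD2 : mu.-integrable [set` `]s', t']] (EFin \o (fun r => X * v i0 r + Y * v i1 r)).
    have := integrableD mD' (JZ i0 X) (JZ i1 Y).
    by apply: eq_integrable => // r _ /=; rewrite !EFinD.
  set N2 := X ^+ 2 + Y ^+ 2 + Z ^+ 2.
  have N20 : 0 <= N2 by rewrite !addr_ge0// sqr_ge0.
  (* Testing the velocity against the increment vector itself turns the squared norm into a single
     scalar integral. *)
  have : N2 <= Num.sqrt N2 * (arc t' - arc s').
    rewrite arc_incr// -RintegralZl//; last exact: intS.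
    have N2E : N2 = \int[mu]_(r in [set` `]s', t']]) (X * v i0 r + Y * v i1 r + Z * v i2 r).
      by rewrite !RintegralD// !RintegralZl// -x -y -z /N2 !expr2.
    rewrite [leLHS]N2E; apply: le_Rintegral => //.
      by have := integrableZl mD' (Num.sqrt N2) (intS s0' t1' iw); apply: eq_integrable => // r _ /=; rewrite EFinM.
    move=> r _; rewrite (le_trans (cauchy_schwarz3 _ _ _ _ _ _))// -/N2 -speed_funE.
    by rewrite ler_wpM2l ?sqrtr_ge0// lerDl ltW.
  have sN := sqr_sqrtr N20; rewrite -{1 3}sN => h.
  rewrite ler_sqr ?nnegrE ?sqrtr_ge0 ?ag//.
  have [->|q0] := eqVneq (Num.sqrt N2) 0; first exact: ag.
  have qp : 0 < Num.sqrt N2 by rewrite lt_neqAle eq_sym q0 sqrtr_ge0.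
  by rewrite -(ler_pM2l qp) -expr2.
have cross (i k : 'I_5) : (i < 3)%N -> (forall r, left_field (@gCarnot R) (vsval (u r)) (gamma r) 0 k = gamma r 0 i0 * v i r) ->
    gamma t 0 i - gamma s 0 i = \int[mu]_(r in [set` `]s, t]]) v i r ->
  `|gamma t 0 k - gamma s 0 k - gamma s 0 i0 * (gamma t 0 i - gamma s 0 i)| <= (arc t - arc s) ^+ 2.
  move=> i3 lk ->; rewrite (gincr lk)// -RintegralZl//; last exact: intS.
  have J1 : mu.-integrable [set` `]s, t]] (EFin \o (fun r => gamma r 0 i0 * v i r)) by exact: intS.
  have J2 : mu.-integrable [set` `]s, t]] (EFin \o (fun r => gamma s 0 i0 * v i r)).
    by have := integrableZl mD (gamma s 0 i0) (intS s0 t1 (iv i)); apply: eq_integrable => // r _ /=; rewrite EFinM.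
  have J3 : mu.-integrable [set` `]s, t]] (EFin \o (fun r => gamma r 0 i0 * v i r - gamma s 0 i0 * v i r)).
    by have := integrableB mD J1 J2; apply: eq_integrable => // r _ /=; rewrite EFinB.
  rewrite -RintegralB// (le_trans (le_normr_Rintegral _ _))//.
  rewrite expr2 {2}arc_incr// -RintegralZl//; last exact: intS.
  apply: le_Rintegral => //; first exact: integrable_norm.
    by have := integrableZl mD (arc t - arc s) (intS s0 t1 iw); apply: eq_integrable => // r _ /=; rewrite EFinM.
  move=> r /=; rewrite in_itv/= => /andP[/ltW sr rt].
  rewrite -mulrBl normrM ler_pM ?v_le//.
  apply: (@le_trans _ _ (arc r - arc s)).
    apply: norm_le_sqr; first by rewrite ag// (le_trans rt).
    have := sq s r s0 sr (le_trans rt t1).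
    have := sqr_ge0 (gamma r 0 i1 - gamma s 0 i1); have := sqr_ge0 (gamma r 0 i2 - gamma s 0 i2).
    lra.
  by rewrite lerD2r -subr_ge0 ag// (le_trans s0).
have [x y z] := ginc3 s0 st t1.
split; [exact: sq|apply: cross => //|apply: cross => //]; by move=> r; rewrite lf ptE.
Qed.

Let arc0 : arc 0 = 0.
Proof. by rewrite /arc set_itv1 Rintegral_set1. Qed.

(** The intermediate value theorem cuts the curve into [N] pieces of equal arc length; strict
    monotonicity of [arc] orders the cutting times and forces the first to be 0 and the last to be
    1. *)
Lemma horizontal_chain : reach (gamma 0) (gamma 1) (arc 1).
Proof.
move=> N N0; have Np : 0 < N%:R :> R by rewrite ltr0n.
have ca : {within I01, continuous arc} by apply: parameterized_integral_continuous.
have a1 : 0 <= arc 1 by rewrite -arc0 ltW// arc_lt.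
have ex (i : nat) : (i <= N)%N -> exists2 s, s \in `[0, 1] & arc s = i%:R / N%:R * arc 1.
  move=> iN; apply: IVT => //; rewrite arc0 min_l ?max_r//.
  rewrite mulr_ge0 ?divr_ge0//= ler_piMl// ler_pdivrMr// mul1r ler_nat//.
have [f Hf] : exists f : nat -> R, forall i, (i <= N)%N -> f i \in `[0, 1] /\ arc (f i) = i%:R / N%:R * arc 1.
  have h i : exists s, (i <= N)%N -> s \in `[0, 1] /\ arc s = i%:R / N%:R * arc 1.
    by have [/ex[s s1 s2]|_] := boolP (i <= N)%N; [exists s|exists 0].
  by exists (fun i => sval (cid (h i))) => i iN; exact: (svalP (cid (h i)) iN).
have inj s t : s \in `[0, 1] -> t \in `[0, 1] -> arc s <= arc t -> s <= t.
  rewrite !in_itv/= => /andP[s0 s1] /andP[t0 t1] st; rewrite leNgt; apply/negP => ts.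
  by have := arc_lt t0 ts s1; rewrite ltNge st.
have f0 : f 0%N = 0.
  have [h1 h2] := Hf 0%N isT; apply/eqP; rewrite eq_le.
  have z01 : 0 \in `[0 : R, 1] by rewrite in_itv/= lexx ler01.
  by apply/andP; split; apply: inj => //; rewrite h2 arc0 !mul0r.
have fN : f N = 1.
  have [h1 h2] := Hf N (leqnn _); apply/eqP; rewrite eq_le.
  have o01 : 1 \in `[0 : R, 1] by rewrite in_itv/= lexx ler01.
  by apply/andP; split; apply: inj => //; rewrite h2 divff ?gt_eqF// mul1r.
exists (fun i => gamma (f i)); split; rewrite ?f0 ?fN// => i iN.
have [h1 h2] := Hf i (ltnW iN); have [h3 h4] := Hf i.+1 iN.
have st : f i <= f i.+1.
  by apply: inj => //; rewrite h2 h4 ler_wpM2r// ler_pM2r ?invr_gt0// ler_nat.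
move: h1 h3; rewrite !in_itv/= => /andP[s0 s1] /andP[t0 t1].
have := arc_hstep s0 st t1; rewrite h2 h4 -natr1.
by rewrite (_ : _ - _ = arc 1 / N%:R)//; field; rewrite gt_eqF.
Qed.

End HorizontalReach.

(** * Distances along geodesics *)

Section Distance.
Context {R : realType}.
Local Notation E := 'rV[R]_5.
Local Notation mu := (@lebesgue_measure R).
Implicit Types (l g : E) (t s T L : R).

(** The slack [L - len'] is used as the extra speed, which makes the total arc length exactly
    [L]. *)
Lemma curve_length_reach gamma (u : R -> subvs_of (layer (@gCarnot R) 1)) L :
  horizontal (G := @gCarnot R) gamma u ->
  (curve_length (G := @gCarnot R) u < L%:E)%E -> reach (gamma 0) (gamma 1) L.
Proof.
move=> hor len; have isp := integrable_speed hor.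
pose len' := \int[mu]_(s in [set` `[0, 1]]) speed_fun u s.
have lenE : curve_length (G := @gCarnot R) u = len'%:E.
  rewrite /len' /Rintegral fineK//; apply: integrable_fin_num => //.
have e0 : 0 < L - len' by rewrite subr_gt0 -lte_fin -lenE.
have := horizontal_chain hor e0; rewrite (_ : arc u (L - len') 1 = L)//.
rewrite /arc RintegralD//; last first.
  by apply: continuous_compact_integrable; [exact: segment_compact|move=> x; exact: cvg_cst].
have muE : mu [set` `[0, 1]] = (1 : R)%:E by rewrite lebesgue_measure_itv/= lte_fin ltr01 -EFinB subr0.
have -> : \int[mu]_(x in [set` `[0, 1]]) (L - len') = L - len'.
  rewrite [LHS]Rintegral_cst//.
  by rewrite -[RHS]mulr1; congr (_ * _); exact: (congr1 fine muE).
by rewrite -/len'; ring.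
Qed.

Lemma sr_dist_reach p q L : (sr_dist (@gCarnot R) p q < L%:E)%E -> reach p q L.
Proof.
move=> /ereal_inf_lt[_ [gamma [u [hor <- <- ->]]] h].
exact: curve_length_reach h.
Qed.

Lemma ex_derive1_continuous (f : R -> R) :
  (forall x : R, exists d, is_derive x 1 f d) -> continuous f.
Proof.
by move=> h x; have [d [df _]] := h x; apply/differentiable_continuous/derivable1_diffP.
Qed.

Lemma Rintegral_derive (F f : R -> R) t : 0 <= t -> continuous f ->
  (forall x : R, is_derive x 1 F (f x)) ->
  \int[mu]_(s in [set` `[0, t]]) f s = F t - F 0.
Proof.
rewrite le_eqVlt => /orP[/eqP <- _ _|t0 cf dF].
  by rewrite set_itv1 Rintegral_set1 subrr.
have cF := is_derive1_continuous dF.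
rewrite /Rintegral (continuous_FTC2 t0 (F := F))//.
- exact: continuous_subspaceT.
- split.
  + by move=> x _; have [] := dF x.
  + by apply: cvg_at_right_filter; exact: cF.
  + by apply: cvg_at_left_filter; exact: cF.
- by move=> x _; rewrite derive1E; apply: derive_val.
Qed.

Lemma row5_continuous (T : topologicalType) (f : T -> E) :
  (forall i, continuous (fun x => f x 0 i)) -> continuous f.
Proof.
move=> h; rewrite (_ : f = (fun x => f x 0 i0 *: 'e_i0 + f x 0 i1 *: 'e_i1 + f x 0 i2 *: 'e_i2
   + f x 0 i3 *: 'e_i3 + f x 0 i4 *: 'e_i4)).
  have hZ i (w : E) : continuous (fun x => f x 0 i *: w).
    by move=> x; apply: continuousZl; exact: h.
  have hD (g1 g2 : T -> E) : continuous g1 -> continuous g2 -> continuous (fun x => g1 x + g2 x).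
    by move=> c1 c2 x; apply: continuousD; [exact: c1|exact: c2].
  exact: (hD _ _ (hD _ _ (hD _ _ (hD _ _ (hZ _ _) (hZ _ _)) (hZ _ _)) (hZ _ _)) (hZ _ _)).
by apply/funext => x; apply: eq_row5; rewrite !mxE /=; ring.
Qed.

Section Geodesic.
Variables (l : E) (t0 T : R).
Hypotheses (k0 : 0 < kap l) (T0 : 0 <= T).

Let tt s := t0 + T * s.
Let dtt s : is_derive s 1 tt T.
Proof.
apply: (is_derive_eq (is_derive1D (is_derive1_cst t0 s)
  (is_derive1M (is_derive1_cst T s) (is_derive1_id s)))).
by ring.
Qed.

Let dc f (df : R -> R) s : (forall x : R, is_derive x 1 f (df x)) ->
  is_derive s 1 (fun s => f (tt s)) (df (tt s) * T).
Proof. by move=> h; exact: is_derive1_comp. Qed.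

Let cA s := gA l (tt s).
Let dA s : is_derive s 1 cA (gH l (tt s) * T). Proof. exact/dc/gA_derive. Qed.
Let dH s : is_derive s 1 (fun s => gH l (tt s)) (- (kap l ^+ 2 * gA l (tt s) + th l) * T).
Proof. by apply: (dc (df := fun t => - (kap l ^+ 2 * gA l t + th l))); exact: gH_derive. Qed.
Let dM s : is_derive s 1 (fun s => gM l (tt s)) (cA s * T).
Proof. by apply: (dc (df := gA l)); exact: gM_derive. Qed.
Let dS s : is_derive s 1 (fun s => gS l (tt s)) (cA s ^+ 2 * T).
Proof. by apply: (dc (df := fun t => gA l t ^+ 2)); exact: gS_derive. Qed.

Let vel s : E := pt (T * gH l (tt s)) (T * (l 0 i1 + cA s * l 0 i3))
   (T * (l 0 i2 + cA s * l 0 i4)) 0 0.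
Let ctl s : subvs_of (layer (@gCarnot R) 1) := vsproj _ (vel s).
Let gam s : E := gexp l (tt s).

Let ctlE s : vsval (ctl s) = vel s.
Proof. by rewrite /ctl vsprojK// [_ \in _]mem_glayer1 !ptE eqxx. Qed.

Let vel_continuous i : continuous (fun s => vel s 0 i).
Proof.
have cc : continuous (fun s => cA s) := is_derive1_continuous dA.
have cp (b p : R) : continuous (fun s => T * (b + cA s * p)).
  apply: ex_derive1_continuous => x; eexists.
  exact: (is_derive1M (is_derive1_cst T x) (is_derive1D (is_derive1_cst b x) (is_derive1M (dA x) (is_derive1_cst p x)))).
move: i; apply: forall_ord5; rewrite /vel.
- rewrite (_ : (fun s => _) = (fun s => T * gH l (tt s))).
    apply: ex_derive1_continuous => x; eexists.
    exact: (is_derive1M (is_derive1_cst T x) (dH x)).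
  by apply/funext => s; rewrite ptE.
- rewrite (_ : (fun s => _) = (fun s => T * (l 0 i1 + cA s * l 0 i3)))//.
  by apply/funext => s; rewrite ptE.
- rewrite (_ : (fun s => _) = (fun s => T * (l 0 i2 + cA s * l 0 i4)))//.
  by apply/funext => s; rewrite ptE.
- rewrite (_ : (fun s => _) = (fun=> 0)); first by move=> x; exact: cvg_cst.
  by apply/funext => s; rewrite ptE.
- rewrite (_ : (fun s => _) = (fun=> 0)); first by move=> x; exact: cvg_cst.
  by apply/funext => s; rewrite ptE.
Qed.

Let gam_derive i s : is_derive s 1 (fun s => gam s 0 i)
  (left_field (@gCarnot R) (vsval (ctl s)) (gam s) 0 i).
Proof.
rewrite left_fieldE ctlE /vel /gam; move: i; apply: forall_ord5; rewrite !ptE.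
- rewrite (_ : (fun s => _) = cA); first by apply: (is_derive_eq (dA s)); ring.
  by apply/funext => x; rewrite ptE.
- rewrite (_ : (fun s => _) = (fun s => tt s * l 0 i1 + gM l (tt s) * l 0 i3)); last first.
    by apply/funext => x; rewrite ptE.
  apply: (is_derive_eq (is_derive1D (is_derive1M (dtt s) (is_derive1_cst (l 0 i1) s))
    (is_derive1M (dM s) (is_derive1_cst (l 0 i3) s)))).
  by rewrite /cA; ring.
- rewrite (_ : (fun s => _) = (fun s => tt s * l 0 i2 + gM l (tt s) * l 0 i4)); last first.
    by apply/funext => x; rewrite ptE.
  apply: (is_derive_eq (is_derive1D (is_derive1M (dtt s) (is_derive1_cst (l 0 i2) s))
    (is_derive1M (dM s) (is_derive1_cst (l 0 i4) s)))).
  by rewrite /cA; ring.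
- rewrite (_ : (fun s => _) = (fun s => gM l (tt s) * l 0 i1 + gS l (tt s) * l 0 i3)); last first.
    by apply/funext => x; rewrite ptE.
  apply: (is_derive_eq (is_derive1D (is_derive1M (dM s) (is_derive1_cst (l 0 i1) s))
    (is_derive1M (dS s) (is_derive1_cst (l 0 i3) s)))).
  by rewrite /cA; ring.
- rewrite (_ : (fun s => _) = (fun s => gM l (tt s) * l 0 i2 + gS l (tt s) * l 0 i4)); last first.
    by apply/funext => x; rewrite ptE.
  apply: (is_derive_eq (is_derive1D (is_derive1M (dM s) (is_derive1_cst (l 0 i2) s))
    (is_derive1M (dS s) (is_derive1_cst (l 0 i4) s)))).
  by rewrite /cA; ring.
Qed.

Lemma gexp_horizontal : horizontal (G := @gCarnot R) gam ctl.
Proof.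
split.
- apply: continuous_subspaceT; apply: row5_continuous => i.
  by apply: ex_derive1_continuous => s; eexists; exact: gam_derive.
- move=> i; rewrite (_ : (fun s => _) = (EFin \o (fun s => vel s 0 i))); last first.
    by apply/funext => s; rewrite ctlE.
  apply: continuous_compact_integrable; first exact: segment_compact.
  exact/continuous_subspaceT/vel_continuous.
- move=> t; rewrite in_itv/= => /andP[t0' t1] i.
  have cv k : continuous (fun s => vel s 0 k) := vel_continuous (i := k).
  have cg : continuous (fun s => gam s 0 i0).
    by apply: ex_derive1_continuous => s; eexists; exact: gam_derive.
  have cM k : continuous (fun s => gam s 0 i0 * vel s 0 k).
    by move=> s; apply: continuousM; [exact: cg|exact: cv].
  have cont : continuous (fun s => left_field (@gCarnot R) (vsval (ctl s)) (gam s) 0 i).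
    move: i; apply: forall_ord5.
    + rewrite (_ : (fun s => _) = (fun s => vel s 0 i0)); first exact: cv.
      by apply/funext => s; rewrite left_fieldE ctlE ptE.
    + rewrite (_ : (fun s => _) = (fun s => vel s 0 i1)); first exact: cv.
      by apply/funext => s; rewrite left_fieldE ctlE ptE.
    + rewrite (_ : (fun s => _) = (fun s => vel s 0 i2)); first exact: cv.
      by apply/funext => s; rewrite left_fieldE ctlE ptE.
    + rewrite (_ : (fun s => _) = (fun s => gam s 0 i0 * vel s 0 i1)); first exact: cM.
      by apply/funext => s; rewrite left_fieldE ctlE !ptE add0r.
    + rewrite (_ : (fun s => _) = (fun s => gam s 0 i0 * vel s 0 i2)); first exact: cM.
      by apply/funext => s; rewrite left_fieldE ctlE !ptE add0r.
  by rewrite (Rintegral_derive t0' cont (gam_derive i)) addrC subrK.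
Qed.

Lemma gexp_length : curve_length (G := @gCarnot R) ctl = (T * ell l)%:E.
Proof.
rewrite /curve_length.
rewrite (eq_integral (fun=> (T * ell l)%:E)); last first.
  move=> s _; congr EFin; rewrite /= /gdot !ctlE !ptE -!expr2.
  rewrite !exprMn -!mulrDr speed// sqrtrM ?sqr_ge0// sqrtr_sqr ger0_norm//.
have muE : mu [set` `[0, 1]] = (1 : R)%:E by rewrite lebesgue_measure_itv/= lte_fin ltr01 -EFinB subr0.
transitivity ((T * ell l)%:E * mu [set` `[0%R, 1%R]])%E; last by rewrite muE mule1.
exact: integral_cst.
Qed.

Lemma sr_dist_gexp_le : (sr_dist (@gCarnot R) (gexp l t0) (gexp l (t0 + T)) <= (T * ell l)%:E)%E.
Proof.
apply: ereal_inf_lbound; exists gam, ctl; split.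
- exact: gexp_horizontal.
- by rewrite /gam /tt mulr0 addr0.
- by rewrite /gam /tt mulr1.
- by rewrite gexp_length.
Qed.

End Geodesic.

Lemma sr_dist_ge0 p q : (0 <= sr_dist (@gCarnot R) p q)%E.
Proof.
apply: le_ereal_inf_tmp => _ [gamma [u [_ _ _ ->]]]; apply: integral_ge0 => s _.
by rewrite lee_fin sqrtr_ge0.
Qed.

(** A smaller distance would leave room for an [L] below [T * ell l] with [reach], against
    [gexp_minimal]. The arbitrary starting time [t0] supplies the distance from [gexp l t] to
    [gexp l 1] without translating. *)
Lemma sr_dist_gexp l t0 T : 0 < kap l <= 1 -> 0 <= T <= 1 ->
  sr_dist (@gCarnot R) (gexp l t0) (gexp l (t0 + T)) = (T * ell l)%:E.
Proof.
move=> /andP[k0 k1] /andP[T0 T1]; apply/eqP; rewrite eq_le sr_dist_gexp_le//=.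
have [->|Tn0] := eqVneq T 0; first by rewrite mul0r sr_dist_ge0.
have {Tn0}T0 : 0 < T by rewrite lt_neqAle eq_sym Tn0.
rewrite leNgt; apply/negP => h.
have [d dE] : exists d : R, sr_dist (@gCarnot R) (gexp l t0) (gexp l (t0 + T)) = d%:E.
  exists (fine (sr_dist (@gCarnot R) (gexp l t0) (gexp l (t0 + T)))).
  by rewrite fineK// ge0_fin_numE ?sr_dist_ge0// (lt_trans h)// ltry.
have d0 : 0 <= d by rewrite -lee_fin -dE sr_dist_ge0.
rewrite dE lte_fin in h.
pose L := (d + T * ell l) / 2.
have Lh : d < L < T * ell l by rewrite /L; apply/andP; split; lra.
have /sr_dist_reach rch : (sr_dist (@gCarnot R) (gexp l t0) (gexp l (t0 + T)) < L%:E)%E.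
  by rewrite dE lte_fin; case/andP: Lh.
have := @gexp_minimal R l t0 T L _ _ _ rch; rewrite k0 k1 T0 T1 => /(_ isT isT) H.
by have := H ltac:(lra); lra.
Qed.

End Distance.

(** * Interpolating sets and the two families of covectors *)

Section Interp.
Context {R : realType}.
Local Notation E := 'rV[R]_5.
Implicit Types (l : E) (t s : R).

Lemma sr_dist_gexp0 l t : 0 < kap l <= 1 -> 0 <= t <= 1 ->
  sr_dist (@gCarnot R) 0 (gexp l t) = (t * ell l)%:E.
Proof.
by move=> k01 t01; have := sr_dist_gexp 0 k01 t01; rewrite gexp0 add0r.
Qed.

Lemma gexp_in_geo_interp l t (A : set E) : 0 < kap l <= 1 -> 0 <= t <= 1 ->
  A (gexp l 1) -> geo_interp (@gCarnot R) t (lgone (@gCarnot R)) A (gexp l t).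
Proof.
move=> k01 t01 Aq; exists (gexp l 1) => //; rewrite /=.
have o01 : 0 <= (1 : R) <= 1 by rewrite ler01 lexx.
have s01 : 0 <= 1 - t <= 1 by case/andP: t01 => *; apply/andP; split; lra.
rewrite !sr_dist_gexp0// mul1r; split=> //.
by have := sr_dist_gexp t k01 s01; rewrite addrC subrK.
Qed.

Lemma geo_interp_sub t (A L : set E) : 0 < t < 1 ->
  (forall l, L l -> 0 < kap l < 1) -> A `<=` (fun l => gexp l 1) @` L ->
  geo_interp (@gCarnot R) t (lgone (@gCarnot R)) A `<=` (fun l => gexp l t) @` L.
Proof.
move=> t01 kL AL z [q Aq [/= d1 d2]]; have [l Ll ql] := AL q Aq.
exists l => //; have /andP[k0 k1] := kL l Ll.
have k01 : 0 < kap l <= 1 by rewrite k0 ltW.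
have o01 : 0 <= (1 : R) <= 1 by rewrite ler01 lexx.
move: d1 d2; rewrite -ql sr_dist_gexp0// mul1r -!EFinM => d1 d2.
apply/esym; apply: intermediate_unique => //; first exact: kL.
- by move=> e e0; apply: sr_dist_reach; rewrite d1 lte_fin ltrDl.
- by move=> e e0; apply: sr_dist_reach; rewrite d2 lte_fin ltrDl.
Qed.

Definition scale t l : E := pt (l 0 i0) (l 0 i1) (l 0 i2) (t * l 0 i3) (t * l 0 i4).

Lemma kap_scale t l : 0 <= t -> kap (scale t l) = t * kap l.
Proof.
move=> t0; rewrite /kap !ptE !exprMn -mulrDr sqrtrM ?sqr_ge0// sqrtr_sqr ger0_norm//.
Qed.

Lemma th_scale t l : th (scale t l) = t * th l.
Proof. by rewrite /th !ptE; ring. Qed.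

(** Homogeneity: following [l] for time [t] is the dilation of ratio [t] of following for time one
    the covector whose component [p], dual to the second layer, is multiplied by [t]. *)
Lemma gexp_scale t l : 0 < t -> 0 < kap l ->
  gexp l t = pt (t * gexp (scale t l) 1 0 i0) (t * gexp (scale t l) 1 0 i1)
    (t * gexp (scale t l) 1 0 i2) (t ^+ 2 * gexp (scale t l) 1 0 i3)
    (t ^+ 2 * gexp (scale t l) 1 0 i4).
Proof.
move=> t0 k0; have tn : t != 0 by rewrite gt_eqF.
have kn : kap l != 0 by rewrite gt_eqF.
have ks := kap_scale l (ltW t0); have ts := th_scale t l.
have tk : t * kap l * 1 = kap l * t by ring.
have A1 : t * gA (scale t l) 1 = gA l t.
  by rewrite /gA ks ts !ptE tk; field; rewrite tn kn.
have M1 : t ^+ 2 * gM (scale t l) 1 = gM l t.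
  by rewrite /gM ks ts !ptE tk; field; rewrite tn kn.
have S1 : t ^+ 3 * gS (scale t l) 1 = gS l t.
  by rewrite /gS /= ks ts !ptE tk; field; rewrite tn kn.
by apply: eq_row5; rewrite !ptE -?A1 -?M1 -?S1; ring.
Qed.

Lemma sin_le_abs (x : R) : `|sin x| <= `|x|.
Proof.
have h z : `|@cos R z| <= 1 by rewrite ler_norml cos_geN1 cos_le1.
by have := derive_bounded_lipschitz 0 x (@is_derive_sin R) h; rewrite sin0 !subr0 mul1r.
Qed.

Lemma cos_ge (x : R) : 1 - x ^+ 2 / 2 <= cos x.
Proof.
have -> : cos x = 1 - 2 * sin (x / 2) ^+ 2.
  rewrite {1}(_ : x = x / 2 *+ 2); last by rewrite mulr2n; field.
  by rewrite cos_mulr2n cos2sin2 mulr2n; ring.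
have := sqr_le2 (sin_le_abs (x / 2)); rewrite real_normK ?num_real//; lra.
Qed.

Lemma sin_ge (x : R) : 0 <= x -> x * (1 - x ^+ 2 / 2) <= sin x.
Proof.
move=> x0; have [z /andP[z0 zx]] := MVT_le (@is_derive_sin R) x0.
rewrite sin0 !subr0 => ->; rewrite mulrC ler_wpM2r//.
rewrite (le_trans _ (cos_ge z))// lerD2l lerN2 ler_pM2r ?invr_gt0//.
by rewrite ler_sqr ?nnegrE.
Qed.

(** Here [k * t <= 1 / 2], and [7 / 8] is [1 - x ^+ 2 / 2] at [x = 1 / 2]. *)
Lemma sinc_bounds k t : 0 < k <= 1 / 2 -> 0 <= t <= 1 ->
  7 / 8 * t <= sin (k * t) / k <= t.
Proof.
move=> /andP[k0 k1] /andP[t0 t1]; have kt0 : 0 <= k * t by rewrite mulr_ge0// ltW.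
have kt1 : k * t <= 1 / 2 by rewrite -[leRHS]mulr1 ler_pM// ltW.
apply/andP; split.
  rewrite ler_pdivlMr// (le_trans _ (sin_ge kt0))//.
  have : (k * t) ^+ 2 <= (1 / 2) ^+ 2 by rewrite ler_sqr ?nnegrE.
  move=> h; rewrite (_ : 7 / 8 * t * k = k * t * (7 / 8)); last by ring.
  by rewrite ler_wpM2l//; lra.
rewrite ler_pdivrMr// [t * _]mulrC (le_trans (ler_norm _))// (le_trans (sin_le_abs _))//.
by rewrite ger0_norm.
Qed.

Lemma gH_lower l t : 0 < kap l <= 1 / 2 -> 0 <= t <= 1 -> 0 <= l 0 i0 ->
  7 / 8 * l 0 i0 - `|th l| <= gH l t.
Proof.
move=> kb t01 u0; have /andP[s1 s2] := sinc_bounds kb t01.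
have /andP[t0 t1] := t01; have /andP[k0 k1] := kb.
have c1 : 7 / 8 <= cos (kap l * t).
  have kt1 : (kap l * t) ^+ 2 <= (1 / 2) ^+ 2.
    rewrite ler_sqr ?nnegrE// ?mulr_ge0// ?(ltW k0)//.
    by rewrite -[leRHS]mulr1 ler_pM// ltW.
  by rewrite (le_trans _ (cos_ge _))//; lra.
rewrite /gH lerB//; first by rewrite mulrC ler_wpM2l.
rewrite (le_trans (ler_norm _))// normrM ler_piMr// ger0_norm; first by rewrite (le_trans s2).
by rewrite (le_trans _ s1)// mulr_ge0//; lra.
Qed.

Definition box (lo hi : 'I_5 -> R) : set E := [set l | forall i, lo i <= l 0 i <= hi i].

Lemma kap_bounds l : 0 < l 0 i3 -> l 0 i3 ^+ 2 + l 0 i4 ^+ 2 <= 1 / 4 -> 0 < kap l <= 1 / 2.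
Proof.
move=> p0 p1; apply/andP; split.
  by rewrite sqrtr_gt0 ltr_pwDl ?sqr_ge0// exprn_gt0.
rewrite -[1 / 2]ger0_norm; last by lra.
rewrite -sqrtr_sqr ler_wsqrtr//; lra.
Qed.

(** The box for [t] is the image under [scale t] of the box for 1. Since [u >= 1] and [th] is small,
    all these covectors are good with the same constant, whatever [t] is. *)
Definition genlo t (i : 'I_5) : R := nth 0 [:: 1; 0; 0; t / 8; t / 8] i.
Definition genhi t (i : 'I_5) : R := nth 0 [:: 3 / 2; 1 / 8; 1 / 8; t / 4; t / 4] i.

Lemma gen_good t l : 0 < t <= 1 -> box (genlo t) (genhi t) l -> good (1 / 2) l.
Proof.
move=> /andP[t0 t1] bl; have := bl i0; have := bl i1; have := bl i2; have := bl i3; have := bl i4.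
rewrite /genlo /genhi /= => /andP[p4 q4] /andP[p3 q3] /andP[p2 q2] /andP[p1 q1] /andP[p0 q0].
have kb : 0 < kap l <= 1 / 2.
  by apply: kap_bounds; [lra|nra].
have thb : `|th l| <= 1 / 16.
  rewrite /th ger0_norm; last by rewrite addr_ge0// mulr_ge0//; lra.
  have h1 : l 0 i1 * l 0 i3 <= 1 / 8 * (1 / 4) by rewrite ler_pM//; lra.
  have h2 : l 0 i2 * l 0 i4 <= 1 / 8 * (1 / 4) by rewrite ler_pM//; lra.
  lra.
case/andP: (kb) => k0 k1; split => //.
  by apply: forall_ord5; rewrite ler_norml; apply/andP; split; lra.
move=> s /andP[s0 s1].
have s01 : 0 <= s <= 1 by apply/andP; split; lra.
have u0 : 0 <= l 0 i0 by lra.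
by have := gH_lower kb s01 u0; lra.
Qed.

(** The signs make [th] negative and bounded away from 0, so [gH] is pushed upwards although [u] may
    be negative; [p] stays small enough for [kap <= 1 / 2]. *)
Definition spelo t (i : 'I_5) : R := nth 0 [:: - t; -1; 0; 1 / 4; 0] i.
Definition spehi t (i : 'I_5) : R := nth 0 [:: t; - (1 / 2); 1 / 4; 3 / 8; 1 / 8] i.

Lemma spe_bounds t l : 0 < t <= 1 / 64 -> box (spelo t) (spehi t) l ->
  [/\ 0 < kap l <= 1 / 2, `|l 0 i0| <= t, - 1 <= th l <= - (1 / 16) & forall i, `|l 0 i| <= 2].
Proof.
move=> /andP[t0 t1] bl; have := bl i0; have := bl i1; have := bl i2; have := bl i3; have := bl i4.
rewrite /spelo /spehi /= => /andP[p4 q4] /andP[p3 q3] /andP[p2 q2] /andP[p1 q1] /andP[p0 q0].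
split.
- by apply: kap_bounds; [lra|nra].
- by rewrite ler_norml p0.
- rewrite /th; have h1 : 1 / 2 * (1 / 4) <= - l 0 i1 * l 0 i3 by rewrite ler_pM//; lra.
  have h1' : - l 0 i1 * l 0 i3 <= 1 * (3 / 8) by rewrite ler_pM//; lra.
  have h2 : l 0 i2 * l 0 i4 <= 1 / 4 * (1 / 8) by rewrite ler_pM//; lra.
  have h2' : 0 <= l 0 i2 * l 0 i4 by rewrite mulr_ge0//; lra.
  by apply/andP; split; lra.
- by apply: forall_ord5; rewrite ler_norml; apply/andP; split; lra.
Qed.

(** For [s >= 1 / 2] the sine term is at least [1 / 16 * (7 / 16) = 7 / 256], and the cosine term is
    at least [- t >= - 4 / 256]; this leaves [3 / 256 >= 1 / 128]. *)
Lemma spe_good t l : 0 < t <= 1 / 64 -> box (spelo t) (spehi t) l -> good (1 / 128) l.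
Proof.
move=> t01 bl; have [kb ub /andP[th1 th2] lb] := spe_bounds t01 bl.
case/andP: (kb) => k0 k1; split => // s /andP[s0 s1].
have s01 : 0 <= s <= 1 by apply/andP; split; lra.
have /andP[q1 q2] := sinc_bounds kb s01.
have h1 : - t <= l 0 i0 * cos (kap l * s).
  rewrite lerNl (le_trans (ler_norm _))// normrN normrM (le_trans _ ub)// ler_piMr//.
  by rewrite ler_norml cos_geN1 cos_le1.
have h2 : 1 / 16 * (7 / 16) <= - th l * (sin (kap l * s) / kap l) by rewrite ler_pM//; lra.
by rewrite /gH; case/andP: t01 => *; lra.
Qed.

Lemma gA_upper l t : 0 < kap l -> 0 <= t ->
  `|gA l t| <= `|l 0 i0| * t + `|th l| * t ^+ 2 / 2.
Proof.
move=> k0 t0; rewrite /gA (le_trans (ler_normD _ _))// lerD//.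
  rewrite normrM ler_wpM2l// normrM normfV (gtr0_norm k0) ler_pdivrMr// (le_trans (sin_le_abs _))//.
  by rewrite normrM (gtr0_norm k0) (ger0_norm t0) mulrC.
rewrite normrM -mulrA ler_wpM2l// normrM normfV (ger0_norm (sqr_ge0 _)).
rewrite ler_pdivrMr ?exprn_gt0// ler0_norm ?subr_le0 ?cos_le1//.
have := cos_ge (kap l * t); rewrite exprMn; lra.
Qed.

Section ContinuityAt.
Variables (T : topologicalType) (x : T).
Implicit Types f g : T -> R.

Lemma row5_continuous_at (f : T -> E) :
  (forall i, {for x, continuous (fun y => f y 0 i)}) -> {for x, continuous f}.
Proof.
move=> h; rewrite (_ : f = (fun x => f x 0 i0 *: 'e_i0 + f x 0 i1 *: 'e_i1 + f x 0 i2 *: 'e_i2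
   + f x 0 i3 *: 'e_i3 + f x 0 i4 *: 'e_i4)); last first.
  by apply/funext => y; apply: eq_row5; rewrite !mxE /=; ring.
have hZ i (w : E) : {for x, continuous (fun x => f x 0 i *: w)}.
  by apply: continuousZl; exact: h.
have hD (g1 g2 : T -> E) : {for x, continuous g1} -> {for x, continuous g2} ->
    {for x, continuous (fun x => g1 x + g2 x)}.
  by move=> c1 c2; apply: continuousD; [exact: c1|exact: c2].
exact: (hD _ _ (hD _ _ (hD _ _ (hD _ _ (hZ _ _) (hZ _ _)) (hZ _ _)) (hZ _ _)) (hZ _ _)).
Qed.

Lemma cont_cst (c : R) : {for x, continuous (fun _ : T => c)}.
Proof. exact: cvg_cst. Qed.
Lemma contD f g : {for x, continuous f} -> {for x, continuous g} ->
  {for x, continuous (fun y => f y + g y)}.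
Proof. by move=> c1 c2; apply: continuousD; [exact: c1|exact: c2]. Qed.
Lemma contN f : {for x, continuous f} -> {for x, continuous (fun y => - f y)}.
Proof. by move=> c1; apply: continuousN; exact: c1. Qed.
Lemma contM f g : {for x, continuous f} -> {for x, continuous g} ->
  {for x, continuous (fun y => f y * g y)}.
Proof. by move=> c1 c2; apply: continuousM; [exact: c1|exact: c2]. Qed.
Lemma contX f n : {for x, continuous f} -> {for x, continuous (fun y => f y ^+ n)}.
Proof.
move=> c1; elim: n => [|n IH]; first exact: cont_cst.
rewrite (_ : (fun y => _) = (fun y => f y * f y ^+ n)); first exact: contM.
by apply/funext => y; rewrite exprS.
Qed.
Lemma contV f : f x != 0 -> {for x, continuous f} -> {for x, continuous (fun y => (f y)^-1)}.
Proof. by move=> f0 c1; apply: continuousV. Qed.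
Lemma cont_comp f (h : R -> R) : {for x, continuous f} -> continuous h ->
  {for x, continuous (fun y => h (f y))}.
Proof. by move=> c1 c2; apply: (@continuous_comp _ _ _ f h) => //; exact: c2. Qed.
Lemma cont_eq f g : f =1 g -> {for x, continuous g} -> {for x, continuous f}.
Proof. by move=> /funext ->. Qed.
End ContinuityAt.

(** Pointwise, because the closed forms divide by [kap l]; this suffices for the compactness of
    images of boxes of good covectors. *)
Lemma gexp_continuous_at t l : 0 < kap l -> {for l, continuous (fun l => gexp l t)}.
Proof.
move=> k0; have kn : kap l != 0 by rewrite gt_eqF.
have cc i : {for l, continuous (fun l : E => l 0 i)} by exact: coord_continuous.
have ck : {for l, continuous (fun l : E => kap l)}.
  apply: (cont_comp (h := Num.sqrt)); last exact: sqrt_continuous.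
  by apply: contD; apply: contX.
have ct : {for l, continuous (fun l : E => th l)} by apply: contD; exact: contM.
have ckt : {for l, continuous (fun l : E => kap l * t)} by apply: contM => //; exact: cont_cst.
have cs : {for l, continuous (fun l : E => sin (kap l * t))} by apply: cont_comp => //; exact: continuous_sin.
have co : {for l, continuous (fun l : E => cos (kap l * t))} by apply: cont_comp => //; exact: continuous_cos.
have cV : {for l, continuous (fun l : E => (kap l)^-1)} by exact: contV.
have cV2 : {for l, continuous (fun l : E => (kap l ^+ 2)^-1)}.
  by apply: contV; [rewrite expf_neq0|exact: contX].
have c2V : {for l, continuous (fun l : E => (2 * kap l)^-1)}.
  by apply: contV; [rewrite mulf_neq0|apply: contM => //; exact: cont_cst].
have u0 := cc i0.
have k1 c : {for l, continuous (fun _ : E => c : R)} by exact: cont_cst.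
have cA : {for l, continuous (fun l : E => gA l t)} :=
  contD (contM u0 (contM cs cV)) (contM ct (contM (contD co (k1 _)) cV2)).
have cM : {for l, continuous (fun l : E => gM l t)} :=
  contD (contM u0 (contM (contD (k1 _) (contN co)) cV2))
    (contM ct (contM (contD (contM cs cV) (k1 _)) cV2)).
have cP := contM u0 cV; have cQ := contM ct cV2.
have csc := contM (contM cs co) c2V.
have cS : {for l, continuous (fun l : E => gS l t)} :=
  contD (contD (contM (contX (n := 2) cP) (contD (k1 _) (contN csc)))
   (contM (contX (n := 2) cQ) (contD (contD (k1 _) csc) (contN (contM (contM (k1 _) cs) cV)))))
   (contM (contM (contM (k1 _) cP) cQ) (contD (contM (contX (n := 2) cs) c2V) (contM (contD co (k1 _)) cV))).
have b1 := cc i1; have b2 := cc i2; have b3 := cc i3; have b4 := cc i4.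
apply: row5_continuous_at; apply: forall_ord5.
- by apply: (cont_eq _ cA) => y; rewrite ptE.
- by apply: (cont_eq _ (contD (contM (k1 t) b1) (contM cM b3))) => y; rewrite ptE.
- by apply: (cont_eq _ (contD (contM (k1 t) b2) (contM cM b4))) => y; rewrite ptE.
- by apply: (cont_eq _ (contD (contM cM b1) (contM cS b3))) => y; rewrite ptE.
- by apply: (cont_eq _ (contD (contM cM b2) (contM cS b4))) => y; rewrite ptE.
Qed.

End Interp.

(** * Haar measure *)

Section Preserving.
Context {R : realType}.
Local Notation TR := (measurableTypeR R).

Implicit Types (lo hi : 'I_5 -> R).

Definition lam : {sigma_finite_measure set TR -> \bar R} := @lebesgue_measure R.

Definition preserves d (T : measurableType d) (m : {measure set T -> \bar R})
    (S : T -> T) : Prop :=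
  measurable_fun setT S /\ forall A, measurable A -> m (S @^-1` A) = m A.

Lemma measurable_addr (c : R) : measurable_fun setT (fun y : TR => y + c : TR).
Proof. by apply: measurable_funD => //; exact: measurable_cst. Qed.

Lemma preserves_addr (c : R) : preserves lam (fun y : TR => y + c : TR).
Proof.
split; first exact: measurable_addr.
move=> A mA; apply/esym.
pose mu := measure_function_pushforward__canonical__measure_function_Measure lam (measurable_addr c).
apply: (@lebesgue_measure_unique R mu) => // X [[a b] /= ab <-]; rewrite /mu /= /pushforward.
rewrite (_ : _ @^-1` _ = `]a - c, b - c]%classic); last first.
  apply/seteqP; split=> y /=; rewrite !in_itv/= => /andP[h1 h2]; apply/andP; split; lra.
rewrite /lam /= !lebesgue_measure_itv /= !lte_fin ltrD2r; case: ifP => // _.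
by rewrite -!EFinB; congr (_%:E); ring.
Qed.

(* Left translations are iterated shears of this form. *)
Lemma preserves_shear d (T : measurableType d) (m : {measure set T -> \bar R})
    (S : T -> T) (f : T -> TR) : preserves m S -> measurable_fun setT f ->
  preserves (m \x lam)%E (fun z : T * TR => (S z.1, z.2 + f z.1 : TR)).
Proof.
move=> [mS pS] mf; split.
  apply: measurable_fun_pair.
    exact: measurableT_comp.
  apply: measurable_funD; first exact: measurable_snd.
  by apply: measurableT_comp.
move=> A mA; rewrite /= /product_measure1.
transitivity (\int[m]_x ((lam \o xsection A) (S x)))%E.
  apply: eq_integral => x _ /=.
  have [_ /(_ _ (measurable_xsection (S x) mA)) <-] := preserves_addr (f x).
  by congr (lam _); apply/seteqP; split=> y; rewrite /xsection /= !in_setE.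
have mx := measurable_fun_xsection lam mA.
have := @ge0_integral_pushforward _ _ _ _ _ S mS m setT _ measurableT mx.
rewrite preimage_setT => <-; last by move=> y _; exact: measure_ge0.
by apply: eq_measure_integral => B mB _ /=; exact: pS.
Qed.

Definition P5 := (TR * TR * TR * TR * TR)%type.
Definition mu5 := ((((lam \x lam) \x lam) \x lam) \x lam)%E.

(** Invariance is proved on the iterated product, where shears can be handled one coordinate at a
    time, and is carried by [toE] to row vectors with their Borel sets. *)
Definition toE (z : P5) : borel R 5 :=
  pt z.1.1.1.1 z.1.1.1.2 z.1.1.2 z.1.2 z.2.

Definition box5 (J : 'I_5 -> interval R) : set 'rV[R]_5 := [set x | forall i, x 0 i \in J i].

Lemma toE_box5 J : toE @^-1` box5 J =
  ([set` J i0] `*` [set` J i1] `*` [set` J i2] `*` [set` J i3] `*` [set` J i4])%classic.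
Proof.
apply/seteqP; split=> z /=.
  move=> h; have := (h i0, h i1, h i2, h i3, h i4); rewrite !ptE.
  by case=> [[[[? ?] ?] ?] ?].
case=> [[[[h0 h1] h2] h3] h4].
by apply: forall_ord5; rewrite ptE.
Qed.

Lemma measurable_toE_box5 J : measurable (toE @^-1` box5 J : set P5).
Proof.
rewrite toE_box5; do 4! (apply: measurableX; last exact: measurable_itv); exact: measurable_itv.
Qed.

Lemma mu5_box5 J : mu5 (toE @^-1` box5 J) =
  (lebesgue_measure [set` J i0] * lebesgue_measure [set` J i1] * lebesgue_measure [set` J i2]
   * lebesgue_measure [set` J i3] * lebesgue_measure [set` J i4])%E.
Proof.
rewrite toE_box5 /mu5.
have mi i : measurable ([set` J i] : set TR) by exact: measurable_itv.
have m2 := measurableX (mi i0) (mi i1).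
have m3 := measurableX m2 (mi i2).
have m4 := measurableX m3 (mi i3).
etransitivity; first exact: (product_measure1E _ lam m4 (mi i4)).
congr (_ * _)%E; etransitivity; first exact: (product_measure1E _ lam m3 (mi i3)).
congr (_ * _)%E; etransitivity; first exact: (product_measure1E _ lam m2 (mi i2)).
by congr (_ * _)%E; exact: (product_measure1E _ lam (mi i0) (mi i1)).
Qed.

(** Boxes with rational ends are countably many. This links the Borel sets, generated by open sets,
    to the product sigma-algebra, which contains the boxes. *)
Lemma open_bigcup_box5 (U : set 'rV[R]_5) : open U -> exists F : nat -> ('I_5 -> interval R),
  U = \bigcup_n box5 (F n).
Proof.
move=> oU.
pose B (q : {ffun 'I_5 -> rat * rat}) i := `]ratr (q i).1, ratr (q i).2[ : interval R.
(* Integers that do not encode a rational box inside [U] are sent to an empty box. *)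
pose F n := if unpickle n is Some q then
   if `[< box5 (B q) `<=` U >] then B q else fun=> `]0, 0[ else fun=> `]0, 0[.
exists F; apply/seteqP; split=> x.
  move=> Ux; have /nbhs_ballP[e /= e0 be] := open_nbhs_nbhs (conj oU Ux).
  have h i : exists q : rat * rat, x 0 i \in (`]ratr q.1, ratr q.2[ : interval R) /\
     (forall y : R, y \in (`]ratr q.1, ratr q.2[ : interval R) -> ball (x 0 i) e y).
    have l1 : x 0 i - e < x 0 i by lra.
    have l2 : x 0 i < x 0 i + e by lra.
    have [q1] := rat_in_itvoo l1; have [q2] := rat_in_itvoo l2.
    rewrite !in_itv /= => /andP[a1 a2] /andP[a3 a4]; exists (q1, q2).
    split; first by rewrite in_itv /= a4.
    move=> y; rewrite in_itv/= => /andP[b1 b2].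
    by rewrite /ball /= ltr_norml; apply/andP; split; lra.
  have [q hq] := choice h.
  exists (pickle [ffun i => q i]) => //.
  rewrite /F pickleK ifT.
    by move=> i; rewrite /B ffunE; have [] := hq i.
  apply/asboolP => y yB; apply: be; split => // i j.
  rewrite !ord1; have := yB j; rewrite /B ffunE; exact: (hq j).2.
case=> n _; rewrite /F; case: unpickle => [q|]; last first.
  by move=> /(_ i0); rewrite in_itv /= => /andP[h /(lt_trans h)]; rewrite ltxx.
case: asboolP => [h|_]; first exact: h.
by move=> /(_ i0); rewrite in_itv /= => /andP[h /(lt_trans h)]; rewrite ltxx.
Qed.

Lemma measurable_toE : measurable_fun setT toE.
Proof.
apply: (@measurability _ _ _ (borel R 5) setT toE (@open 'rV[R]_5) erefl).
move=> _ [U oU <-]; rewrite setTI; have [F ->] := open_bigcup_box5 oU.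
rewrite preimage_bigcup; apply: bigcupT_measurable => n; exact: measurable_toE_box5.
Qed.

Lemma open_borel (U : set 'rV[R]_5) : open U -> measurable (U : set (borel R 5)).
Proof. by move=> oU; apply: sub_sigma_algebra. Qed.

Lemma closed_borel (U : set 'rV[R]_5) : closed U -> measurable (U : set (borel R 5)).
Proof.
by move=> cU; rewrite -[U]setCK; apply: measurableC; apply: open_borel; exact: closed_openC.
Qed.

Definition gvol : {measure set (borel R 5) -> \bar R} :=
  measure_function_pushforward__canonical__measure_function_Measure mu5 measurable_toE.

Lemma gvol_box5 J : gvol (box5 J) =
  (lebesgue_measure [set` J i0] * lebesgue_measure [set` J i1] * lebesgue_measure [set` J i2]
   * lebesgue_measure [set` J i3] * lebesgue_measure [set` J i4])%E.
Proof. exact: mu5_box5. Qed.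

Definition bvol (lo hi : 'I_5 -> R) : R := \prod_(i < 5) (hi i - lo i).

Lemma bvolE lo hi : bvol lo hi = (hi i0 - lo i0) * (hi i1 - lo i1) * (hi i2 - lo i2)
   * (hi i3 - lo i3) * (hi i4 - lo i4).
Proof.
rewrite /bvol !big_ord_recr big_ord0 /= mul1r.
by do !congr (_ * _); congr (hi _ - lo _); exact: val_inj.
Qed.

Lemma gvol_box_bvol (l r : bool) lo hi : (forall i, lo i < hi i) ->
  gvol (box5 (fun i => Interval (BSide l (lo i)) (BSide r (hi i)))) = (bvol lo hi)%:E.
Proof.
move=> lh; rewrite gvol_box5 !lebesgue_measure_itv /= !lte_fin !lh.
by rewrite -!EFinB -!EFinM bvolE.
Qed.

Lemma box_box5 lo hi : box lo hi = box5 (fun i => `[lo i, hi i]).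
Proof. by apply/seteqP; split=> x h i; have := h i; rewrite in_itv. Qed.

Definition obox (lo hi : 'I_5 -> R) : set 'rV[R]_5 := [set l | forall i, lo i < l 0 i < hi i].

Lemma obox_box5 lo hi : obox lo hi = box5 (fun i => `]lo i, hi i[).
Proof. by apply/seteqP; split=> x h i; have := h i; rewrite in_itv. Qed.

Lemma gvol_box lo hi : (forall i, lo i < hi i) -> gvol (box lo hi) = (bvol lo hi)%:E.
Proof. by rewrite box_box5; exact: gvol_box_bvol. Qed.

Lemma gvol_obox lo hi : (forall i, lo i < hi i) -> gvol (obox lo hi) = (bvol lo hi)%:E.
Proof. by rewrite obox_box5; exact: gvol_box_bvol. Qed.

Lemma compact_box lo hi : compact (box lo hi).
Proof.
rewrite box_box5; apply: (@rV_compact _ _ (fun i => [set` `[lo i, hi i]])) => i.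
exact: segment_compact.
Qed.

Lemma compact_borel (K : set 'rV[R]_5) : compact K -> measurable (K : set (borel R 5)).
Proof. by move=> cK; apply: closed_borel; apply: compact_closed => //; exact: norm_hausdorff. Qed.

Lemma box_borel lo hi : measurable (box lo hi : set (borel R 5)).
Proof. by apply: compact_borel; exact: compact_box. Qed.

Lemma obox_open lo hi : open (obox lo hi).
Proof.
pose c i := (fun l : 'rV[R]_5 => l 0 i) @^-1` `]lo i, hi i[%classic.
have oc i : open (c i).
  by apply: open_comp; [move=> x _; exact: coord_continuous|exact: itv_open].
rewrite (_ : obox lo hi = c i0 `&` c i1 `&` c i2 `&` c i3 `&` c i4).
  by do 4! apply: openI => //.
apply/seteqP; split=> x h; first by do !split; rewrite /c /= in_itv; exact: h.
by move: h; rewrite /c /= !in_itv/= => -[[[[? ?] ?] ?] ?]; exact: forall_ord5.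
Qed.

Lemma compact_sub_box (K : set 'rV[R]_5) : compact K ->
  exists2 M, 0 < M & K `<=` box (fun=> - M) (fun=> M).
Proof.
move=> cK.
have h i : exists M, forall x, K x -> `|x 0 i| <= M.
  have cf : {within K, continuous (fun l : 'rV[R]_5 => l 0 i)}.
    by apply: continuous_subspaceT => x; exact: coord_continuous.
  have /compact_bounded[M [_ mrt]] := continuous_compact cf cK.
  exists (M + 1) => x Kx; apply: (mrt (M + 1)); first by rewrite ltrDl.
  by exists x.
have [M hM] := choice h; pose N := \big[Num.max/1]_i M i.
have N1 : 1 <= N by apply: bigmax_ge_id.
exists N; first by lra.
move=> x Kx i; rewrite -ler_norml (le_trans (hM i x Kx))//.
exact: le_bigmax.
Qed.

Lemma gvol_compact (K : set 'rV[R]_5) : compact K -> (gvol K < +oo)%E.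
Proof.
move=> cK; have [M M0 KM] := compact_sub_box cK.
apply: (@le_lt_trans _ _ (gvol (box (fun=> - M) (fun=> M)))).
  by apply: le_measure => //; rewrite inE; [exact: compact_borel|exact: box_borel].
by rewrite gvol_box ?ltry// => _; lra.
Qed.

Lemma gmul_pt (p : 'rV[R]_5) (a b1 b2 c1 c2 : R) : gmul p (pt a b1 b2 c1 c2) =
  pt (a + p 0 i0) (b1 + p 0 i1) (b2 + p 0 i2) (c1 + (b1 * p 0 i0 + p 0 i3))
     (c2 + (b2 * p 0 i0 + p 0 i4)).
Proof. by rewrite gmulE !ptE; congr pt; ring. Qed.

Lemma preserves_gmul p : exists2 T : P5 -> P5, preserves mu5 T & forall z, toE (T z) = gmul p (toE z).
Proof.
have s0 := preserves_addr (p 0 i0).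
have s1 := preserves_shear s0 (measurable_cst (p 0 i1)).
have s2 := preserves_shear s1 (measurable_cst (p 0 i2)).
have s3 := preserves_shear (f := fun z : TR * TR * TR => z.1.2 * p 0 i0 + p 0 i3) s2.
have {}s3 := s3 _.
have m3 : measurable_fun setT (fun z : TR * TR * TR => z.1.2 * p 0 i0 + p 0 i3 : TR).
  apply: measurable_funD; last exact: measurable_cst.
  apply: measurable_funM; last exact: measurable_cst.
  by apply: measurableT_comp; [exact: measurable_snd|exact: measurable_fst].
have m4 : measurable_fun setT (fun z : TR * TR * TR * TR => z.1.2 * p 0 i0 + p 0 i4 : TR).
  apply: measurable_funD; last exact: measurable_cst.
  apply: measurable_funM; last exact: measurable_cst.
  by apply: measurableT_comp; [exact: measurable_snd|exact: measurable_fst].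
have s4 := preserves_shear (s3 m3) m4.
exists (fun z => (z.1.1.1.1 + p 0 i0, z.1.1.1.2 + p 0 i1, z.1.1.2 + p 0 i2,
   z.1.2 + (z.1.1.1.2 * p 0 i0 + p 0 i3), z.2 + (z.1.1.2 * p 0 i0 + p 0 i4))).
  exact: s4.
by move=> z; rewrite gmul_pt.
Qed.

Lemma gvol_is_haar : is_haar (@gGroup R) gvol.
Proof.
split.
- move=> p A mA.
  have -> : lgmul (@gGroup R) p @` A = gmul (ginv p) @^-1` A.
    have gVK x : gmul (ginv p) (gmul p x) = x by rewrite gmulA gmulV gmul0.
    have gKV x : gmul p (gmul (ginv p) x) = x.
      have e : gmul p (ginv p) = 0 by rewrite gmulE ginvE; apply: eq_row5; rewrite !ptE !mxE; ring.
      by rewrite gmulA e gmul0.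
    apply/seteqP; split=> [_ [x Ax <-]|x /= Ax]; first by rewrite /= gVK.
    by exists (gmul (ginv p) x) => //; exact: gKV.
  have [T [mT pT] hT] := preserves_gmul (ginv p).
  have mB : measurable (toE @^-1` A) by rewrite -[X in measurable X]setTI; exact: measurable_toE.
  rewrite -[RHS](pT _ mB); congr (mu5 _).
  by apply/seteqP; split=> z; rewrite /= hT.
- exact: gvol_compact.
- apply: (@lt_le_trans _ _ (gvol (box (fun=> 0) (fun=> 1)))); last first.
    by apply: le_measure => //; rewrite inE//; exact: box_borel.
  by rewrite gvol_box// lte_fin bvolE !subr0 !mulr1.
Qed.

End Preserving.

(** * Packing *)

Section Packing.
Context {R : realType}.
Local Notation E := 'rV[R]_5.
Implicit Types (w : 'I_5 -> R) (r : R) (x y : E) (S : set E).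

(** The weights [w] allow anisotropic cubes, adapted either to the dilations or to the degenerate
    interpolating sets. *)
Definition ocube w r x : set E := obox (fun i => x 0 i - r * w i) (fun i => x 0 i + r * w i).
Definition ccube w r x : set E := box (fun i => x 0 i - r * w i) (fun i => x 0 i + r * w i).

Lemma bvol_cube w r (x : E) :
  bvol (fun i => x 0 i - r * w i) (fun i => x 0 i + r * w i) = (2 * r) ^+ 5 * \prod_i w i.
Proof.
rewrite /bvol (eq_bigr (fun i => 2 * r * w i)); last by move=> i _; ring.
by rewrite big_split /= prodr_const card_ord.
Qed.

Lemma gvol_ocube w r x : 0 < r -> (forall i, 0 < w i) ->
  gvol (ocube w r x) = ((2 * r) ^+ 5 * \prod_i w i)%:E.
Proof.
move=> r0 w0; rewrite /ocube gvol_obox ?bvol_cube// => i.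
by have := mulr_gt0 r0 (w0 i); lra.
Qed.

Lemma gvol_ccube w r x : 0 < r -> (forall i, 0 < w i) ->
  gvol (ccube w r x) = ((2 * r) ^+ 5 * \prod_i w i)%:E.
Proof.
move=> r0 w0; rewrite /ccube gvol_box ?bvol_cube// => i.
by have := mulr_gt0 r0 (w0 i); lra.
Qed.

Lemma ocubeP w r x y : ocube w r x y <-> forall i, `|y 0 i - x 0 i| < r * w i.
Proof.
split=> h i; have := h i; rewrite ltr_distl => // /andP[h1 h2]; apply/andP; split; lra.
Qed.

Lemma ccubeP w r x y : ccube w r x y <-> forall i, `|y 0 i - x 0 i| <= r * w i.
Proof.
split=> h i; have := h i; rewrite ler_distl => // /andP[h1 h2]; apply/andP; split; lra.
Qed.

Definition thick w r S : set E := \bigcup_(x in S) ocube w r x.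

Lemma thick_open w r S : open (thick w r S).
Proof. by apply: bigcup_open => x _; exact: obox_open. Qed.

Lemma thick_borel w r S : measurable (thick w r S : set (borel R 5)).
Proof. by apply: open_borel; exact: thick_open. Qed.

Lemma gvol_thick_fin w r S : compact S -> (gvol (thick w r S) < +oo)%E.
Proof.
move=> cS; have [M M0 SM] := compact_sub_box cS.
have [N hN] : exists N, forall i, r * w i < N.
  exists (1 + \sum_i `|r * w i|) => i; rewrite (bigD1 i)//= (le_lt_trans (ler_norm _))//.
  have : 0 <= \sum_(j < 5 | j != i) `|r * w j| by apply: sumr_ge0.
  lra.
apply: (@le_lt_trans _ _ (gvol (box (fun=> - M - `|N| - 1) (fun=> M + `|N| + 1)))); last first.
  by rewrite gvol_box ?ltry// => _; have := normr_ge0 N; lra.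
apply: le_measure; rewrite ?inE; [exact: thick_borel|exact: box_borel|].
move=> y [x Sx yx] i; have := yx i; have := hN i; have := SM x Sx i; have := ler_norm N.
by move=> h1 /andP[h2 h3] h4 /andP[h5 h6]; apply/andP; split; lra.
Qed.

Lemma compact_thick w S : (forall i, 0 < w i) -> compact S ->
  \bigcap_n thick w n.+1%:R^-1 S = S.
Proof.
move=> w0 cS; apply/seteqP; split=> y; last first.
  move=> Sy n _; exists y => //; apply/ocubeP => i.
  by rewrite subrr normr0 mulr_gt0// invr_gt0.
move=> h; have clS : closed S by apply: compact_closed => //; exact: norm_hausdorff.
apply: clS => B /nbhs_ballP[e /= e0 eB].
have [W hW] : exists W, forall i, w i < W.
  exists (1 + \sum_i `|w i|) => i; rewrite (bigD1 i)//= (le_lt_trans (ler_norm _))//.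
  have : 0 <= \sum_(j < 5 | j != i) `|w j| by apply: sumr_ge0.
  lra.
have W0 : 0 < W by apply: lt_trans (hW i0).
pose n := Num.truncn (W / e).
have hn : W / e < n.+1%:R by exact: truncnS_gt.
have [x Sx /ocubeP yx] := h n I.
exists x; split => //; apply: eB; split => // i j; rewrite !ord1 /ball /=.
apply: (lt_trans (yx j)); rewrite mulrC ltr_pdivrMr//.
by apply: (lt_trans (hW j)); rewrite mulrC -ltr_pdivrMr.
Qed.

(** Cubes of radius [r / 2] about the points are disjoint and have edges [r * w i]. They may leave
    [S], so the bound is on its thickening. *)
Lemma separated_card w r S (f : nat -> E) n : 0 < r -> (forall i, 0 < w i) ->
  (forall a, (a < n)%N -> S (f a)) ->
  (forall a b, (a < b < n)%N -> exists j, r * w j < `|f a 0 j - f b 0 j|) ->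
  ((n%:R * (r ^+ 5 * \prod_i w i))%:E <= gvol (thick w r S))%E.
Proof.
move=> r0 w0 fS fsep.
pose Q k : set (borel R 5) := if (k < n)%N then ocube w (r / 2) (f k) else set0.
have mQ k : measurable (Q k).
  by rewrite /Q; case: ifP => // _; apply: open_borel; exact: obox_open.
have tQ : trivIset setT Q.
  apply/trivIsetP => a b _ _; wlog ab : a b / (a < b)%N.
    move=> hw; case: ltngtP => // ab _; first by apply: hw => //; rewrite ltn_eqF.
    by rewrite setIC; apply: hw => //; rewrite ltn_eqF.
  move=> _; apply/seteqP; split => // y [].
  rewrite /Q; case: (ltnP b n) => // bn; rewrite (ltn_trans ab bn).
  move=> /ocubeP ya /ocubeP yb.
  have abn : (a < b < n)%N by rewrite ab.
  have [j] := fsep a b abn.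
  rewrite ltNge => /negP; apply.
  rewrite (_ : f a 0 j - f b 0 j = (y 0 j - f b 0 j) - (y 0 j - f a 0 j)); last by ring.
  by rewrite (le_trans (ler_normB _ _))//; have := ya j; have := yb j; lra.
have /(_ n) Qadd := @measure_bigsetU _ _ _ gvol Q mQ tQ.
apply: (@le_trans _ _ (gvol (\big[setU/set0]_(i < n) Q i))).
  rewrite Qadd (eq_bigr (fun=> (r ^+ 5 * \prod_i w i)%:E)); last first.
    move=> k _; rewrite /Q ltn_ord; have r20 : 0 < r / 2 by lra.
    etransitivity; first exact: gvol_ocube r20 w0.
    by congr (_ ^+ _ * _)%:E; field.
  by rewrite sumEFin lee_fin sumr_const card_ord mulr_natl.
apply: le_measure; rewrite ?inE.
- by apply: bigsetU_measurable => i _; exact: mQ.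
- exact: thick_borel.
- rewrite -bigcup_mkord => y [k kn]; rewrite /Q kn => /ocubeP yk.
  exists (f k); first exact: fS.
  by apply/ocubeP => i; apply: (lt_trans (yk i)); rewrite ltr_pM2r//; lra.
Qed.

Lemma gvol_cover_le (A : set (borel R 5)) (Q : nat -> set (borel R 5)) n v :
  measurable A -> (forall k, measurable (Q k)) ->
  (forall k, (k < n)%N -> (gvol (Q k) <= v%:E)%E) ->
  (forall x, A x -> exists2 k, (k < n)%N & Q k x) -> (gvol A <= (n%:R * v)%:E)%E.
Proof.
move=> mA mQ vQ AQ.
apply: (@le_trans _ _ (gvol (\big[setU/set0]_(i < n) Q i))).
  apply: le_measure; rewrite ?inE//; first by apply: bigsetU_measurable => i _; exact: mQ.
  by rewrite -bigcup_mkord => x /AQ[k kn Qx]; exists k.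
apply: (le_trans (@Boole_inequality _ _ _ gvol Q n (fun i _ => mQ i))).
apply: (@le_trans _ _ (\sum_(i < n) v%:E)%E).
  by apply: lee_sum => i _; exact: vQ.
by rewrite sumEFin lee_fin sumr_const card_ord mulr_natl.
Qed.

(* The covectors of a maximal family whose images are [r]-separated have disjoint
   cubes of size [r] around their images, while cubes of size [K r] around them
   cover the box. *)
Lemma packing lo hi (F : E -> E) w K : (forall i, lo i < hi i) -> (forall i, 0 < w i) -> 0 < K ->
  compact (F @` box lo hi) ->
  (forall l l' m, box lo hi l -> box lo hi l' ->
     (forall j, `|F l 0 j - F l' 0 j| <= m * w j) -> forall i, `|l 0 i - l' 0 i| <= K * m) ->
  ((bvol lo hi * (\prod_i w i) / (2 * K) ^+ 5)%:E <= gvol (F @` box lo hi))%E.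
Proof.
move=> lh w0 K0 cF FK; set S := F @` _.
have w10 : 0 < \prod_i w i by apply: prodr_gt0.
have main r : 0 < r -> ((bvol lo hi * (\prod_i w i) / (2 * K) ^+ 5)%:E <= gvol (thick w r S))%E.
  move=> r0.
  pose P n := `[< exists f : nat -> E, (forall a, (a < n)%N -> box lo hi (f a)) /\
    forall a b, (a < b < n)%N -> exists j, r * w j < `|F (f a) 0 j - F (f b) 0 j| >].
  have P0 : exists n, P n by exists 0%N; apply/asboolP; exists (fun=> 0); split => // a b; rewrite ltn0 andbF.
  have r5 : 0 < r ^+ 5 * \prod_i w i by rewrite mulr_gt0// exprn_gt0.
  have cnt n (f : nat -> E) : (forall a, (a < n)%N -> box lo hi (f a)) ->
     (forall a b, (a < b < n)%N -> exists j, r * w j < `|F (f a) 0 j - F (f b) 0 j|) ->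
     ((n%:R * (r ^+ 5 * \prod_i w i))%:E <= gvol (thick w r S))%E.
    move=> fb fs; apply: (separated_card (f := F \o f)) => // a an.
    by exists (f a) => //; exact: fb.
  have tf := gvol_thick_fin w r cF.
  have tE : gvol (thick w r S) = (fine (gvol (thick w r S)))%:E.
    by rewrite fineK// ge0_fin_numE// measure_ge0.
  set V := fine _ in tE.
  (* The finite volume of the thickening bounds the size of separated families, so a largest one
     exists. *)
  have Pb n : P n -> (n <= Num.truncn (V / (r ^+ 5 * \prod_i w i)))%N.
    move=> /asboolP[f [fb fs]]; have := cnt n f fb fs; rewrite tE lee_fin.
    rewrite -ler_pdivlMr// => h; rewrite -ltnS -(ltr_nat R) (le_lt_trans h)//.
    exact: truncnS_gt.
  case: (ex_maxnP P0 Pb) => n /asboolP[f [fb fs]] nmax.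
  apply: le_trans (cnt n f fb fs); rewrite lee_fin.
  have Kr : 0 < K * r by rewrite mulr_gt0.
  have : (gvol (box lo hi) <= (n%:R * ((2 * (K * r)) ^+ 5))%:E)%E.
    apply: (@gvol_cover_le _ (fun k => ccube (fun=> 1) (K * r) (f k))).
    - exact: box_borel.
    - by move=> k; exact: box_borel.
    - by move=> k _; rewrite gvol_ccube// big1 ?mulr1.
    - move=> l bl; apply: contrapT => hl.
      (* A covector missed by all cubes has, by [FK], an image separated from all the others, and
         could be added to the family. *)
      have : P n.+1.
        apply/asboolP; exists (fun k => if (k < n)%N then f k else l); split=> [a _|a b].
          by case: ifP => [an|_] //; exact: fb.
        rewrite ltnS => /andP[ab bn]; rewrite (leq_trans ab bn).
        case: ltnP => [bn'|_]; first by apply: fs; rewrite ab.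
        apply: contrapT => hj; apply: hl; exists a; first exact: leq_trans ab bn.
        apply/ccubeP => i; rewrite mulr1; apply: FK => //; first exact: (fb _ (leq_trans ab bn)).
        move=> j; rewrite distrC leNgt; apply/negP => hh; apply: hj; by exists j.
      by move=> /nmax; rewrite ltnn.
  rewrite gvol_box// lee_fin => h.
  have K5 : 0 < (2 * K) ^+ 5 by rewrite exprn_gt0// mulr_gt0.
  rewrite ler_pdivrMr// (le_trans (ler_wpM2r (ltW w10) h))//.
  by rewrite mulrA exprMn [X in X <= _](_ : _ = n%:R * (r ^+ 5 * \prod_i w i) * (2 * K) ^+ 5) // !exprMn; ring.
(* The bound no longer involves [r], so [r] can tend to 0: thickenings of finite volume decrease to
   the compact image. *)
have cv := @nonincreasing_cvg_mu _ _ _ gvol (fun n => thick w n.+1%:R^-1 S).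
have nneg (n : nat) : 0 < n.+1%:R^-1 :> R by rewrite invr_gt0.
have mS : measurable (S : set (borel R 5)) by exact: compact_borel.
have : (gvol \o (fun n => thick w n.+1%:R^-1 S)) x @[x --> \oo] --> gvol (\bigcap_n thick w n.+1%:R^-1 S).
  apply: cv.
  - exact: gvol_thick_fin.
  - by move=> i; exact: thick_borel.
  - by rewrite compact_thick.
  - move=> n m nm; apply/subsetPset => y [x Sx /ocubeP yx]; exists x => //; apply/ocubeP => i.
    apply: (lt_le_trans (yx i)); rewrite ler_pM2r// lef_pV2 ?posrE//.
    by rewrite ler_nat.
rewrite compact_thick// => cvS.
have := cvg_lim (@ereal_hausdorff R) cvS => <-.
apply: lime_ge; first by apply/cvg_ex; eexists; exact: cvS.
by apply: nearW => n; exact: main.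
Qed.

End Packing.

(** * The two exponents *)

Section GeodesicDimension.
Context {R : realType}.
Local Notation E := 'rV[R]_5.
Implicit Types (lo hi : 'I_5 -> R) (l x : E) (t h : R).

Definition dil t x : E :=
  pt (t * x 0 i0) (t * x 0 i1) (t * x 0 i2) (t ^+ 2 * x 0 i3) (t ^+ 2 * x 0 i4).

Definition dilw t (i : 'I_5) : R := nth 0 [:: t; t; t; t ^+ 2; t ^+ 2] i.

Lemma dilE t x i : dil t x 0 i = dilw t i * x 0 i.
Proof. by move: i; apply: forall_ord5; rewrite /dil ptE. Qed.

Lemma dil1 x : dil 1 x = x.
Proof. by apply: eq_row5; rewrite dilE /dilw/= ?expr1n mul1r. Qed.

Lemma dilw_gt0 t i : 0 < t -> 0 < dilw t i.
Proof. by move=> t0; move: i; apply: forall_ord5; rewrite /dilw /= ?exprn_gt0. Qed.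

Lemma prod_dilw t : \prod_i dilw t i = t ^+ 7.
Proof. by rewrite !big_ord_recr big_ord0 /dilw /=; ring. Qed.

Lemma gexp_image_compact lo hi t : (forall l, box lo hi l -> 0 < kap l) ->
  compact ((fun l => dil t (gexp l 1)) @` box lo hi).
Proof.
move=> k0; apply: continuous_compact; last exact: compact_box.
apply: continuous_in_subspaceT => l; rewrite inE => /k0 kl.
have cg := gexp_continuous_at (t := 1) kl.
apply: row5_continuous_at => i.
apply: (cont_eq (g := fun y => dilw t i * gexp y 1 0 i)); first by move=> y; rewrite dilE.
apply: contM; first exact: cont_cst.
exact: (continuous_comp cg (@coord_continuous _ _ _ 0 i _)).
Qed.

(** Packing with weights [dilw t], for which the dilated map has the same expansion constant as
    [gexp]. Hence [c] depends on [h] only, and the product [t ^+ 7] of the weights is the whole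
    effect of the dilation. *)
Lemma gexp_image_lower h : 0 < h -> exists2 c, 0 < c & forall lo hi t, (forall i, lo i < hi i) ->
  0 < t -> (forall l, box lo hi l -> good h l) ->
  ((bvol lo hi * t ^+ 7 * c)%:E <= gvol ((fun l => dil t (gexp l 1)) @` box lo hi))%E.
Proof.
move=> h0; have [K [K0 hK]] := gexp_expansive h0.
exists ((2 * K) ^+ 5)^-1; first by rewrite invr_gt0 exprn_gt0// mulr_gt0.
move=> lo hi t lh t0 gb; rewrite -prod_dilw; apply: packing => //.
- by move=> i; exact: dilw_gt0.
- by apply: gexp_image_compact => l /gb[].
move=> l l' m bl bl' hm i; apply: hK; [exact: gb|exact: gb|move=> j].
have := hm j; rewrite !dilE -mulrBr normrM gtr0_norm ?dilw_gt0// [m * _]mulrC.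
by rewrite ler_pM2l// dilw_gt0.
Qed.

Lemma bvol_gt0 lo hi : (forall i, lo i < hi i) -> 0 < bvol lo hi.
Proof. by move=> lh; apply: prodr_gt0 => i _; rewrite subr_gt0. Qed.

Lemma gexp_image_test lo hi h : 0 < h -> (forall i, lo i < hi i) ->
  (forall l, box lo hi l -> good h l) ->
  test_sets (@gCarnot R) gvol ((fun l => gexp l 1) @` box lo hi).
Proof.
move=> h0 lh gb; have [c c0 hc] := gexp_image_lower h0.
have := hc lo hi 1 lh ltr01 gb.
have : compact ((fun l => dil 1 (gexp l 1)) @` box lo hi).
  by apply: gexp_image_compact => l /gb[].
rewrite (_ : (fun l => dil 1 (gexp l 1)) = fun l => gexp l 1); last first.
  by apply/funext => l; rewrite dil1.
move=> cE vE; split.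
- exists 4 => _ [l /gb[k0 k1 l2 _] <-].
  have k01 : 0 < kap l <= 1 by rewrite k0; lra.
  have o01 : 0 <= (1 : R) <= 1 by rewrite ler01 lexx.
  rewrite [lgone _]/(0 : E) (sr_dist_gexp0 k01 o01) mul1r lee_fin.
  rewrite -ler_sqr ?nnegrE ?ell_ge0// sqr_ell /ell2.
  have s i : l 0 i ^+ 2 <= 2 ^+ 2.
    by rewrite -[l 0 i ^+ 2]real_normK ?num_real// ler_sqr ?nnegrE.
  by have := s i0; have := s i1; have := s i2; lra.
- exact: compact_borel.
- rewrite gvol_compact// andbT (lt_le_trans _ vE)// lte_fin expr1n mulr1 mulr_gt0//.
  exact: bvol_gt0.
Qed.

Definition genset : set (borel R 5) := (fun l => gexp l 1) @` box (genlo 1) (genhi 1).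

Lemma gen_lt t i : 0 < t -> genlo t i < genhi t i.
Proof. by move=> t0; move: i; apply: forall_ord5; rewrite /genlo /genhi /=; lra. Qed.

Lemma genset_test : test_sets (@gCarnot R) gvol genset.
Proof.
apply: (@gexp_image_test _ _ (1 / 2)); first by lra.
  by move=> i; apply: gen_lt.
by move=> l; apply: gen_good; rewrite ltr01 lexx.
Qed.

(** By [gexp_scale], dilating the time-one image of the box for [t] gives points of [Z_t]. The box
    contributes [t ^+ 2] and the dilation [t ^+ 7], with a constant uniform in [t]. *)
Lemma genset_interp : exists2 c, 0 < c & forall t, 0 < t <= 1 ->
  ((c * t ^+ 9)%:E <= vol_interp (@gCarnot R) gvol t genset)%E.
Proof.
have [|c c0 hc] := @gexp_image_lower (1 / 2); first by lra.
exists (c * bvol (genlo 1) (genhi 1)).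
  by rewrite mulr_gt0// bvol_gt0// => i; exact: gen_lt.
move=> t t01; have /andP[t0 t1] := t01.
have gb l : box (genlo t) (genhi t) l -> good (1 / 2) l by exact: gen_good.
have := hc _ _ t (fun i => gen_lt i t0) t0 gb.
have -> : bvol (genlo t) (genhi t) * t ^+ 7 * c = c * bvol (genlo 1) (genhi 1) * t ^+ 9.
  by rewrite !bvolE /genlo /genhi /=; field.
move=> /le_trans; apply; set A := _ @` _.
have mA : measurable (A : set (borel R 5)).
  by apply: compact_borel; apply: gexp_image_compact => l /gb[].
rewrite /vol_interp -(measurable_mu_extE gvol mA); apply: le_mu_ext => _ [l bl <-].
have tn : t != 0 by rewrite gt_eqF.
have [k0 k1 _ _] := gb l bl.
have ti : 0 < t^-1 by rewrite invr_gt0.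
pose l1 := scale t^-1 l.
have ls : scale t l1 = l by apply: eq_row5; rewrite !ptE //; field.
have bl1 : box (genlo 1) (genhi 1) l1.
  apply: forall_ord5; rewrite ptE; [exact: (bl i0)|exact: (bl i1)|exact: (bl i2)| |].
  - have := bl i3; rewrite /genlo /genhi /= => /andP[h1 h2].
    by apply/andP; split; rewrite [t^-1 * _]mulrC; [rewrite ler_pdivlMr//|rewrite ler_pdivrMr//]; lra.
  - have := bl i4; rewrite /genlo /genhi /= => /andP[h1 h2].
    by apply/andP; split; rewrite [t^-1 * _]mulrC; [rewrite ler_pdivlMr//|rewrite ler_pdivrMr//]; lra.
have g1 : 0 < (1 : R) <= 1 by rewrite ltr01 lexx.
have [q0 q1 _ _] := gen_good g1 bl1.
rewrite /dil -ls -gexp_scale//; apply: gexp_in_geo_interp.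
- by rewrite q0; lra.
- by rewrite t1 ltW.
- by exists l1.
Qed.

(** The exponent 10 belongs to the set defining [N_GEO]: against [t ^+ 10], the lower bound of order
    [t ^+ 9] makes the ratio for [genset] grow like [1 / t]. *)
Lemma geodesic_dimension_le10 : (N_GEO (@gCarnot R) gvol <= 10%:E)%E.
Proof.
apply: ereal_inf_lbound; exists 10 => //; split => //.
apply/eqP; rewrite eq_le leey /=.
apply: le_trans; last first.
  by apply: ereal_sup_ubound; exists genset => //; exact: genset_test.
have [c c0 hc] := genset_interp.
have [_ _ /andP[v0 vy]] := genset_test.
have vE : gvol genset = (fine (gvol genset))%:E.
  by rewrite fineK// ge0_fin_numE// measure_ge0.
set V := fine _ in vE; rewrite vE in v0 vy; rewrite lte_fin in v0.
rewrite /limf_esup; apply: le_ereal_inf_tmp => _ [A [e /= e0 eA] <-].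
rewrite leye_eq; apply/eqP/eq_infty => M.
(* A time in the given neighbourhood of 0 at which the ratio, at least [c / (d * V)], is at least
   [M]. *)
pose d := Num.min (Num.min (e / 2) 1) (c / (V * (`|M| + 1))).
have M1 : 0 < `|M| + 1 by have := normr_ge0 M; lra.
have d0 : 0 < d by rewrite !lt_min ltr01 !divr_gt0// mulr_gt0.
have d1 : d <= 1 by rewrite !ge_min lexx orbT.
have dM : d <= c / (V * (`|M| + 1)) by rewrite ge_min lexx orbT.
have de : d <= e / 2 by rewrite !ge_min lexx.
apply: (@le_trans _ _ (vol_interp (@gCarnot R) gvol d genset / ((d `^ 10)%:E * gvol genset))%E); last first.
  apply: ereal_sup_ubound; exists d => //; apply: eA => //=.
  by rewrite /ball /= sub0r normrN gtr0_norm//; lra.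
rewrite vE -EFinM powR_mulrn ?(ltW d0)// inver.
have D0 : 0 < d ^+ 10 * V by rewrite mulr_gt0// exprn_gt0.
rewrite gt_eqF//.
apply: (@le_trans _ _ ((c * d ^+ 9)%:E * (d ^+ 10 * V)^-1%:E)%E); last first.
  apply: lee_wpmul2r; first by rewrite lee_fin invr_ge0 ltW.
  by apply: hc; rewrite d0.
rewrite -EFinM lee_fin ler_pdivlMr// exprSr.
have V1 : 0 < V * (`|M| + 1) by rewrite mulr_gt0.
have h : d * (V * (`|M| + 1)) <= c by rewrite -ler_pdivlMr.
have h2 : d * (V * M) <= c.
  apply: le_trans h; rewrite ler_pM2l// ler_pM2l//; have := ler_norm M; lra.
rewrite (_ : M * _ = d ^+ 9 * (d * (V * M))); last by ring.
by rewrite [leRHS]mulrC ler_pM2l// exprn_gt0.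
Qed.

End GeodesicDimension.

(** * Lower bound for the curvature exponent *)

Section CurvatureExponent.
Context {R : realType}.
Local Notation E := 'rV[R]_5.
Implicit Types (l x : E) (t : R).

Lemma spe_growth t l : 0 < t <= 1 / 64 -> box (spelo t) (spehi t) l ->
  [/\ `|gA l t| <= 2 * t ^+ 2, `|gM l t| <= 2 * t ^+ 3 & `|gS l t| <= 4 * t ^+ 5].
Proof.
move=> t01 bl; have [/andP[k0 _] ub /andP[th1 th2] _] := spe_bounds t01 bl.
have /andP[t0 t1] := t01.
have hA z : 0 <= z <= t -> `|gA l z| <= 2 * t ^+ 2.
  move=> /andP[z0 zt]; apply: (le_trans (gA_upper k0 z0)).
  have z2 : z ^+ 2 <= t ^+ 2 by rewrite ler_sqr ?nnegrE// ltW.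
  have a1 : `|l 0 i0| * z <= t * t by rewrite ler_pM.
  have a2 : `|th l| * z ^+ 2 <= 1 * t ^+ 2.
    by rewrite ler_pM// ?sqr_ge0// ler_norml; apply/andP; split; lra.
  by have := sqr_ge0 t; lra.
split; first by apply: hA; rewrite lexx ltW.
- have [z zt] := MVT_le (gM_derive k0) (ltW t0); rewrite gM0 !subr0 => ->.
  rewrite normrM (gtr0_norm t0) exprSr mulrA ler_pM2r//; exact: hA.
- have [z zt] := MVT_le (gS_derive k0) (ltW t0); rewrite gS0 !subr0 => ->.
  rewrite normrM (gtr0_norm t0) [t ^+ 5]exprSr mulrA ler_pM2r// ger0_norm ?sqr_ge0//.
  by have := sqr_le2 (hA z zt); rewrite exprMn => h; lra.
Qed.

Lemma grid_point (x B d : R) m : 0 < d -> `|x| <= B -> 2 * B / d < m%:R ->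
  exists2 i, (i < m)%N & 0 <= x - (- B + i%:R * d) <= d.
Proof.
move=> d0; rewrite ler_norml => /andP[x1 x2] hm.
have y0 : 0 <= (x + B) / d by rewrite divr_ge0 ?(ltW d0)//; lra.
have /andP[h1 h2] := Num.Theory.truncn_itv y0.
set i := Num.truncn _ in h1 h2; exists i.
  rewrite -(ltr_nat R) (le_lt_trans h1)// (le_lt_trans _ hm)//.
  by rewrite ler_pM2r ?invr_gt0//; lra.
move: h1 h2; rewrite ler_pdivlMr// ltr_pdivrMr// -natr1 mulrDl mul1r => h1 h2.
by apply/andP; split; lra.
Qed.

(** Half-widths of the covering cubes: the bound on [gA], the mesh of the b-grids, and the error of
    [spe_coord] in the c-coordinates. *)
Definition spw t (i : 'I_5) : R :=
  nth 0 [:: 2 * t ^+ 2; t ^+ 3; t ^+ 3; 21 * t ^+ 5; 21 * t ^+ 5] i.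

(* [r] is a grid approximation, of mesh [t ^+ 4], of [gM l t / t]; [b1] and [b2]
   run through grids of mesh [t ^+ 3]. *)
Definition spcenter t (i j k : nat) : E :=
  let r := - (2 * t ^+ 2) + i%:R * t ^+ 4 in
  let b1 := - (3 * t) + j%:R * t ^+ 3 in
  let b2 := - (3 * t) + k%:R * t ^+ 3 in
  pt 0 b1 b2 (r * b1) (r * b2).

(** The digits of [k] in base [m] are the three grid indices, for [r], [b1] and [b2]. The
    a-coordinate needs no grid, since one cube covers its whole range. *)
Definition spcube t m (k : nat) : set (borel R 5) :=
  ccube (spw t) 1 (spcenter t (k %/ m %/ m) (k %/ m %% m) (k %% m)).

(** With [b = t be + M p], eliminating [be] from [M be + S p] leaves
    [(M / t) b + (S - M ^+ 2 / t) p], where the last term is [O(t^5)]. Rounding [M / t] and [b] to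
    the grids costs [O(t^5)] too. *)
Lemma spe_coord (t be p M S r' b' : R) : 0 < t <= 1 / 64 -> `|be| <= 1 -> `|p| <= 1 ->
  `|M| <= 2 * t ^+ 3 -> `|S| <= 4 * t ^+ 5 ->
  0 <= M / t - r' <= t ^+ 4 -> `|r'| <= 2 * t ^+ 2 -> 0 <= t * be + M * p - b' <= t ^+ 3 ->
  `|t * be + M * p| <= 3 * t /\ `|M * be + S * p - r' * b'| <= 21 * t ^+ 5.
Proof.
move=> /andP[t0 t1] be1 p1 hM hS hr hr' hb.
have tn : t != 0 by rewrite gt_eqF.
have hb1 : `|t * be + M * p| <= 3 * t.
  rewrite (le_trans (ler_normD _ _))// !normrM (gtr0_norm t0).
  have a1 : t * `|be| <= t * 1 by rewrite ler_pM2l.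
  have a2 : `|M| * `|p| <= 2 * t ^+ 3 * 1 by rewrite ler_pM.
  have a3 : t ^+ 3 <= t * 1.
    by rewrite exprS ler_pM2l// expr_le1//; lra.
  lra.
split => //; set b := t * be + M * p in hb hb1 *.
have -> : M * be + S * p - r' * b' =
   S * p - M * (M / t) * p + (M / t - r') * b + r' * (b - b') by rewrite /b; field.
have n1 : `|S * p| <= 4 * t ^+ 5 * 1 by rewrite normrM ler_pM.
have n2 : `|M * (M / t) * p| <= 4 * t ^+ 5 * 1.
  rewrite normrM ler_pM// normrM normrM normfV (gtr0_norm t0) mulrA ler_pdivrMr//.
  have : `|M| * `|M| <= 2 * t ^+ 3 * (2 * t ^+ 3) by rewrite ler_pM.
  by lra.
have n3 : `|(M / t - r') * b| <= t ^+ 4 * (3 * t).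
  by rewrite normrM ler_pM//; case/andP: hr => h1 h2; rewrite ger0_norm.
have n4 : `|r' * (b - b')| <= 2 * t ^+ 2 * t ^+ 3.
  by rewrite normrM ler_pM//; case/andP: hb => h1 h2; rewrite ger0_norm.
move: n1 n2 n3 n4; rewrite !ler_norml => /andP[? ?] /andP[? ?] /andP[? ?] /andP[? ?].
apply/andP; split; lra.
Qed.

(** The grid for [r] spans [4 n^2] meshes and those for [b1] and [b2] span [6 n^2], so [7 n^2]
    points suffice for each; [t = 1 / n] makes this count an integer. *)
Lemma spe_cover n l : (64 <= n)%N -> let t := n%:R^-1 : R in let m := (7 * n ^ 2)%N in
  box (spelo t) (spehi t) l ->
  exists2 k, (k < m * m * m)%N & spcube t m k (gexp l t).
Proof.
move=> n64 t m bl.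
have n0 : 0 < n%:R :> R by rewrite ltr0n (leq_trans _ n64).
have t0 : 0 < t by rewrite invr_gt0.
have t1 : t <= 1 / 64.
  by rewrite /t div1r lef_pV2 ?posrE// (ler_nat R 64).
have t01 : 0 < t <= 1 / 64 by rewrite t0.
have tn : t != 0 by rewrite gt_eqF.
have [hA hM hS] := spe_growth t01 bl.
have mE : m%:R = 7 / t ^+ 2 :> R by rewrite /m /t natrM natrX exprVn invrK.
have it : 0 < (t ^+ 2)^-1 by rewrite invr_gt0 exprn_gt0.
have hr : `|gM l t / t| <= 2 * t ^+ 2.
  by rewrite normrM normfV (gtr0_norm t0) ler_pdivrMr// -mulrA -exprSr.
have [||i im ihr] := @grid_point (gM l t / t) (2 * t ^+ 2) (t ^+ 4) m _ hr.
- by rewrite exprn_gt0.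
- by rewrite mE (_ : 2 * (2 * t ^+ 2) / t ^+ 4 = 4 / t ^+ 2); [lra|field].
have b1 i' : i' \in [:: i1; i2; i3; i4] -> `|l 0 i'| <= 1.
  clear -bl t0 t1; rewrite !inE => /or4P[] /eqP ->; [have := bl i1|have := bl i2|have := bl i3|have := bl i4];
  rewrite /spelo /spehi /= ler_norml => /andP[? ?]; apply/andP; split; lra.
have r'b : `|- (2 * t ^+ 2) + i%:R * t ^+ 4| <= 2 * t ^+ 2.
  move: hr ihr; rewrite !ler_norml => /andP[a1 a2] /andP[a3 a4].
  have i40 : 0 <= i%:R * t ^+ 4 by rewrite mulr_ge0// exprn_ge0// ltW.
  by apply/andP; split; lra.
have gb be p : `|be| <= 1 -> `|p| <= 1 -> exists2 j, (j < m)%N &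
   0 <= t * be + gM l t * p - (- (3 * t) + j%:R * t ^+ 3) <= t ^+ 3.
  move=> hbe hp; apply: grid_point; first by rewrite exprn_gt0.
    rewrite (le_trans (ler_normD _ _))// !normrM (gtr0_norm t0).
    have a1 : t * `|be| <= t * 1 by rewrite ler_pM2l.
    have a2 : `|gM l t| * `|p| <= 2 * t ^+ 3 * 1 by rewrite ler_pM.
    have a3 : t ^+ 3 <= t * 1.
      by rewrite exprS ler_pM2l// expr_le1//; lra.
    lra.
  by rewrite mE (_ : 2 * (3 * t) / t ^+ 3 = 6 / t ^+ 2); [lra|field].
have b1' := b1 i1 isT; have b2' := b1 i2 isT; have b3' := b1 i3 isT; have b4' := b1 i4 isT.
have [j jm hj] := gb _ _ b1' b3'; have [k km hk] := gb _ _ b2' b4'.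
have [_ c1] := spe_coord t01 b1' b3' hM hS ihr r'b hj.
have [_ c2] := spe_coord t01 b2' b4' hM hS ihr r'b hk.
have m0 : (0 < m)%N by apply: leq_ltn_trans im.
exists ((i * m + j) * m + k)%N.
  rewrite (@leq_trans ((i * m + j).+1 * m)%N)// ?mulSn; first by rewrite addnC ltn_add2r.
  rewrite -mulSn leq_pmul2r// (@leq_trans (i.+1 * m)%N)// ?mulSn.
    by rewrite addnC ltn_add2r.
  by rewrite -mulSn leq_pmul2r.
rewrite /spcube divnMDl// (divn_small km) addn0 divnMDl// (divn_small jm) addn0.
rewrite !modnMDl (modn_small jm) (modn_small km).
apply/ccubeP; apply: forall_ord5; rewrite mul1r /spcenter /gexp !ptE /spw /=.
- by rewrite subr0.
- by case/andP: hj => h1 h2; rewrite ger0_norm.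
- by case/andP: hk => h1 h2; rewrite ger0_norm.
- exact: c1.
- exact: c2.
Qed.

Definition spset t : set (borel R 5) := (fun l => gexp l 1) @` box (spelo t) (spehi t).

Lemma spset_interp_le : exists2 C, 0 < C & forall n, (64 <= n)%N ->
  (vol_interp (@gCarnot R) gvol n%:R^-1 (spset n%:R^-1) <= (C * n%:R^-1 ^+ 12)%:E)%E.
Proof.
(* There are [7 ^+ 3 * t^-6] cubes, each of volume [2 ^+ 5 * (2 * 21 ^+ 2) * t ^+ 18]. *)
pose C : R := 7 ^+ 3 * (2 ^+ 5 * (2 * 21 ^+ 2)).
exists C; first by rewrite /C !mulr_gt0// exprn_gt0.
move=> n n64; set t : R := n%:R^-1; set m := (7 * n ^ 2)%N.
have n0 : 0 < n%:R :> R by rewrite ltr0n (leq_trans _ n64).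
have t0 : 0 < t by rewrite invr_gt0.
have t1 : t <= 1 / 64.
  by rewrite /t div1r lef_pV2 ?posrE// (ler_nat R 64).
have t01 : 0 < t <= 1 / 64 by rewrite t0.
have tn : t != 0 by rewrite gt_eqF.
have mE : m%:R = 7 / t ^+ 2 :> R by rewrite /m /t natrM natrX exprVn invrK.
have mQ k : measurable (spcube t m k) by exact: box_borel.
have w0 i : 0 < spw t i.
  by move: i; apply: forall_ord5; rewrite /spw /= ?mulr_gt0// exprn_gt0.
pose U := \big[setU/set0]_(k < m * m * m) spcube t m k.
have mU : measurable U by apply: bigsetU_measurable => k _.
have ZU : geo_interp (@gCarnot R) t (lgone (@gCarnot R)) (spset t) `<=` U.
  apply: subset_trans (_ : (fun l => gexp l t) @` box (spelo t) (spehi t) `<=` _).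
    apply: geo_interp_sub => //; first by rewrite t0; lra.
    by move=> l bl; have [/andP[-> ?] _ _ _] := spe_bounds t01 bl; rewrite /=; lra.
  move=> _ [l bl <-]; have [k km hk] := spe_cover n64 bl.
  by rewrite /U -bigcup_mkord; exists k.
apply: (@le_trans _ _ (gvol U)).
  by rewrite /vol_interp -(measurable_mu_extE gvol mU); apply: le_mu_ext.
apply: (@le_trans _ _ ((m * m * m)%:R * ((2 * 1) ^+ 5 * \prod_i spw t i))%:E).
  apply: (@gvol_cover_le _ _ (spcube t m)) => //.
    by move=> k _; rewrite /spcube gvol_ccube.
  by move=> x; rewrite /U -bigcup_mkord => -[k km hk]; exists k.
rewrite lee_fin (natrM _ (m * m)%N m) (natrM _ m m) mE !big_ord_recr big_ord0 /spw /= mulr1 /C mul1r.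
rewrite le_eqVlt; apply/orP; left; apply/eqP.
set c : R := 21; set d : R := 2 ^+ 5; set e : R := 7; clearbody c d e.
by field.
Qed.

(** Goodness with the fixed constant [1 / 128] makes the packing bound uniform in [t]; only the edge
    [2 * t] of the box in the direction of [u] shrinks. *)
Lemma spset_lower : exists2 c, 0 < c & forall t, 0 < t <= 1 / 64 ->
  test_sets (@gCarnot R) gvol (spset t) /\ ((c * t)%:E <= gvol (spset t))%E.
Proof.
have h0 : 0 < 1 / 128 :> R by lra.
have [c c0 hc] := gexp_image_lower h0.
exists (c * (1 / 2 * (1 / 4) * (1 / 8) * (1 / 8) * 2)); first by rewrite !mulr_gt0//; lra.
move=> t t01; have /andP[t0 t1] := t01.
have lh i : spelo t i < spehi t i.
  by move: i; apply: forall_ord5; rewrite /spelo /spehi /=; lra.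
have gb l : box (spelo t) (spehi t) l -> good (1 / 128) l by exact: spe_good.
split; first exact: gexp_image_test h0 lh gb.
have := hc _ _ 1 lh ltr01 gb.
rewrite (_ : (fun l => dil 1 (gexp l 1)) = fun l => gexp l 1); last first.
  by apply/funext => l; rewrite dil1.
apply: le_trans; rewrite lee_fin bvolE /spelo /spehi /= expr1n le_eqVlt.
by apply/orP; left; apply/eqP; field.
Qed.

(** An admissible [N] satisfies [t^N * c t <= C t^12] for small [t = 1 / n], which is impossible
    below 11. The weaker value [21 / 2] already exceeds 10. *)
Lemma curvature_exponent_ge : (((21%:R / 2)%:E : \bar R) <= N_CE (@gCarnot R) gvol)%E.
Proof.
apply: le_ereal_inf_tmp => _ [N [N0 hN] <-]; rewrite lee_fin leNgt; apply/negP => Nlt.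
have [C C0 hC] := spset_interp_le; have [c c0 hc] := spset_lower.
(* Taking [t = s^2] with [s = 1 / k] turns [t^(21/2)] into the integer power [s^21], while
   [1 / t = k^2] is an integer as the covering requires; [k >= 8] gives [t <= 1 / 64]. The
   contradiction will be [c <= C s]. *)
have [k k8 kC] : exists2 k, (8 <= k)%N & C / c < k%:R.
  exists (8 + (Num.truncn (C / c)).+1)%N; first by rewrite leq_addr.
  by rewrite natrD ltr_pwDl// ltW// truncnS_gt.
have n64 : (64 <= k ^ 2)%N by rewrite (@leq_exp2r 8 k 2).
have k0 : 0 < k%:R :> R by rewrite ltr0n (leq_trans _ k8).
pose s : R := k%:R^-1; have s0 : 0 < s by rewrite invr_gt0.
have := hC _ n64; rewrite natrX -exprVn -/s => hZ.
have s1 : s ^+ 2 <= 1 / 64.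
  rewrite /s exprVn -natrX div1r lef_pV2 ?posrE ?ltr0n ?(leq_trans _ n64)//.
  by rewrite (ler_nat R 64).
have sp : 0 < s ^+ 2 <= 1 / 64 by rewrite exprn_gt0.
have [tst low] := hc _ sp.
have st : 0 <= s ^+ 2 <= 1 by rewrite sqr_ge0; lra.
have h1 := le_trans (hN _ st _ tst) hZ.
have p0 : 0 < (s ^+ 2) `^ N by rewrite powR_gt0// exprn_gt0.
have h2 : (((s ^+ 2) `^ N)%:E * (c * s ^+ 2)%:E <= (C * (s ^+ 2) ^+ 12)%:E)%E.
  by apply: le_trans h1; apply: lee_wpmul2l; rewrite ?lee_fin ?(ltW p0).
rewrite -EFinM lee_fin in h2.
have h3 : s ^+ 21 <= (s ^+ 2) `^ N.
  have -> : s ^+ 21 = (s ^+ 2) `^ (21%:R / 2).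
    rewrite -[s ^+ 2]powR_mulrn ?(ltW s0)// -powRrM mulrC divfK//.
    by rewrite powR_mulrn// ltW.
  by apply: ger_powR; [rewrite exprn_gt0//=; lra|exact: ltW].
have h4 : s ^+ 21 * (c * s ^+ 2) <= C * (s ^+ 2) ^+ 12.
  by apply: le_trans h2; rewrite ler_wpM2r// mulr_ge0 ?sqr_ge0 ?ltW.
have : c <= C * s.
  rewrite -(@ler_pM2l _ (s ^+ 23)) ?exprn_gt0//.
  have -> : s ^+ 23 * c = s ^+ 21 * (c * s ^+ 2) by ring.
  by have -> : s ^+ 23 * (C * s) = C * (s ^+ 2) ^+ 12 by ring.
rewrite leNgt => /negP; apply.
by rewrite /s ltr_pdivrMr// mulrC -ltr_pdivrMr.
Qed.

End CurvatureExponent.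

Theorem corollary1p3 (R : realType) :
  exists (n : nat) (G : carnotGroup R n)
         (vol : {measure set (borel R n) -> \bar R}),
    [/\ step G = 2%N, is_haar G vol & (N_GEO G vol < N_CE G vol)%E].
Proof.
exists 5, gCarnot, gvol.
split.
exact: erefl.
exact: gvol_is_haar.
apply: (le_lt_trans geodesic_dimension_le10); apply: lt_le_trans curvature_exponent_ge.
by rewrite lte_fin; lra.
Qed.
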